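(* Let $(\Delta,g)$ be a rank-two sub-Riemannian structure on a smooth manifold $M$ with a global orthonormal frame $X_1,X_2$, and let $T>0$. A regular abnormal geodesic $\gamma:[0,T]\to M$ has a regular abnormal branching at time $\tau\in(0,T)$ if and only if the function $(0,T]\ni t\mapsto \dim(\mathcal{A}_t)$ is discontinuous at $\tau$.
   Context: Setting: $M$ is a smooth manifold, $\Delta\subset TM$ a smooth totally nonholonomic (bracket-generating) distribution of constant rank $2$, $g$ a Riemannian metric on $\Delta$, and $X_1,X_2$ a fixed global $g$-orthonormal frame of smooth vector fields for $\Delta$. A horizontal curve is an absolutely continuous $\gamma:[0,T]\to M$ with $\dot\gamma=u_1X_1(\gamma)+u_2X_2(\gamma)$ a.e. for some (unique) control $u\in L^2([0,T],\mathbb{R}^2)$; its length is $L(\gamma)=\int_0^T|u(t)|\,dt$, and $d(p,q)$ is the infimum of lengths of horizontal curves from $p$ to $q$. A horizontal curve is a length minimizer if its length equals the distance $d$ between its endpoints; a geodesic is a horizontal curve with constant speed such that every $t\in[0,T]$ has an $\varepsilon>0$ for which the restriction to $[t-\varepsilon,t+\varepsilon]\cap[0,T]$ is a length minimizer. Notation: $\pi:T^*M\to M$ is the projection, $h_X(\lambda)=\langle\lambda,X(\pi(\lambda))\rangle$, $X_{i_1\dots i_k}=[X_{i_1},\dots,[X_{i_{k-1}},X_{i_k}]\dots]$, $h_{i_1\dots i_k}=h_{X_{i_1\dots i_k}}$. For a smooth function $h$ on $T^*M$, $\vec h$ is its Hamiltonian vector field, $\omega(\cdot,\vec h)=dh$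 with $\omega$ the canonical symplectic form (in canonical coordinates $\dot x=\partial_p h$, $\dot p=-\partial_x h$). An abnormal lift of a horizontal curve $\gamma$ with control $u$ is an absolutely continuous $\lambda:[0,T]\to T^*M$ with $\pi\circ\lambda=\gamma$, $\lambda(t)\ne0$, $h_1(\lambda(t))=h_2(\lambda(t))=0$ for all $t$, and $\dot\lambda=u_1\vec h_1(\lambda)+u_2\vec h_2(\lambda)$ a.e. For $t\in(0,T]$, $\mathcal{A}_t\subset T^*_{\gamma(0)}M$ is the vector space consisting of $0$ and of the initial covectors $\lambda(0)$ of all abnormal lifts $\lambda(\cdot)$ of $\gamma|_{[0,t]}$. Let $\Delta_2^\perp=\{h_1=h_2=h_{12}=0\}$, $\Delta_3^\perp=\{h_1=h_2=h_{12}=h_{112}=h_{212}=0\}\subset T^*M$ and $\mathcal{R}=\Delta_2^\perp\setminus\Delta_3^\perp$, a submanifold of $T^*M$. On $\mathcal{R}$ the vector field (tangent to $\mathcal R$) $$\vec G=\frac{-h_{212}}{\sqrt{h_{212}^2+h_{112}^2}}\,\vec h_1+\frac{h_{112}}{\sqrt{h_{212}^2+h_{112}^2}}\,\vec h_2$$ is defined. A regular abnormal path is the projection to $M$ of an integral curve (contained in $\mathcal{R}$) of $\vec G$ or $-\vec G$. It is known that every regular abnormal path is a (unit-speed) geodesic; it is then called a regular abnormal geodesic. A regular abnormal geodesic $\gamma:[0,T]\to M$ has a regular abnormal branching at time $\tau\in(0,T)$ if there exist $\varepsilon_0>0$ and a regular abnormal geodesic $\bar\gamma:[0,\tau+\varepsilon_0]\to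 M$ such that $\bar\gamma|_{[0,\tau]}=\gamma|_{[0,\tau]}$ and $\bar\gamma|_{[0,\tau+\varepsilon]}\neq\gamma|_{[0,\tau+\varepsilon]}$ for all $0<\varepsilon\le\varepsilon_0$. *)

(* Defs.v *)
From HB Require Import structures.
From mathcomp Require Export all_boot all_order all_algebra.
From mathcomp Require Export all_classical all_reals all_analysis.
Set Implicit Arguments.
Unset Strict Implicit.
Unset Printing Implicit Defensive.
Export Order.TTheory GRing.Theory Num.Theory.
Export numFieldNormedType.Exports.
Local Open Scope classical_set_scope.
Local Open Scope ring_scope.

Fixpoint Ck {R : realType} {V W : normedModType R} (k : nat) (U : set V)
    (f : V -> W) : Prop :=
  if k is k'.+1 then
    (forall x, U x -> differentiable f x) /\ (forall v, Ck k' U ('D_v f))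
  else forall x, U x -> {for x, continuous f}.

Definition smooth_on {R : realType} {V W : normedModType R} (U : set V)
    (f : V -> W) : Prop :=
  forall k, Ck k U f.

Definition abs_cont {R : realType} {V : normedModType R} (a b : R)
    (f : R -> V) : Prop :=
  forall e : R, 0 < e -> exists2 d : R, 0 < d &
    forall (m : nat) (x y : 'I_m -> R),
      (forall i, a <= x i /\ x i <= y i /\ y i <= b) ->
      (forall i j, i != j -> y i <= x j \/ y j <= x i) ->
      \sum_i (y i - x i) < d -> \sum_i `|f (y i) - f (x i)| < e.

(** [v] is the derivative of [c] at [t] relative to [0, T]; it is one-sided at
    the endpoints. *)
Definition derivative_on {R : realType} {V : normedModType R} (T : R)
    (c : R -> V) (t : R) (v : V) : Prop :=
  (s - t)^-1 *: (c s - c t) @[s --> within `[0, T] t^'] --> v.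

(** [chart i] and [chart_inv i] are total maps, only meaningful on [chart_dom i]
    and on its image. The choice [chart_at] of a chart around each point is used
    to represent tangent and cotangent vectors. *)
Record smoothManifold (R : realType) (n : nat) := SmoothManifold {
  carrier :> topologicalType ;
  chart_index : Type ;
  chart_dom : chart_index -> set carrier ;
  chart : chart_index -> carrier -> 'rV[R]_n ;
  chart_inv : chart_index -> 'rV[R]_n -> carrier ;
  chart_at : carrier -> chart_index ;
  manifold_hausdorff : hausdorff_space carrier ;
  manifold_second_countable : @second_countable carrier ;
  chart_dom_open : forall i, open (chart_dom i) ;
  chart_img_open : forall i, open (chart i @` chart_dom i) ;
  chart_at_dom : forall p, chart_dom (chart_at p) p ;
  chartK : forall i p, chart_dom i p -> chart_inv i (chart i p) = p ;
  chart_continuous : forall i p, chart_dom i p -> {for p, continuous (chart i)} ;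
  chart_inv_continuous : forall i x, (chart i @` chart_dom i) x ->
    {for x, continuous (chart_inv i)} ;
  transition_smooth : forall i j,
    smooth_on (chart i @` (chart_dom i `&` chart_dom j))
      (chart j \o chart_inv i)
}.

Arguments chart_dom {R n} {s}.
Arguments chart {R n} {s}.
Arguments chart_inv {R n} {s}.
Arguments chart_at {R n} {s}.

(** The Jacobian at [p] of the change of coordinates from chart [i] to chart [j].
    It acts on row vectors on the right: if [v] is the coordinate vector of a
    tangent vector in chart [i], then [v *m transition_jac i j p] is its
    coordinate vector in chart [j]. *)
Definition transition_jac {R : realType} {n : nat} {M : smoothManifold R n}
    (i j : chart_index M) (p : M) : 'M[R]_n :=
  jacobian (chart j \o chart_inv i) (chart i p).

(** Both the tangent space and the cotangent space at [p] are identified with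
    ['rV[R]_n] by means of the coordinates of the chart [chart_at p]. *)
Definition vector_field {R : realType} {n : nat} (M : smoothManifold R n) : Type :=
  M -> 'rV[R]_n.

Definition vf_coord {R : realType} {n : nat} {M : smoothManifold R n}
    (X : vector_field M) (i : chart_index M) (x : 'rV[R]_n) : 'rV[R]_n :=
  let q := chart_inv i x in X q *m transition_jac (chart_at q) i q.

Definition smooth_vf_on {R : realType} {n : nat} {M : smoothManifold R n}
    (U : set M) (X : vector_field M) : Prop :=
  forall i, smooth_on (chart i @` (chart_dom i `&` U)) (vf_coord X i).

Definition smooth_fun_on {R : realType} {n : nat} {M : smoothManifold R n}
    (U : set M) (f : M -> R) : Prop :=
  forall i, smooth_on (chart i @` (chart_dom i `&` U))
              ((f \o chart_inv i) : 'rV[R]_n -> R^o).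

(** In coordinates, [X, Y] = DY(X) - DX(Y), i.e. [X, Y] f = X (Y f) - Y (X f). *)
Definition lie_bracket {R : realType} {n : nat} {M : smoothManifold R n}
    (X Y : vector_field M) : vector_field M :=
  fun p => let i := chart_at p in
    'D_(X p) (vf_coord Y i) (chart i p) - 'D_(Y p) (vf_coord X i) (chart i p).

Definition cotangent {R : realType} {n : nat} (M : smoothManifold R n) : Type :=
  (M * 'rV[R]_n)%type.

(** Canonical coordinates on the cotangent bundle induced by the chart [i], and
    the inverse map; covectors transform by the transposed Jacobian. *)
Definition ct_coord {R : realType} {n : nat} {M : smoothManifold R n}
    (i : chart_index M) (l : cotangent M) : 'rV[R]_n * 'rV[R]_n :=
  (chart i l.1, l.2 *m (transition_jac i (chart_at l.1) l.1)^T).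

Definition ct_of_coord {R : realType} {n : nat} {M : smoothManifold R n}
    (i : chart_index M) (x p : 'rV[R]_n) : cotangent M :=
  let q := chart_inv i x in (q, p *m (transition_jac (chart_at q) i q)^T).

Definition hfun {R : realType} {n : nat} {M : smoothManifold R n}
    (X : vector_field M) (l : cotangent M) : R :=
  \sum_(k < n) l.2 0 k * X l.1 0 k.

(** The tangent space at [l] of the cotangent bundle is identified with
    ['rV[R]_n * 'rV[R]_n] by means of the canonical coordinates induced by the
    chart [chart_at l.1]; in them l.2 is its own fibre coordinate, and the
    Hamiltonian vector field is (dh/dp, - dh/dx). *)
Definition ham_vf {R : realType} {n : nat} {M : smoothManifold R n}
    (h : cotangent M -> R) (l : cotangent M) : 'rV[R]_n * 'rV[R]_n :=
  let i := chart_at l.1 in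
  (\row_k 'D_(delta_mx 0 k)
      ((fun p => h (ct_of_coord i (chart i l.1) p)) : 'rV[R]_n -> R^o) l.2,
   \row_k - 'D_(delta_mx 0 k)
      ((fun x => h (ct_of_coord i x l.2)) : 'rV[R]_n -> R^o) (chart i l.1)).

Definition smooth_section {R : realType} {n : nat} {M : smoothManifold R n}
    (D : M -> {vspace 'rV[R]_n}) (U : set M) (X : vector_field M) : Prop :=
  smooth_vf_on U X /\ (forall p, U p -> X p \in D p).

Definition smooth_distribution2 {R : realType} {n : nat} {M : smoothManifold R n}
    (D : M -> {vspace 'rV[R]_n}) : Prop :=
  (forall p, \dim (D p) = 2) /\
  (forall p : M, exists (U : set M) (Y1 Y2 : vector_field M),
     [/\ open U, U p, smooth_section D U Y1, smooth_section D U Y2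
       & forall q, U q -> D q = <<[:: Y1 q; Y2 q]>>%VS]).

Inductive iterated_bracket {R : realType} {n : nat} {M : smoothManifold R n}
    (D : M -> {vspace 'rV[R]_n}) : vector_field M -> Prop :=
| iterated_bracket_section X :
    smooth_section D setT X -> iterated_bracket D X
| iterated_bracket_bracket X Y :
    iterated_bracket D X -> iterated_bracket D Y ->
    iterated_bracket D (lie_bracket X Y).

Definition bracket_generating {R : realType} {n : nat} {M : smoothManifold R n}
    (D : M -> {vspace 'rV[R]_n}) : Prop :=
  forall p : M, exists (m : nat) (Z : 'I_m -> vector_field M),
    (forall i, iterated_bracket D (Z i)) /\
    <<[seq Z i p | i <- enum 'I_m]>>%VS = fullv.

(** [g p] is only meaningful on [D p]. *)
Definition smooth_metric {R : realType} {n : nat} {M : smoothManifold R n}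
    (D : M -> {vspace 'rV[R]_n}) (g : M -> 'rV[R]_n -> 'rV[R]_n -> R) : Prop :=
  [/\ forall p v w, v \in D p -> w \in D p -> g p v w = g p w v,
      forall p a v v' w, v \in D p -> v' \in D p -> w \in D p ->
        g p (a *: v + v') w = a * g p v w + g p v' w,
      forall p v, v \in D p -> v != 0 -> 0 < g p v v
    & forall (U : set M) X Y, open U ->
        smooth_section D U X -> smooth_section D U Y ->
        smooth_fun_on U (fun p => g p (X p) (Y p))].

Record subRiemannian2 {R : realType} {n : nat} (M : smoothManifold R n) :=
  SubRiemannian2 {
    sr_dist : M -> {vspace 'rV[R]_n} ;
    sr_metric : M -> 'rV[R]_n -> 'rV[R]_n -> R ;
    sr_dist_smooth : smooth_distribution2 sr_dist ;
    sr_dist_generating : bracket_generating sr_dist ;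
    sr_metric_smooth : smooth_metric sr_dist sr_metric
  }.

Definition orthonormal_frame {R : realType} {n : nat} {M : smoothManifold R n}
    (S : subRiemannian2 M) (X1 X2 : vector_field M) : Prop :=
  [/\ smooth_section (sr_dist S) setT X1,
      smooth_section (sr_dist S) setT X2
    & forall p, [/\ sr_metric S p (X1 p) (X1 p) = 1,
                    sr_metric S p (X2 p) (X2 p) = 1
                  & sr_metric S p (X1 p) (X2 p) = 0]].

(** Curves are total functions on [R], only meaningful on [0, T]. *)

Definition ac_curve {R : realType} {n : nat} {M : smoothManifold R n} (T : R)
    (gamma : R -> M) : Prop :=
  forall t, 0 <= t <= T -> exists (i : chart_index M) (e : R), [/\ 0 < e,
    (forall s, 0 <= s <= T -> `|s - t| <= e -> chart_dom i (gamma s))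
    & abs_cont (Num.max 0 (t - e)) (Num.min T (t + e)) (chart i \o gamma)].

Definition ac_lift {R : realType} {n : nat} {M : smoothManifold R n} (T : R)
    (lam : R -> cotangent M) : Prop :=
  forall t, 0 <= t <= T -> exists (i : chart_index M) (e : R), [/\ 0 < e,
    (forall s, 0 <= s <= T -> `|s - t| <= e -> chart_dom i (lam s).1)
    & abs_cont (Num.max 0 (t - e)) (Num.min T (t + e)) (ct_coord i \o lam)].

Definition velocity {R : realType} {n : nat} {M : smoothManifold R n} (T : R)
    (gamma : R -> M) (t : R) (v : 'rV[R]_n) : Prop :=
  derivative_on T (chart (chart_at (gamma t)) \o gamma) t v.

Definition ct_velocity {R : realType} {n : nat} {M : smoothManifold R n} (T : R)
    (lam : R -> cotangent M) (t : R) (v : 'rV[R]_n * 'rV[R]_n) : Prop :=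
  derivative_on T (ct_coord (chart_at (lam t).1) \o lam) t v.

Definition L2_on {R : realType} (T : R) (u : R -> R) : Prop :=
  measurable_fun `[0, T] u /\
  (@lebesgue_measure R).-integrable `[0, T] (EFin \o (fun t => u t ^+ 2)).

(** [gamma] restricted to [0, T] is a horizontal curve with control (u1, u2). *)
Definition horizontal_control {R : realType} {n : nat} {M : smoothManifold R n}
    (X1 X2 : vector_field M) (T : R) (gamma : R -> M) (u1 u2 : R -> R) : Prop :=
  [/\ ac_curve T gamma, L2_on T u1, L2_on T u2
    & {ae (@lebesgue_measure R), forall t, 0 <= t <= T ->
        velocity T gamma t (u1 t *: X1 (gamma t) + u2 t *: X2 (gamma t))}].

Definition abnormal_lift {R : realType} {n : nat} {M : smoothManifold R n}
    (X1 X2 : vector_field M) (T : R) (gamma : R -> M)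
    (lam : R -> cotangent M) : Prop :=
  exists u1 u2 : R -> R, horizontal_control X1 X2 T gamma u1 u2 /\
  [/\ ac_lift T lam,
      forall t, 0 <= t <= T -> (lam t).1 = gamma t,
      forall t, 0 <= t <= T ->
        [/\ (lam t).2 != 0, hfun X1 (lam t) = 0 & hfun X2 (lam t) = 0]
    & {ae (@lebesgue_measure R), forall t, 0 <= t <= T ->
        ct_velocity T lam t
          (u1 t *: ham_vf (hfun X1) (lam t) + u2 t *: ham_vf (hfun X2) (lam t))}].

(** The space A_t, as a subset of the cotangent space at [gamma 0]. *)
Definition abnormal_space {R : realType} {n : nat} {M : smoothManifold R n}
    (X1 X2 : vector_field M) (gamma : R -> M) (t : R) : set 'rV[R]_n :=
  [set xi | xi = 0 \/
     exists2 lam, abnormal_lift X1 X2 t gamma lam & lam 0 = (gamma 0, xi)].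

(** The largest number of linearly independent vectors in [A]; this is the
    dimension of [A] if [A] is a linear subspace. *)
Definition dim_set {R : realType} {n : nat} (A : set 'rV[R]_n) : nat :=
  (\max_(k < n.+1 | `[< exists b : k.-tuple 'rV[R]_n,
      free b /\ (forall v, v \in b -> A v) >]) k)%N.

Definition Delta2_perp {R : realType} {n : nat} {M : smoothManifold R n}
    (X1 X2 : vector_field M) : set (cotangent M) :=
  [set l | [/\ hfun X1 l = 0, hfun X2 l = 0 & hfun (lie_bracket X1 X2) l = 0]].

Definition h112 {R : realType} {n : nat} {M : smoothManifold R n}
    (X1 X2 : vector_field M) : cotangent M -> R :=
  hfun (lie_bracket X1 (lie_bracket X1 X2)).

Definition h212 {R : realType} {n : nat} {M : smoothManifold R n}
    (X1 X2 : vector_field M) : cotangent M -> R :=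
  hfun (lie_bracket X2 (lie_bracket X1 X2)).

Definition Delta3_perp {R : realType} {n : nat} {M : smoothManifold R n}
    (X1 X2 : vector_field M) : set (cotangent M) :=
  Delta2_perp X1 X2 `&` [set l | h112 X1 X2 l = 0 /\ h212 X1 X2 l = 0].

Definition regular_set {R : realType} {n : nat} {M : smoothManifold R n}
    (X1 X2 : vector_field M) : set (cotangent M) :=
  Delta2_perp X1 X2 `\` Delta3_perp X1 X2.

Definition Gvec {R : realType} {n : nat} {M : smoothManifold R n}
    (X1 X2 : vector_field M) (l : cotangent M) : 'rV[R]_n * 'rV[R]_n :=
  let r := Num.sqrt (h212 X1 X2 l ^+ 2 + h112 X1 X2 l ^+ 2) in
  (- h212 X1 X2 l / r) *: ham_vf (hfun X1) l +
  (h112 X1 X2 l / r) *: ham_vf (hfun X2) l.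

(** Continuity of the base curve is required separately because the velocity is
    expressed in a chart which need not contain the whole curve. *)
Definition integral_curve {R : realType} {n : nat} {M : smoothManifold R n}
    (V : cotangent M -> 'rV[R]_n * 'rV[R]_n) (T : R)
    (lam : R -> cotangent M) : Prop :=
  {within `[0, T], continuous (fun t => (lam t).1 : M)} /\
  (forall t, 0 <= t <= T -> ct_velocity T lam t (V (lam t))).

(** Regular abnormal paths are known to be geodesics, and the two names are
    synonyms; no minimality requirement is part of the definition. *)
Definition regular_abnormal_geodesic {R : realType} {n : nat}
    {M : smoothManifold R n} (X1 X2 : vector_field M) (T : R)
    (gamma : R -> M) : Prop :=
  exists lam : R -> cotangent M,
  [/\ integral_curve (Gvec X1 X2) T lam \/
      integral_curve (fun l => - Gvec X1 X2 l) T lam,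
      forall t, 0 <= t <= T -> regular_set X1 X2 (lam t)
    & forall t, 0 <= t <= T -> (lam t).1 = gamma t].

Definition regular_abnormal_branching {R : realType} {n : nat}
    {M : smoothManifold R n} (X1 X2 : vector_field M) (T : R)
    (gamma : R -> M) (tau : R) : Prop :=
  exists (eps0 : R) (gamma' : R -> M),
  [/\ 0 < eps0 /\ tau + eps0 <= T,
      regular_abnormal_geodesic X1 X2 (tau + eps0) gamma',
      forall t, 0 <= t <= tau -> gamma' t = gamma t
    & forall eps, 0 < eps <= eps0 ->
        ~ (forall t, 0 <= t <= tau + eps -> gamma' t = gamma t)].

(* Main.v *)
From mathcomp Require Import ring lra measurable_realfun.
Require Import Defs.
Set Implicit Arguments.
Unset Strict Implicit.
Unset Printing Implicit Defensive.
Local Open Scope classical_set_scope.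
Local Open Scope ring_scope.

(** Let [u] be the control of the regular abnormal geodesic [gamma]. It is continuous and of norm
    one. The equation of an abnormal lift is linear in the covector, and it has exactly one
    solution along [gamma] for each initial covector ([transport_exists], [transport_unique]).
    An abnormal lift of [gamma] on $[0, t]$ is a nonzero transported covector which annihilates
    the frame on $[0, t]$ ([abnormal_lift_flow], [flow_abnormal_lift]). Hence $A_t$ is a vector
    space cut out by conditions on $[0, t]$ that are closed and linear in the initial covector.
    It decreases with [t] and its dimension is continuous from the left; so the dimension is
    discontinuous at [tau] if and only if $A_t\neq A_\tau$ for all $t > \tau$
    ([dim_continuousP]).

    Along a transported covector the derivative of $h_Y$ is $u_1 h_{[X_1,Y]} + u_2 h_{[X_2,Y]}$
    ([flow_hfun_lin]). On an abnormal lift one differentiates $h_1 = h_2 = 0$ and finds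
    $h_{12} = 0$, then $u_1 h_{112} + u_2 h_{212} = 0$ ([abnormal_brackets]). Where
    $(h_{112}, h_{212})\neq 0$ this determines [u] up to sign, and it says that the lift is an
    integral curve of $\vec G$ or $-\vec G$, the sign being that of a determinant
    ([rotation_of_sign]).

    If $A_t\neq A_\tau$ for all $t > \tau$, some $\xi\in A_\tau$ is in none of these $A_t$. Adding
    to the lift of [gamma] a small multiple of the transport of $\xi$ gives on $[0,\tau]$ another
    regular lift of [gamma], with the same sign. Its continuation as an integral curve of the
    same field projects to a regular abnormal geodesic; if that followed [gamma] after [tau] then
    $\xi$ would belong to some later $A_t$ ([branching_of_drop]). Conversely, the initial
    covector of the lift of a branch belongs to $A_\tau$. If it belonged to $A_t$ with $t > \tau$,
    its transport along [gamma] would be an integral curve of the same field as the lift of the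
    branch, with the same value at [tau]; by uniqueness the branch would follow [gamma] after
    [tau] ([drop_of_branching]).

    Three tools carry this. The Hamiltonian equations and the Lie brackets are defined in a chart
    which changes from point to point; they have the same form in all charts because second
    derivatives of transition maps are symmetric ([derive_comm], [derive_vf_coord_change]). An
    absolutely continuous lift with a square integrable control is in fact differentiable at all
    times, by a mean value inequality which tolerates a null set ([ac_mean_value]). Existence for
    the linear and the nonlinear equation comes from [picard]. *)

(** * Derivatives relative to a set *)

(** An explicit form of the derivative relative to a set [D]: one-sided derivatives at the ends
    of a segment need no separate treatment, and derivatives relative to two sets glue. *)
Definition dwithin {R : realType} {V : normedModType R} (D : set R)
    (c : R -> V) (t : R) (v : V) : Prop :=
  forall e : R, 0 < e -> exists2 d : R, 0 < d & forall s, D s -> `|s - t| < d ->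
    `|c s - c t - (s - t) *: v| <= e * `|s - t|.

Definition cwithin {R : realType} {V : normedModType R} (D : set R)
    (c : R -> V) (t : R) : Prop :=
  forall e : R, 0 < e -> exists2 d : R, 0 < d & forall s, D s -> `|s - t| < d ->
    `|c s - c t| < e.

Section Dwithin.
Variable R : realType.
Implicit Types V W : normedModType R.

Lemma derivative_onE V (T : R) (c : R -> V) t v :
  derivative_on T c t v <-> dwithin `[0, T] c t v.
Proof.
rewrite /derivative_on; split.
  move/cvgrPdist_le => H e e0; have := H e e0.
  rewrite near_withinE; case/nbhs_ballP => d /= d0 Hd.
  exists d => // s Ds sd.
  have [->|st] := eqVneq s t; first by rewrite !subrr scale0r subr0 !normr0 mulr0.
  have := Hd s; rewrite /ball /= distrC => /(_ sd st Ds) Hs.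
  have s0 : s - t != 0 by rewrite subr_eq0.
  have -> : c s - c t - (s - t) *: v = - ((s - t) *: (v - (s - t)^-1 *: (c s - c t))).
    by rewrite scalerBr scalerA divff// scale1r opprB.
  by rewrite normrN normrZ mulrC ler_wpM2r.
move=> H; apply/cvgrPdist_le => e e0; have [d d0 Hd] := H e e0.
rewrite near_withinE; apply/nbhs_ballP; exists d => //= s.
rewrite /ball /= distrC => sd st Ds.
have s0 : s - t != 0 by rewrite subr_eq0.
have := Hd s Ds sd.
have -> : c s - c t - (s - t) *: v = - ((s - t) *: (v - (s - t)^-1 *: (c s - c t))).
  by rewrite scalerBr scalerA divff// scale1r opprB.
by rewrite normrN normrZ mulrC ler_pM2r // normr_gt0.
Qed.

Lemma differentiable_taylor V W (f : V -> W) x : differentiable f x ->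
  forall e : R, 0 < e -> exists2 d : R, 0 < d & forall y, `|y - x| < d ->
    `|f y - f x - 'd f x (y - x)| <= e * `|y - x|.
Proof.
move=> /diff_locallyP[_ /eqaddoP H] e e0; case/nbhs_ballP: (H _ e0) => d /= d0 Hd.
exists d => // y yx; have := Hd (y - x); rewrite -ball_normE /ball_ /= sub0r normrN => /(_ yx).
by rewrite !fctE /= subrK opprD addrA.
Qed.

Lemma dwithin_subset V (D D' : set R) (c : R -> V) t v :
  D' `<=` D -> dwithin D c t v -> dwithin D' c t v.
Proof. by move=> sub H e /H[d d0 Hd]; exists d => // s /sub; exact: Hd. Qed.

Lemma dwithin_setU V (D D' : set R) (c : R -> V) t v :
  dwithin D c t v -> dwithin D' c t v -> dwithin (D `|` D') c t v.
Proof.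
move=> H H' e e0; have [d d0 Hd] := H e e0; have [d' d0' Hd'] := H' e e0.
exists (Num.min d d'); first by rewrite lt_min d0.
by move=> s [] Ds; rewrite lt_min => /andP[s1 s2]; [exact: Hd|exact: Hd'].
Qed.

(** Only the germs of the set and of the function at [t] matter; this is how two formulas for a
    curve which agree near [t], such as its readings in two charts, are exchanged. *)
Lemma dwithin_near V (D D' : set R) (c c' : R -> V) t v d :
  0 < d -> (forall s, D' s -> `|s - t| < d -> D s /\ c s = c' s) -> c t = c' t ->
  dwithin D c t v -> dwithin D' c' t v.
Proof.
move=> d0 E Et H e e0; have [k k0 Hk] := H e e0.
exists (Num.min d k); first by rewrite lt_min d0.
move=> s Ds; rewrite lt_min => /andP[sd sk].
by have [Ds' <-] := E s Ds sd; rewrite -Et; exact: Hk.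
Qed.

Lemma dwithin_cst V D (a : V) t : dwithin D (cst a) t 0.
Proof.
by move=> e e0; exists 1 => // s _ _; rewrite /cst subrr sub0r scaler0 oppr0 normr0 mulr_ge0 // ltW.
Qed.

Lemma dwithinD V D (c c' : R -> V) t v v' :
  dwithin D c t v -> dwithin D c' t v' -> dwithin D (fun s => c s + c' s) t (v + v').
Proof.
move=> H H' e e0; have e2 : 0 < e / 2 by rewrite divr_gt0.
have [d d0 Hd] := H _ e2; have [d' d0' Hd'] := H' _ e2.
exists (Num.min d d'); first by rewrite lt_min d0.
move=> s Ds; rewrite lt_min => /andP[s1 s2].
have -> : c s + c' s - (c t + c' t) - (s - t) *: (v + v') =
   (c s - c t - (s - t) *: v) + (c' s - c' t - (s - t) *: v').
  by rewrite scalerDr !opprD (addrACA (c s)) [LHS]addrACA.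
rewrite (le_trans (ler_normD _ _))// (le_trans (lerD (Hd _ Ds s1) (Hd' _ Ds s2)))//.
by rewrite -mulrDl -splitr.
Qed.

Lemma dwithin_sum V D (m : nat) (c : 'I_m -> R -> V) t v :
  (forall i, dwithin D (c i) t (v i)) ->
  dwithin D (fun s => \sum_i c i s) t (\sum_i v i).
Proof.
elim: m c v => [|m IH] c v H.
  rewrite big_ord0 [X in dwithin _ X](_ : _ = cst 0); first exact: dwithin_cst.
  by apply/funext => s; rewrite big_ord0.
rewrite big_ord_recl [X in dwithin _ X](_ : _ = fun s => c ord0 s + \sum_i c (lift ord0 i) s);
  first by apply: dwithinD; [exact: H|apply: IH => i; exact: H].
by apply/funext => s; rewrite big_ord_recl.
Qed.

Lemma dwithin_lipschitz V D (c : R -> V) t v :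
  dwithin D c t v -> exists2 d : R, 0 < d &
    forall s, D s -> `|s - t| < d -> `|c s - c t| <= (`|v| + 1) * `|s - t|.
Proof.
move=> /(_ 1 ltr01) [d d0 Hd]; exists d => // s Ds sd.
have := Hd s Ds sd; rewrite mul1r mulrDl mul1r => H.
rewrite -[c s - c t](subrK ((s - t) *: v)) (le_trans (ler_normD _ _))// addrC lerD//.
by rewrite normrZ mulrC.
Qed.

Lemma dwithin_cwithin V D (c : R -> V) t v : dwithin D c t v -> cwithin D c t.
Proof.
move=> /dwithin_lipschitz[d d0 H] e e0.
have k0 : 0 < `|v| + 1 by rewrite ltr_wpDl.
exists (Num.min d (e / (`|v| + 1))); first by rewrite lt_min d0 divr_gt0.
move=> s Ds; rewrite lt_min => /andP[s1 s2].
by rewrite (le_lt_trans (H _ Ds s1))// mulrC -ltr_pdivlMr.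
Qed.

Lemma dwithin_comp V W D (c : R -> V) (f : V -> W) t v :
  differentiable f (c t) -> dwithin D c t v ->
  dwithin D (f \o c) t ('d f (c t) v).
Proof.
move=> df H e e0.
have [d1 d10 H1] := dwithin_lipschitz H.
set K := `|v| + 1 in H1.
have K0 : 0 < K by rewrite /K ltr_wpDl.
have [L L0 HL] := linear_lipschitz (diff_continuous df).
have e1 : 0 < e / 2 / K by rewrite !divr_gt0.
have e2 : 0 < e / 2 / L by rewrite !divr_gt0.
have [d2 d20 H2] := H _ e2.
have [r r0 Hr] := differentiable_taylor df e1.
exists (Num.min (r / K) (Num.min d1 d2)).
  by rewrite !lt_min divr_gt0// d10.
move=> s Ds; rewrite !lt_min => /and3P[s0 s1 s2] /=.
have cs : `|c s - c t| < r.
  by rewrite (le_lt_trans (H1 _ Ds s1))// mulrC -ltr_pdivlMr.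
have -> : f (c s) - f (c t) - (s - t) *: 'd f (c t) v =
  (f (c s) - f (c t) - 'd f (c t) (c s - c t)) + 'd f (c t) (c s - c t - (s - t) *: v).
  by rewrite [X in _ = _ + X]linearB /= [RHS]addrA subrK; congr (_ - _); rewrite linearZ.
rewrite (le_trans (ler_normD _ _))// [e](splitr e) mulrDl lerD//.
  rewrite (le_trans (Hr _ cs))// (le_trans (ler_wpM2l (ltW e1) (H1 _ Ds s1)))//.
  have -> : e / 2 / K * (K * `|s - t|) = e / 2 * `|s - t| by field; rewrite lt0r_neq0.
  done.
rewrite (le_trans (HL _))// (le_trans (ler_wpM2l (ltW L0) (H2 _ Ds s2)))//.
have -> : L * (e / 2 / L * `|s - t|) = e / 2 * `|s - t| by field; rewrite lt0r_neq0.
done.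
Qed.

Lemma dwithinZ V D (k : R) (c : R -> V) t v :
  dwithin D c t v -> dwithin D (fun s => k *: c s) t (k *: v).
Proof.
move=> H e e0.
have k0 : 0 < `|k| + 1 by rewrite ltr_wpDl.
have [d d0 Hd] := H _ (divr_gt0 e0 k0); exists d => // s Ds sd.
have -> : k *: c s - k *: c t - (s - t) *: (k *: v) = k *: (c s - c t - (s - t) *: v).
  by rewrite !scalerBr !scalerA [k * _]mulrC.
rewrite normrZ (le_trans (ler_wpM2l (normr_ge0 _) (Hd _ Ds sd)))//.
have -> : `|k| * (e / (`|k| + 1) * `|s - t|) = (`|k| / (`|k| + 1)) * (e * `|s - t|).
  by field; rewrite lt0r_neq0.
by rewrite ler_piMl ?mulr_ge0 ?(ltW e0)// ler_pdivrMr// mul1r lerDl.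
Qed.

Lemma dwithinN V D (c : R -> V) t v :
  dwithin D c t v -> dwithin D (fun s => - c s) t (- v).
Proof.
move=> /(dwithinZ (-1)); rewrite scaleN1r.
by under [X in dwithin _ X]eq_fun do rewrite scaleN1r.
Qed.

Lemma dwithinM D (a b : R -> R) t a' b' :
  dwithin D a t a' -> dwithin D b t b' ->
  dwithin D (fun s => a s * b s) t (a' * b t + a t * b').
Proof.
move=> Ha Hb e e0.
have [d1 d10 L] := dwithin_lipschitz Ha; set K := `|a'| + 1 in L.
have K0 : 0 < K by rewrite /K ltr_wpDl.
have x0 : 0 < `|b t| + 1 by rewrite ltr_wpDl.
have y0 : 0 < `|a t| + 1 by rewrite ltr_wpDl.
have e3 : 0 < e / 3 by rewrite divr_gt0.
have [d2 d20 H2] := dwithin_cwithin Hb (divr_gt0 e3 K0).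
have [d3 d30 H3] := Ha _ (divr_gt0 e3 x0).
have [d4 d40 H4] := Hb _ (divr_gt0 e3 y0).
exists (Num.min (Num.min d1 d2) (Num.min d3 d4)); first by rewrite !lt_min d10 d20 d30.
move=> s Ds; rewrite !lt_min => /andP[/andP[s1 s2] /andP[s3 s4]].
set h := s - t in s1 s2 s3 s4 *.
have -> : a s * b s - a t * b t - h *: (a' * b t + a t * b' : R) =
  (a s - a t - h *: (a' : R)) * b t + a t * (b s - b t - h *: (b' : R))
  + (a s - a t) * (b s - b t) by rewrite /GRing.scale /=; ring.
have -> : e * `|h| = e / 3 * `|h| + e / 3 * `|h| + e / 3 * `|h| by field.
rewrite (le_trans (ler_normD _ _))// lerD// ?(le_trans (ler_normD _ _))// ?lerD// normrM.
- have -> : e / 3 * `|h| = (e / 3 / (`|b t| + 1) * `|h|) * (`|b t| + 1).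
    by field; rewrite lt0r_neq0.
  by rewrite ler_pM// ?H3// lerDl.
- have -> : e / 3 * `|h| = (`|a t| + 1) * (e / 3 / (`|a t| + 1) * `|h|).
    by field; rewrite lt0r_neq0.
  by rewrite ler_pM// ?H4// lerDl.
- have -> : e / 3 * `|h| = K * `|h| * (e / 3 / K) by field; rewrite lt0r_neq0.
  by rewrite ler_pM// ?L// ltW// H2.
Qed.

Lemma normr_mx_entry m k (A : 'M[R]_(m, k)) i j : `|A i j| <= `|A|.
Proof. by rewrite [leRHS]mx_normrE; apply: (le_bigmax _ _ (i, j)). Qed.

Lemma normr_mx_le m k (A : 'M[R]_(m, k)) (x : R) : 0 <= x ->
  (forall i j, `|A i j| <= x) -> `|A| <= x.
Proof.
by move=> x0 H; rewrite [leLHS]mx_normrE; apply/bigmax_leP; split => // -[i j] _; exact: H.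
Qed.

Lemma dwithin_entry m k D (c : R -> 'M[R]_(m, k)) t (v : 'M[R]_(m, k)) i j :
  dwithin D c t v -> dwithin D (fun s => c s i j) t (v i j).
Proof.
move=> H e /H[d d0 Hd]; exists d => // s Ds /(Hd _ Ds); apply: le_trans.
by have := normr_mx_entry (c s - c t - (s - t) *: v) i j; rewrite !mxE.
Qed.

Lemma dwithin_row m D (c : R -> 'rV[R]_m) t (v : 'rV[R]_m) :
  (forall j, dwithin D (fun s => c s 0 j) t (v 0 j)) -> dwithin D c t v.
Proof.
move=> H e e0.
have /choice[d Hd] : forall j, exists d : R, 0 < d /\ forall s, D s -> `|s - t| < d ->
    `|c s 0 j - c t 0 j - (s - t) *: (v 0 j : R)| <= e * `|s - t|.
  by move=> j; have [d d0 Hd] := H j e e0; exists d.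
exists (\big[Num.min/1]_j d j).
  by apply: (big_ind (fun x : R => 0 < x)) => // [x y x0 y0|j _]; [rewrite lt_min x0|have [] := Hd j].
move=> s Ds sd; apply: normr_mx_le => [|i j]; first by rewrite mulr_ge0// ltW.
rewrite !mxE ord1; have [_ Hj] := Hd j; apply: (Hj s Ds).
by rewrite (lt_le_trans sd)//; exact: bigmin_le_cond.
Qed.

Lemma dwithin_fst V W D (c : R -> V * W) t v :
  dwithin D c t v -> dwithin D (fun s => (c s).1) t v.1.
Proof.
move=> H e /H[d d0 Hd]; exists d => // s Ds /(Hd _ Ds); apply: le_trans.
by rewrite [leRHS]prod_normE le_max lexx.
Qed.

Lemma dwithin_snd V W D (c : R -> V * W) t v :
  dwithin D c t v -> dwithin D (fun s => (c s).2) t v.2.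
Proof.
move=> H e /H[d d0 Hd]; exists d => // s Ds /(Hd _ Ds); apply: le_trans.
by rewrite [leRHS]prod_normE le_max lexx orbT.
Qed.

Lemma dwithin_pair V W D (c : R -> V * W) t v :
  dwithin D (fun s => (c s).1) t v.1 -> dwithin D (fun s => (c s).2) t v.2 ->
  dwithin D c t v.
Proof.
move=> H1 H2 e e0; have [d d0 Hd] := H1 e e0; have [k k0 Hk] := H2 e e0.
exists (Num.min d k); first by rewrite lt_min d0.
move=> s Ds; rewrite lt_min => /andP[sd sk].
by rewrite [leLHS]prod_normE ge_max Hd// Hk.
Qed.

Lemma dwithin_unique V (a b : R) (c : R -> V) t v v' : a < b -> a <= t <= b ->
  dwithin `[a, b] c t v -> dwithin `[a, b] c t v' -> v = v'.
Proof.
move=> ab /andP[a_t tb] H H'; apply/eqP; rewrite -subr_eq0 -normr_le0.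
apply/ler_addgt0Pr => e e0; rewrite add0r.
have e2 : 0 < e / 2 by rewrite divr_gt0.
have [d d0 Hd] := H _ e2; have [k k0 Hk] := H' _ e2.
have [s [abs st sd sk]] : exists s, [/\ `[a, b]%classic s, s != t, `|s - t| < d & `|s - t| < k].
  have [tb'|bt] := ltP t b.
    exists (Num.min b (t + Num.min d k / 2)).
    have m0 : 0 < Num.min d k by rewrite lt_min d0.
    set m := Num.min d k in m0 *.
    have md : m <= d by rewrite ge_min lexx.
    have mk : m <= k by rewrite ge_min lexx orbT.
    have [H1|H1] := leP b (t + m / 2).
      split; rewrite /= ?in_itv /= ?lexx ?(ltW ab)// ?gt_eqF// ger0_norm; lra.
    by split; rewrite /= ?in_itv /= ?gt_eqF//; try (rewrite ger0_norm; lra); lra.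
  exists (Num.max a (t - Num.min d k / 2)).
  have m0 : 0 < Num.min d k by rewrite lt_min d0.
  set m := Num.min d k in m0 *.
  have md : m <= d by rewrite ge_min lexx.
  have mk : m <= k by rewrite ge_min lexx orbT.
  have [H1|H1] := leP a (t - m / 2).
    by split; rewrite /= ?in_itv /= ?lt_eqF//; try (rewrite ler0_norm; lra); lra.
  split; rewrite /= ?in_itv /= ?lexx ?(ltW ab)// ?lt_eqF//; try (rewrite ler0_norm; lra); lra.
have h0 : 0 < `|s - t| by rewrite normr_gt0 subr_eq0.
rewrite -(ler_pM2l h0) -normrZ.
have -> : (s - t) *: (v - v') =
    (c s - c t - (s - t) *: v') - (c s - c t - (s - t) *: v).
  by rewrite opprB [RHS]addrC addrA subrK scalerBr.
rewrite (le_trans (ler_normB _ _))// (le_trans (lerD (Hk s abs sk) (Hd s abs sd)))//.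
by rewrite -mulrDl -splitr mulrC.
Qed.
End Dwithin.

(** * Subdivision arguments on a segment *)

Section Cousin.
Variable R : realType.

(** Cousin's lemma in the form of an induction principle: a relation between the ends of a segment
    which is transitive and holds on all small segments around each point holds on [[a, b]].
    The supremum of the points that can be reached from [a] is reached, and is [b]. *)
Lemma cousin (a b : R) (Q : R -> R -> Prop) : a <= b ->
  (forall x y z, a <= x -> x <= y -> y <= z -> z <= b -> Q x y -> Q y z -> Q x z) ->
  (forall s, a <= s <= b -> exists2 d : R, 0 < d & forall x y,
     a <= x -> x <= s -> s <= y -> y <= b -> s - x < d -> y - s < d -> Q x y) ->
  Q a b.
Proof.
move=> ab Qtrans Qloc.
pose A := [set x | a <= x <= b /\ Q a x].
have Aa : A a.
  have [|d d0 Hd] := Qloc a; first by rewrite lexx.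
  by split; [rewrite lexx|apply: Hd; rewrite ?subrr].
have supA : has_sup A by split; [exists a|exists b => x [/andP[]]].
have s_ab : a <= sup A <= b.
  apply/andP; split; first exact: (sup_upper_bound supA).
  by apply: ge_sup; [exists a|move=> x [/andP[]]].
have [d d0 Hd] := Qloc _ s_ab; case/andP: s_ab => sa sb.
have [x [/andP[ax xb] Qax] sx] := sup_adherent d0 supA.
have xs : x <= sup A by apply: (sup_upper_bound supA); split => //; apply/andP.
pose y := Num.min b (sup A + d / 2).
have sy : sup A <= y by rewrite /y le_min sb lerDl divr_ge0 // ltW.
have yb : y <= b by rewrite /y ge_min lexx.
have yd : y - sup A < d.
  have : y <= sup A + d / 2 by rewrite /y ge_min lexx orbT.
  by move=> H; lra.
have Qay : Q a y.
  apply: (Qtrans _ x) => //; first exact: le_trans sy.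
  by apply: Hd => //; lra.
have Ay : A y by split => //; rewrite yb andbT (le_trans sa).
have ys : y <= sup A by exact: (sup_upper_bound supA).
move: ys Qay; rewrite /y; have [//|H ys] := leP b (sup A + d / 2).
by exfalso; lra.
Qed.

(** Connectedness of a segment, for properties that are locally decided: being equivalent at both
    ends is transitive, so that [cousin] applies. *)
Lemma itv_connected (a b s0 : R) (P : R -> Prop) : a <= s0 <= b -> P s0 ->
  (forall s, a <= s <= b -> exists2 d : R, 0 < d &
    (forall r, a <= r <= b -> `|r - s| < d -> P r) \/
    (forall r, a <= r <= b -> `|r - s| < d -> ~ P r)) ->
  forall s, a <= s <= b -> P s.
Proof.
move=> /andP[as0 s0b] Ps0 H s /andP[a_s sb].
have key x y : a <= x -> x <= y -> y <= b -> P x <-> P y.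
  move=> ax xy yb; apply: (cousin xy (Q := fun x y => P x <-> P y)).
    by move=> ? ? ? _ _ _ _ [p q] [p' q']; split; auto.
  move=> r /andP[xr ry]; have [|d d0 Hd] := H r.
    by rewrite (le_trans ax)// (le_trans ry).
  exists d => // p q xp pr rq qy pd qd.
  have Hp : a <= p <= b by apply/andP; lra.
  have Hq : a <= q <= b by apply/andP; lra.
  have dp : `|p - r| < d by rewrite ler0_norm; lra.
  have dq : `|q - r| < d by rewrite ger0_norm; lra.
  case: Hd => Hd; first by split => _; apply: Hd.
  by split => /Hd; [move=> /(_ Hp dp)|move=> /(_ Hq dq)].
have [ss|/ltW ss] := leP s0 s; first by apply/(key s0 s).
by apply/(key s s0).
Qed.

Lemma itv0_le (t T s : R) : t <= T -> 0 <= s <= t -> 0 <= s <= T.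
Proof. by move=> tT /andP[-> h]; exact: le_trans tT. Qed.

Lemma itv0_subset (t T : R) : t <= T -> `[0, t]%classic `<=` `[0, T]%classic.
Proof. by move=> tT r /=; rewrite !in_itv /=; exact: itv0_le. Qed.

Lemma between_dist (r s q : R) : Num.min r s <= q <= Num.max r s -> `|q - s| <= `|r - s|.
Proof.
have := ler_norm (r - s); have := ler_norm (s - r); rewrite (distrC s r).
by case: (leP r s) => ? ? ? /andP[? ?]; rewrite ler_norml; apply/andP; lra.
Qed.

Lemma between_itv (a b r s q : R) : a <= r <= b -> a <= s <= b ->
  Num.min r s <= q <= Num.max r s -> a <= q <= b.
Proof. by move=> /andP[? ?] /andP[? ?]; case: (leP r s) => ? /andP[? ?]; apply/andP; lra. Qed.

Lemma dist_min_max (V : normedModType R) (f : R -> V) (r s : R) :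
  `|f (Num.max r s) - f (Num.min r s)| = `|f r - f s|.
Proof. by case: (leP r s) => // _; rewrite distrC. Qed.

Lemma max_sub_min (r s : R) : Num.max r s - Num.min r s = `|r - s|.
Proof.
case: (leP r s) => h; last by rewrite gtr0_norm// subr_gt0.
by rewrite ler0_norm ?subr_le0// opprB.
Qed.

Lemma clamp_lipschitz (a b r r' : R) :
  `|Num.max a (Num.min r b) - Num.max a (Num.min r' b)| <= `|r - r'|.
Proof.
have minL : `|Num.min r b - Num.min r' b| <= `|r - r'|.
  have := ler_norm (r - r'); have := ler_norm (r' - r); rewrite (distrC r' r).
  by case: (leP r b) => ?; case: (leP r' b) => ? ? ?; rewrite ler_norml; apply/andP; lra.
rewrite (le_trans _ minL)//; move: (Num.min r b) (Num.min r' b) => v w.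
have := ler_norm (v - w); have := ler_norm (w - v); rewrite (distrC w v).
by case: (leP a v) => ?; case: (leP a w) => ? ? ?; rewrite ler_norml; apply/andP; lra.
Qed.

End Cousin.

(** * Mean value inequalities *)

Section MeanValue.
Variable R : realType.
Implicit Types V W : normedModType R.
Local Notation mu := (@lebesgue_measure R).

(** Bounds the slopes of the chords from [s] in the limit, without naming a derivative. *)
Definition slope_bound V (a b : R) (f : R -> V) (K s : R) : Prop :=
  forall e : R, 0 < e -> exists2 d : R, 0 < d & forall r, a <= r <= b ->
    `|r - s| < d -> `|f r - f s| <= (K + e) * `|r - s|.

Lemma dwithin_slope_bound V (a b : R) (f : R -> V) K s v :
  dwithin `[a, b] f s v -> `|v| <= K -> slope_bound a b f K s.
Proof.
move=> H vK e /H[d d0 Hd]; exists d => // r rab rs.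
have := Hd r; rewrite /= in_itv /= => /(_ rab rs) Hr.
rewrite -[f r - f s](subrK ((r - s) *: v)) (le_trans (ler_normD _ _))//.
by rewrite addrC mulrDl lerD// normrZ mulrC ler_wpM2r.
Qed.

Lemma slope_bound_ends V (a b : R) (f : R -> V) K s : 0 <= K ->
  slope_bound a b f K s -> forall e : R, 0 < e -> exists2 d : R, 0 < d &
  forall x y, a <= x -> x <= s -> s <= y -> y <= b -> s - x < d -> y - s < d ->
  `|f y - f x| <= (K + e) * (y - x).
Proof.
move=> K0 H e /H[d d0 Hd]; exists d => // x y ax xs sy yb xd yd.
have -> : f y - f x = (f y - f s) - (f x - f s) by rewrite opprB addrA subrK.
have -> : (K + e) * (y - x) = (K + e) * `|y - s| + (K + e) * `|x - s|.
  by rewrite ger0_norm ?ler0_norm ?subr_ge0 ?subr_le0//; ring.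
rewrite (le_trans (ler_normB _ _))// lerD//; apply: Hd; try (apply/andP; lra).
  by rewrite ger0_norm; lra.
by rewrite ler0_norm; lra.
Qed.

(** The null set is covered by an open set of small measure, on which absolute continuity
    controls the increments; elsewhere the slope does, and [cousin] chains the local estimates. *)
Lemma ac_mean_value V (a b : R) (f : R -> V) (N : set R) (K : R) : a <= b -> 0 <= K ->
  abs_cont a b f -> mu.-negligible N ->
  (forall s, a <= s <= b -> ~ N s -> slope_bound a b f K s) ->
  `|f b - f a| <= K * (b - a).
Proof.
move=> ab K0 acf [A [mA A0 NA]] H.
have main : forall e : R, 0 < e -> `|f b - f a| <= (K + e) * (b - a) + e.
  move=> e e0; have [d d0 Hd] := acf e e0.
  have Afin : (mu A < +oo)%E by rewrite A0 ltry.
  have [U [oU AU Ud]] := lebesgue_regularity_outer mA Afin d0.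
  have mU : measurable U by exact: open_measurable.
  have {}Ud : (mu U < d%:E)%E.
    rewrite -(setDUK AU) measureU//; first by rewrite [X in (X + _)%E]A0 add0e.
      exact: measurableD.
    by rewrite setDE setICA setICr setI0.
  (* [I] lists the segments of the subdivision whose tag lies in [N]; they lie in [U], and
     measuring [U] between [x] and [y] makes the bound on their total length additive. *)
  pose Q x y := exists I : seq (R * R),
    [/\ forall p, p \in I -> [/\ x <= p.1, p.1 <= p.2 & p.2 <= y],
        pairwise (fun p q : R * R => p.2 <= q.1) I,
        ((\sum_(p <- I) (p.2 - p.1))%:E <= mu (U `&` `[x, y[))%E &
        `|f y - f x| <= (K + e) * (y - x) + \sum_(p <- I) `|f p.2 - f p.1|].
  have [I [I1 I2 I3 I4]] : Q a b.
    apply: cousin => //.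
      move=> x y z _ xy yz _ [I [I1 I2 I3 I4]] [J [J1 J2 J3 J4]]; exists (I ++ J); split.
      - move=> p; rewrite mem_cat => /orP[/I1[]|/J1[]] h1 h2 h3; split => //.
          exact: le_trans yz.
        exact: le_trans h1.
      - rewrite pairwise_cat I2 J2 !andbT; apply/allrelP => p q /I1[_ _ h] /J1[h' _ _].
        exact: le_trans h'.
      - rewrite big_cat /= EFinD (le_trans (leeD I3 J3))//.
        rewrite -measureU; first last.
        + apply/seteqP; split => // r /= [[_ +] [_ +]]; rewrite !in_itv /=.
          by move=> /andP[_ h] /andP[h' _]; have := lt_le_trans h h'; rewrite ltxx.
        + by apply: measurableI.
        + by apply: measurableI.
        apply: le_measure; rewrite ?inE; [by apply: measurableU; apply: measurableI|by apply: measurableI|].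
        move=> r /= [[Ur]|[Ur]]; rewrite !in_itv /= => /andP[h1 h2]; split => //; rewrite ?in_itv /=.
          by rewrite h1 (lt_le_trans h2).
        by rewrite h2 (le_trans xy).
      - have -> : f z - f x = (f y - f x) + (f z - f y) by rewrite [RHS]addrC [RHS]addrA subrK.
        rewrite big_cat /= (le_trans (ler_normD _ _))//; move: (lerD I4 J4); lra.
    move=> s sab; have [Ns|Ns] := pselect (N s).
      have /nbhs_ballP[r /= r0 Hr] : nbhs s U by apply: open_nbhs_nbhs; split => //; apply/AU/NA.
      exists r => // x y ax xs sy yb xr yr; exists [:: (x, y)]; rewrite !big_seq1 /=; split.
      - by move=> p; rewrite inE => /eqP -> /=; split => //; exact: le_trans sy.
      - by [].
      - have -> : U `&` `[x, y[ = `[x, y[%classic.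
          apply/setIidPr => z /=; rewrite in_itv /= => /andP[xz zy]; apply: Hr.
          rewrite /ball /= ltr_norml; apply/andP; lra.
        have xy := le_trans xs sy.
        by rewrite lebesgue_measure_itv /= lte_fin; case: ltgtP xy => // -> _; rewrite subrr.
      - rewrite lerDr mulr_ge0// ?subr_ge0 ?(le_trans xs)//; lra.
    have [d' d'0 Hd'] := slope_bound_ends K0 (H s sab Ns) e0.
    exists d' => // x y ax xs sy yb xr yr; exists [::]; rewrite !big_nil; split => //.
    by rewrite addr0; exact: Hd'.
  rewrite (le_trans I4)// lerD2l.
  have := Hd (size I) (fun i => (nth (0, 0) I i).1) (fun i => (nth (0, 0) I i).2).
  have E (F : R * R -> R) : \sum_(i < size I) F (nth (0, 0) I i) = \sum_(p <- I) F p.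
    by rewrite (big_nth (0, 0)) big_mkord.
  rewrite (E (fun p => p.2 - p.1)) (E (fun p => `|f p.2 - f p.1|)).
  move=> /(_ _ _ _)/ltW; apply.
  - by move=> i; have [] := I1 _ (mem_nth (0, 0) (ltn_ord i)).
  - move=> i j ij; move/(pairwiseP (0, 0)): I2 => I2.
    by move: ij; rewrite neq_ltn => /orP[] ij; [left|right]; apply: I2; rewrite ?inE.
  - rewrite -lte_fin (le_lt_trans I3)// (le_lt_trans _ Ud)//.
    by apply: le_measure; rewrite ?inE//; apply: measurableI.
apply/ler_addgt0Pr => e e0.
have k0 : 0 < b - a + 1 by lra.
have := main _ (divr_gt0 e0 k0); congr (_ <= _); field; lra.
Qed.

Lemma mean_value V (a b : R) (f : R -> V) (K : R) : a <= b -> 0 <= K ->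
  (forall s, a <= s <= b -> slope_bound a b f K s) ->
  `|f b - f a| <= K * (b - a).
Proof.
move=> ab K0 H; apply/ler_addgt0Pr => e e0.
have k0 : 0 < b - a + 1 by lra.
pose k := e / (b - a + 1).
have k1 : 0 < k by exact: divr_gt0.
have : `|f b - f a| <= (K + k) * (b - a).
  apply: (cousin (Q := fun x y => `|f y - f x| <= (K + k) * (y - x)) ab).
    move=> x y z _ _ _ _ h1 h2.
    have -> : f z - f x = (f y - f x) + (f z - f y) by rewrite [RHS]addrC [RHS]addrA subrK.
    rewrite (le_trans (ler_normD _ _))//; lra.
  by move=> s /H/(slope_bound_ends K0)/(_ k k1).
move=> h; rewrite (le_trans h)// mulrDl lerD2l /k -mulrA ler_piMr ?(ltW e0)//.
by rewrite mulrC ler_pdivrMr//; lra.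
Qed.

Lemma dwithin_mean_value V (a b : R) (f f' : R -> V) (K : R) : 0 <= K ->
  (forall s, a <= s <= b -> dwithin `[a, b] f s (f' s)) ->
  (forall s, a <= s <= b -> `|f' s| <= K) ->
  forall x y, a <= x <= b -> a <= y <= b -> `|f y - f x| <= K * `|y - x|.
Proof.
move=> K0 H HK.
have main x y : a <= x -> x <= y -> y <= b -> `|f y - f x| <= K * (y - x).
  move=> ax xy yb; apply: mean_value => // s /andP[xs sy].
  have sab : a <= s <= b by rewrite (le_trans ax)// (le_trans sy).
  apply: dwithin_slope_bound (HK s sab); apply: dwithin_subset (H s sab).
  by move=> r /=; rewrite !in_itv /= => /andP[h1 h2]; rewrite (le_trans ax)// (le_trans h2).
move=> x y /andP[ax xb] /andP[ay yb].
have [xy|/ltW yx] := leP x y; first by rewrite ger0_norm ?subr_ge0// main.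
by rewrite distrC [`|y - x|]distrC ger0_norm ?subr_ge0// main.
Qed.

(** A linear differential inequality propagates a zero, here on an interval so short that
    each application of the mean value inequality halves the bound. *)
Lemma dwithin_zero V (a b s0 : R) (c c' : R -> V) (C B : R) : 0 <= C ->
  C * (b - a) <= 1 / 2 -> a <= s0 <= b -> c s0 = 0 ->
  (forall s, a <= s <= b -> `|c s| <= B) ->
  (forall s, a <= s <= b -> dwithin `[a, b] c s (c' s)) ->
  (forall s, a <= s <= b -> `|c' s| <= C * `|c s|) ->
  forall s, a <= s <= b -> c s = 0.
Proof.
move=> C0 Cab s0ab cs0 cB dc Hc'.
have B0 : 0 <= B by exact: le_trans (cB s0 s0ab).
(* each use of the mean value inequality between [s0] and [s] gains a factor [C * (b - a)] *)
have main k : forall s, a <= s <= b -> `|c s| <= B / 2 ^+ k.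
  elim: k => [|k IH] s sab; first by rewrite expr0 divr1 cB.
  have L0 : 0 <= B / 2 ^+ k by rewrite divr_ge0 ?exprn_ge0.
  have := @dwithin_mean_value _ a b c c' (C * (B / 2 ^+ k)) _ dc _ s0 s s0ab sab.
  rewrite cs0 subr0 => /(_ _ _)/le_trans; apply.
  - exact: mulr_ge0.
  - by move=> r rab; rewrite (le_trans (Hc' r rab))// ler_wpM2l// IH.
  - have -> : B / 2 ^+ k.+1 = (1 / 2) * (B / 2 ^+ k).
      by rewrite exprS; field; rewrite expf_neq0.
    rewrite mulrAC ler_wpM2r// (le_trans _ Cab)// ler_wpM2l//.
    case/andP: s0ab => ? ?; case/andP: sab => ? ?.
    by rewrite ler_norml; apply/andP; split; lra.
move=> s sab; apply/eqP; rewrite -normr_le0; apply/ler_addgt0Pr => e e0; rewrite add0r.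
have [k Hk] : exists k, B / 2 ^+ k <= e.
  exists (Num.trunc (B / e)).+1; rewrite ler_pdivrMr ?exprn_gt0// mulrC -ler_pdivrMr//.
  rewrite (le_trans (ltW (truncnS_gt _)))// ltW// -natrX ltr_nat; exact: ltn_expl.
exact: le_trans (main k s sab) Hk.
Qed.

Lemma lipschitz_abs_cont V (a b : R) (f : R -> V) (K : R) :
  (forall x y, a <= x <= b -> a <= y <= b -> `|f y - f x| <= K * `|y - x|) ->
  abs_cont a b f.
Proof.
move=> H e e0.
have k0 : 0 < `|K| + 1 by rewrite ltr_wpDl.
exists (e / (`|K| + 1)); first exact: divr_gt0.
move=> m x y Hxy _ Hsum.
apply: (@le_lt_trans _ _ ((`|K| + 1) * \sum_i (y i - x i))); last by rewrite mulrC -ltr_pdivlMr.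
rewrite mulr_sumr; apply: ler_sum => i _; have [h1 [h2 h3]] := Hxy i.
rewrite (le_trans (H (x i) (y i) _ _))//.
- by rewrite h1 (le_trans h2).
- by rewrite h3 (le_trans h1).
rewrite ger0_norm ?subr_ge0// ler_wpM2r ?subr_ge0//.
by rewrite (le_trans (ler_norm _))// lerDl.
Qed.

End MeanValue.

(** * Ordinary differential equations *)

Section Picard.
Variable R : realType.
Implicit Types V W : normedModType R.

(** The two properties of the space of values on which Picard iteration rests. They hold for the
    real line and pass to row vectors and to products coordinate by coordinate, which is how the
    cotangent coordinates are reached. *)
Definition has_primitives V : Prop := forall f : R -> V, continuous f ->
  forall (t0 : R) (y0 : V) (a : R), exists F : R -> V, F t0 = y0 /\
    forall t, `|t - t0| <= a -> dwithin setT F t (f t).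

(** Completeness for sequences with geometrically decreasing steps, with the rate of convergence;
    the iterates converge at that rate. *)
Definition geom_complete V : Prop := forall (u : nat -> V) (C : R),
  (forall m, `|u m.+1 - u m| <= C / 2 ^+ m) ->
  exists l, forall m, `|u m - l| <= 2 * C / 2 ^+ m.

Lemma telescope_sub (Z : zmodType) (x y c e : Z) :
  c - e = (x - y) - (x - c) + (y - e).
Proof.
have h : x - y - (x - c) = c - y by rewrite opprB addrC addrA subrK.
by rewrite h addrA subrK.
Qed.
Lemma telescope_sub2 (Z : zmodType) (p q x y c e : Z) :
  c - e - (p - q) = (x - p) - (y - q) - (x - c) + (y - e).
Proof.
have h : x - p - (x - c) = c - p by rewrite opprB addrC addrA subrK.
have k : - (y - q) + (y - e) = q - e by rewrite opprB addrA subrK.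
rewrite [X in _ = X + _]addrAC h -[RHS]addrA k opprB.
by rewrite addrACA [RHS]addrACA [- p - e]addrC.
Qed.

Lemma ler_add_geom (C x y : R) : (forall m : nat, x <= y + C / 2 ^+ m) -> x <= y.
Proof.
move=> H; apply/ler_addgt0Pr => e e0.
pose m := (Num.trunc (C / e)).+1.
rewrite (le_trans (H m))// lerD2l ler_pdivrMr ?exprn_gt0// mulrC -ler_pdivrMr//.
by rewrite (le_trans (ltW (truncnS_gt _)))// ltW// -natrX ltr_nat ltn_expl.
Qed.

Lemma has_primitivesR : has_primitives R.
Proof.
move=> f cf t0 y0 a; pose A := t0 - `|a| - 1.
pose F x := \int[lebesgue_measure]_(t in `[A, x]) f t.
exists (fun x => F x - F t0 + y0); split; first by rewrite subrr add0r.
move=> t ta.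
have tA : A < t.
  by have := ler_norm a; move: ta; rewrite ler_norml /A => /andP[h1 h2] h3; lra.
have fint : lebesgue_measure.-integrable `[A, t + 1] (EFin \o f).
  apply: continuous_compact_integrable; first exact: segment_compact.
  exact: continuous_subspaceT.
have tt1 : t < t + 1 by rewrite ltrDl.
have [dF FE] := continuous_FTC1_closed tt1 fint tA (cf t).
have dF' : differentiable F t by apply/derivable1_diffP.
have idt : dwithin setT (@id R) t (1 : R).
  move=> e e0; exists 1 => // s _ _.
  by rewrite /GRing.scale /= mulr1 subrr normr0 mulr_ge0// ltW.
have := dwithin_comp dF' idt; rewrite -derive1E'// FE => H.
have := dwithinD (dwithinD H (dwithin_cst setT (- F t0) t)) (dwithin_cst setT y0 t).
by rewrite !addr0.
Qed.

Lemma has_primitives_row m : has_primitives 'rV[R]_m.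
Proof.
move=> f cf t0 y0 a.
have /choice[F HF] : forall j, exists F : R -> R, F t0 = y0 0 j /\
    forall t, `|t - t0| <= a -> dwithin setT F t (f t 0 j).
  move=> j; apply: (has_primitivesR (f := fun s => f s 0 j)) => t.
  exact: (@continuous_comp _ _ _ f (fun A : 'rV[R]_m => A 0 j) t (cf t) (@coord_continuous _ _ _ 0 j (f t))).
exists (fun t => \row_j F j t); split; first by apply/rowP => j; rewrite mxE (HF j).1.
move=> t ta; apply: dwithin_row => j.
by under eq_fun do rewrite mxE; apply: (HF j).2.
Qed.

Lemma has_primitives_pair V W : has_primitives V -> has_primitives W ->
  has_primitives (V * W)%type.
Proof.
move=> HV HW f cf t0 y0 a.
have [|F [F0 HF]] := HV (fst \o f) _ t0 y0.1 a.
  by move=> t; exact: (@continuous_comp _ _ _ f fst t (cf t) (@cvg_fst _ _ _ _ _)).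
have [|G [G0 HG]] := HW (snd \o f) _ t0 y0.2 a.
  by move=> t; exact: (@continuous_comp _ _ _ f snd t (cf t) (@cvg_snd _ _ _ _ _)).
exists (fun t => (F t, G t)); split; first by rewrite F0 G0 -surjective_pairing.
by move=> t ta; apply: dwithin_pair; [exact: HF|exact: HG].
Qed.

Lemma geom_completeR : geom_complete R.
Proof.
move=> u C H.
have E m : C / 2 ^+ m = 2 * (C / 2 ^+ m.+1) by rewrite exprS; field; rewrite expf_neq0.
pose v m := u m - 2 * (C / 2 ^+ m); pose w m := u m + 2 * (C / 2 ^+ m).
have vS m : v m <= v m.+1.
  by have := H m; rewrite ler_norml => /andP[h _]; rewrite /v -E; lra.
have wS m : w m.+1 <= w m.
  by have := H m; rewrite ler_norml => /andP[_ h]; rewrite /w -E; lra.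
have C0 m : 0 <= C / 2 ^+ m by rewrite (le_trans _ (H m)).
have vw m k : v m <= w k.
  have vmono i j : v i <= v (j + i)%N by elim: j => // j IH; exact: le_trans IH (vS _).
  have wmono i j : w (j + i)%N <= w i by elim: j => // j IH; exact: le_trans (wS _) IH.
  rewrite (le_trans (vmono m k))// (le_trans _ (wmono k m))// addnC.
  by have := C0 (m + k)%N; rewrite /v /w; lra.
pose A := [set v m | m in setT].
have supA : has_sup A by split; [exists (v 0%N); exists 0%N|exists (w 0%N) => _ [m _ <-]].
exists (sup A) => m; rewrite -mulrA ler_norml; apply/andP; split.
  have : sup A <= w m by apply: ge_sup; [exact: supA.1|move=> _ [k _ <-]].
  by rewrite /w; lra.
have : v m <= sup A by apply: (sup_upper_bound supA); exists m.
by rewrite /v; lra.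
Qed.

Lemma geom_complete_row m : geom_complete 'rV[R]_m.
Proof.
move=> u C H.
have C0 k : 0 <= C / 2 ^+ k by rewrite (le_trans _ (H k)).
have /choice[l Hl] : forall j, exists l : R, forall k, `|u k 0 j - l| <= 2 * C / 2 ^+ k.
  move=> j; apply: (geom_completeR (u := fun k => u k 0 j)) => k.
  by have := normr_mx_entry (u k.+1 - u k) 0 j; rewrite !mxE => /le_trans; apply.
exists (\row_j l j) => k; apply: normr_mx_le => [|i j].
  by rewrite -mulrA mulr_ge0.
by rewrite !mxE ord1.
Qed.

Lemma geom_complete_pair V W : geom_complete V -> geom_complete W ->
  geom_complete (V * W)%type.
Proof.
move=> HV HW u C H.
have [|l Hl] := HV (fun k => (u k).1) C.
  by move=> k; have := H k; rewrite [leLHS]prod_normE ge_max => /andP[].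
have [|r Hr] := HW (fun k => (u k).2) C.
  by move=> k; have := H k; rewrite [leLHS]prod_normE ge_max => /andP[].
by exists (l, r) => k; rewrite [leLHS]prod_normE ge_max (Hl k) (Hr k).
Qed.

(** Local existence for a field defined in a ball. Time is clamped to the interval of existence,
    so that the iterates are globally defined, remain in the ball and are [B]-Lipschitz; on that
    interval consecutive iterates get closer by a factor one half since [K * delta <= 1 / 2].
    The limit is differentiable because the derivatives of the iterates converge uniformly. *)
Theorem picard V (F : R -> V -> V) (t0 : R) (y0 : V) (d B K delta : R) :
  has_primitives V -> geom_complete V ->
  0 <= d -> 0 <= B -> 0 <= K -> 0 < delta -> B * delta <= d -> K * delta <= 1 / 2 ->
  (forall s y, `|y - y0| <= d -> `|F s y| <= B) ->
  (forall s y z, `|y - y0| <= d -> `|z - y0| <= d ->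
     `|F s y - F s z| <= K * `|y - z|) ->
  (forall y, `|y - y0| <= d -> continuous (F ^~ y)) ->
  exists y : R -> V, y t0 = y0 /\ forall t, t0 - delta <= t <= t0 + delta ->
    `|y t - y0| <= d /\ dwithin `[t0 - delta, t0 + delta] y t (F t (y t)).
Proof.
move=> Vprim Vcomp d0 B0 K0 delta0 Bd Kd FB FK Fc.
set a := t0 - delta; set b := t0 + delta.
have ab : a <= b by rewrite /a /b; lra.
have t0ab : a <= t0 <= b by rewrite /a /b; apply/andP; lra.
have lenab t : a <= t <= b -> `|t - t0| <= delta.
  by rewrite /a /b ler_norml => /andP[? ?]; apply/andP; lra.
pose good (g : R -> V) :=
  (forall s t, `|g s - g t| <= B * `|s - t|) /\ (forall s, `|g s - y0| <= d).
(* one Picard step, from a candidate [g] to a primitive of [F s (g s)] *)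
have step : forall g, exists g', good g ->
    [/\ good g', g' t0 = y0 & forall t, a <= t <= b -> dwithin `[a, b] g' t (F t (g t))].
  move=> g; have [[gL gB]|ng] := pselect (good g); last by exists g => /ng.
  have ch : continuous (fun s => F s (g s)).
    move=> t; apply/cvgrPdist_lt => e e0.
    have /cvgrPdist_lt/(_ _ (divr_gt0 e0 (ltr0n _ 2)))/nbhs_ballP[r /= r0 Hr] := Fc _ (gB t) t.
    have k0 : 0 < 2 * (K * B + 1) by rewrite mulr_gt0// ltr_wpDl ?mulr_ge0.
    apply/nbhs_ballP; exists (Num.min r (e / (2 * (K * B + 1)))).
      by rewrite /= lt_min r0 divr_gt0.
    move=> s; rewrite /ball /= lt_min => /andP[s1 s2].
    have -> : F t (g t) - F s (g s) = (F t (g t) - F s (g t)) + (F s (g t) - F s (g s)).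
      by rewrite addrA subrK.
    rewrite (le_lt_trans (ler_normD _ _))// (splitr e) ltr_leD//; first exact: Hr.
    rewrite (le_trans (FK _ _ _ _ _))// (le_trans (ler_wpM2l K0 (gL _ _)))//.
    rewrite mulrA; move: s2; rewrite ltr_pdivlMr// => s2.
    have := normr_ge0 (t - s).
    by move: s2; lra.
  have [Phi [Phi0 HPhi]] := Vprim _ ch t0 y0 delta.
  pose clamp (t : R) := Num.max a (Num.min t b).
  have clampab t : a <= clamp t <= b by rewrite /clamp le_max lexx/= ge_max ab ge_min lexx orbT.
  have clampE t : a <= t <= b -> clamp t = t.
    by rewrite /clamp => /andP[h1 h2]; rewrite min_l// max_r.
  have clampL s t : `|clamp s - clamp t| <= `|s - t|.
    exact: clamp_lipschitz.
  have PhiI t : a <= t <= b -> dwithin `[a, b] Phi t (F t (g t)).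
    by move=> /lenab/HPhi; apply: dwithin_subset.
  have PhiL s t : a <= s <= b -> a <= t <= b -> `|Phi t - Phi s| <= B * `|t - s|.
    by apply: dwithin_mean_value PhiI _ _ _ => // r _; exact: FB.
  exists (Phi \o clamp) => _; split.
  - split => [s t|s] /=.
      by rewrite (le_trans (PhiL _ _ _ _))// ler_wpM2l.
    rewrite -Phi0 (le_trans (PhiL _ _ _ _))// (le_trans _ Bd)// ler_wpM2l//.
    exact: lenab.
  - by rewrite /= clampE.
  - move=> t tab; apply: (dwithin_near ltr01 _ _ (PhiI t tab)) => [s|] /=.
      by rewrite in_itv /= => sab _; rewrite clampE.
    by rewrite clampE.
have [S HS] := choice step.
pose y m := iter m S (cst y0).
have good_y m : good (y m).
  elim: m => [|m /HS[]//]; split => [s t|s] /=; rewrite /y /= subrr normr0//.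
  exact: mulr_ge0.
have y_t0 m : y m t0 = y0 by case: m => // m; have [] := HS _ (good_y m).
have dy m t : a <= t <= b -> dwithin `[a, b] (y m.+1) t (F t (y m t)).
  by have [_ _] := HS _ (good_y m); exact.
have diff_y m t : a <= t <= b -> `|y m.+1 t - y m t| <= d / 2 ^+ m.
  elim: m t => [|m IH] t tab; first by rewrite expr0 divr1; exact: (good_y 1%N).2.
  have L0 : 0 <= d / 2 ^+ m by rewrite divr_ge0 ?exprn_ge0.
  have := @dwithin_mean_value _ V a b (fun s => y m.+2 s - y m.+1 s)
     (fun s => F s (y m.+1 s) - F s (y m s)) (K * (d / 2 ^+ m)) _ _ _ t0 t t0ab tab.
  rewrite !y_t0 subrr subr0 => /(_ _ _ _)/le_trans; apply.
  - exact: mulr_ge0.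
  - by move=> s sab; apply: dwithinD; [exact: dy|apply: dwithinN; exact: dy].
  - move=> s sab; rewrite (le_trans (FK _ _ _ _ _))//; [exact: (good_y _).2|exact: (good_y _).2|].
    by rewrite ler_wpM2l// IH.
  - have -> : d / 2 ^+ m.+1 = 1 / 2 * (d / 2 ^+ m) by rewrite exprS; field; rewrite expf_neq0.
    rewrite mulrAC ler_wpM2r// (le_trans _ Kd)// ler_wpM2l//; exact: lenab.
have /choice[z Hz] : forall t, exists z, a <= t <= b ->
    forall m, `|y m t - z| <= 2 * d / 2 ^+ m.
  move=> t; have [tab|_] := boolP (a <= t <= b); last by exists y0.
  by have [z Hz] := Vcomp (fun m => y m t) d (fun m => diff_y m t tab); exists z.
have zB t : a <= t <= b -> `|z t - y0| <= d.
  move=> tab; apply: (@ler_add_geom (2 * d)) => m.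
  have -> : z t - y0 = (y m t - y0) - (y m t - z t) by rewrite opprB [RHS]addrC addrA subrK.
  by rewrite (le_trans (ler_normB _ _))// lerD ?Hz//; exact: (good_y m).2.
have z_t0 : z t0 = y0.
  apply/eqP; rewrite -subr_eq0 -normr_le0; apply: (@ler_add_geom (2 * d)) => m.
  by rewrite add0r distrC -(y_t0 m) Hz.
have zL s t : a <= s <= b -> a <= t <= b -> `|z s - z t| <= B * `|s - t|.
  move=> sab tab; apply: (@ler_add_geom (4 * d)) => m.
  have -> : z s - z t = (y m s - y m t) - (y m s - z s) + (y m t - z t).
    exact: telescope_sub.
  rewrite (le_trans (ler_normD _ _))//.
  have -> : B * `|s - t| + 4 * d / 2 ^+ m = B * `|s - t| + 2 * d / 2 ^+ m + 2 * d / 2 ^+ m.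
    by field; rewrite expf_neq0.
  by rewrite lerD ?Hz// (le_trans (ler_normB _ _))// lerD ?Hz//; exact: (good_y m).1.
exists z; split => // t tab; split; first exact: zB.
move=> e e0.
have /cvgrPdist_lt/(_ _ (divr_gt0 e0 (ltr0n _ 2)))/nbhs_ballP[r /= r0 Hr] := Fc _ (zB t tab) t.
have k0 : 0 < 2 * (K * B + 1) by rewrite mulr_gt0// ltr_wpDl ?mulr_ge0.
exists (Num.min r (e / (2 * (K * B + 1)))); first by rewrite lt_min r0 divr_gt0.
move=> s; rewrite /= in_itv /= => sab; rewrite lt_min => /andP[sr sk].
set h := `|s - t|.
apply: (@ler_add_geom ((2 * K * h + 4) * d)) => m.
pose v := F t (z t).
have yv : `|(y m.+1 s - s *: v) - (y m.+1 t - t *: v)| <= (e + 2 * K * d / 2 ^+ m) * h.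
  pose a' := Num.min s t; pose b' := Num.max s t.
  have sub q : a' <= q <= b' -> a <= q <= b /\ `|q - t| <= h.
    rewrite /a' /b' /h; case/andP: sab => ? ?; case/andP: tab => ? ?.
    have := ler_norm (s - t); have := ler_norm (t - s); rewrite (distrC t s).
    by case: (leP s t) => ? ? ? /andP[? ?]; (split; first by apply/andP; lra);
      rewrite ler_norml; apply/andP; lra.
  apply: (@dwithin_mean_value _ V a' b' (fun q => y m.+1 q - q *: v)
    (fun q => F q (y m q) - v)).
  - by rewrite addr_ge0 ?(ltW e0)// !mulr_ge0 ?invr_ge0 ?exprn_ge0.
  - move=> q /sub[qab _]; apply: dwithinD.
      apply: dwithin_subset (dy _ _ qab) => p /=; rewrite !in_itv /=; move/sub => [].
      by [].
    apply: dwithinN => e' e'0; exists 1 => // p _ _.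
    by rewrite -scalerBl subrr normr0 mulr_ge0// ltW.
  - move=> q /sub[qab qh].
    have -> : F q (y m q) - v = (F q (y m q) - F q (z t)) + (F q (z t) - v).
      by rewrite addrA subrK.
    rewrite (le_trans (ler_normD _ _))//.
    have H1 : `|F q (z t) - v| <= e / 2.
      by rewrite distrC ltW// Hr// /ball /= distrC (le_lt_trans qh).
    have H2 : `|F q (y m q) - F q (z t)| <= K * (2 * d / 2 ^+ m + B * h).
      rewrite (le_trans (FK _ _ _ _ _))//; [exact: (good_y m).2|exact: zB|].
      rewrite ler_wpM2l//.
      have -> : y m q - z t = (y m q - z q) + (z q - z t) by rewrite addrA subrK.
      rewrite (le_trans (ler_normD _ _))// lerD ?Hz// (le_trans (zL _ _ _ _))//.
      by rewrite ler_wpM2l.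
    have H3 : K * (B * h) <= e / 2.
      move: sk; rewrite ltr_pdivlMr// -/h => sk; rewrite mulrA.
      have : 0 <= h by exact: normr_ge0.
      by move: sk; lra.
    move: H2; rewrite mulrDr.
    have -> : 2 * K * d / 2 ^+ m = K * (2 * d / 2 ^+ m) by ring.
    lra.
  - by rewrite /a' /b' ge_min le_max lexx orbT /= orbT.
  - by rewrite /a' /b' ge_min le_max lexx.
have Hs := Hz s sab m.+1; have Ht := Hz t tab m.+1.
have E2 : 2 * d / 2 ^+ m.+1 = d / 2 ^+ m by rewrite exprS; field; rewrite expf_neq0.
rewrite E2 in Hs Ht.
have -> : z s - z t - (s - t) *: v =
   ((y m.+1 s - s *: v) - (y m.+1 t - t *: v)) - (y m.+1 s - z s) + (y m.+1 t - z t).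
  rewrite scalerBl; exact: telescope_sub2.
rewrite (le_trans (ler_normD _ _))//.
have -> : e * h + (2 * K * h + 4) * d / 2 ^+ m =
  (e + 2 * K * d / 2 ^+ m) * h + d / 2 ^+ m + 3 * (d / 2 ^+ m) by ring.
rewrite lerD//; last by rewrite (le_trans Ht)// ler_peMl ?ler1n// divr_ge0 ?exprn_ge0.
by rewrite (le_trans (ler_normB _ _))// lerD.
Qed.

End Picard.

(** * Smooth maps *)

Section Smooth.
Variable R : realType.
Implicit Types V W : normedModType R.

Lemma smooth_differentiable V W (U : set V) (f : V -> W) x :
  smooth_on U f -> U x -> differentiable f x.
Proof. by move=> /(_ 1%N)[+ _]; exact. Qed.

Lemma smooth_derive V W (U : set V) (f : V -> W) v :
  smooth_on U f -> smooth_on U ('D_v f).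
Proof. by move=> H k; have [_] := H k.+1; exact. Qed.

(** The differential of [f] is a candidate for that of [g], and differentials are unique. *)
Lemma near_differentiable V W (f g : V -> W) x :
  (\forall y \near x, f y = g y) -> differentiable f x -> differentiable g x.
Proof.
move=> fg df; have fgx := nbhs_singleton fg.
have [cdf /eqaddoP Hf] := (iffLR (diff_locallyP x f)) df.
have Hg : g \o shift x = cst (g x) + 'd f x +o_ (0 : V) id.
  apply/eqaddoP => e e0; have := Hf e e0.
  have : \forall z \near (0 : V), f (z + x) = g (z + x).
    case/nbhs_ballP: fg => d /= d0 Hd; apply/nbhs_ballP; exists d => // z.
    rewrite -!ball_normE /ball_ /= sub0r normrN => zd; apply: Hd.
    by rewrite -ball_normE /ball_ /= opprD addrCA subrr addr0 normrN.
  apply: filterS2 => z E; rewrite !fctE /=.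
  by rewrite E fgx.
have dE := diff_unique cdf Hg.
by apply/diff_locallyP; rewrite dE.
Qed.

Lemma open_near V (U : set V) (P : V -> Prop) x : open U -> U x ->
  (forall y, U y -> P y) -> \forall y \near x, P y.
Proof. by move=> oU Ux H; apply: (filterS (H)); exact: open_nbhs_nbhs. Qed.

Lemma derive_eq_on V W (U : set V) (f g : V -> W) x v : open U -> U x ->
  (forall y, U y -> f y = g y) -> 'D_v f x = 'D_v g x.
Proof. by move=> oU Ux fg; apply: near_eq_derive; exact: (open_near oU). Qed.

Lemma Ck_eq_on V W (U : set V) k (f g : V -> W) : open U ->
  (forall y, U y -> f y = g y) -> Ck k U f -> Ck k U g.
Proof.
move=> oU; elim: k f g => [|k IH] f g fg /=.
  move=> cf x Ux; have cfx : f y @[y --> x] --> f x := cf x Ux.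
  change (g y @[y --> x] --> g x); rewrite -(fg x Ux).
  apply: cvg_trans cfx; apply: near_eq_cvg; apply: (open_near oU Ux) => y Uy.
  by rewrite fg.
move=> [df Df]; split=> [x Ux|v].
  by apply: near_differentiable (df x Ux); exact: (open_near oU).
by apply: IH (Df v) => y Uy; exact: (derive_eq_on _ oU).
Qed.

Lemma CkW V W (U : set V) k (f : V -> W) : Ck k.+1 U f -> Ck k U f.
Proof.
elim: k f => [|k IH] f.
  by move=> [df _] x Ux; exact: differentiable_continuous (df x Ux).
by move=> [df Df]; split => // v; apply: IH; exact: Df.
Qed.

Lemma Ck_cst V W (U : set V) k (a : W) : Ck k U (cst a).
Proof.
elim: k a => [|k IH] a /=; first by move=> x _; exact: cvg_cst.
split=> [x _|v]; first exact: differentiable_cst.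
by rewrite (_ : 'D_v (cst a) = cst 0)//; apply/funext => x; rewrite derive_cst.
Qed.

Lemma CkD V W (U : set V) k (f g : V -> W) : open U ->
  Ck k U f -> Ck k U g -> Ck k U (fun x => f x + g x).
Proof.
move=> oU; elim: k f g => [|k IH] f g /=.
  by move=> cf cg x Ux; apply: cvgD; [exact: cf|exact: cg].
move=> [df Df] [dg Dg]; split=> [x Ux|v].
  by apply: differentiableD; [exact: df|exact: dg].
apply: (Ck_eq_on oU _ (IH _ _ (Df v) (Dg v))) => x Ux /=.
by rewrite -deriveD//; apply: diff_derivable; [exact: df|exact: dg].
Qed.

Lemma CkN V W (U : set V) k (f : V -> W) : open U ->
  Ck k U f -> Ck k U (fun x => - f x).
Proof.
move=> oU; elim: k f => [|k IH] f /=.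
  by move=> cf x Ux; apply: cvgN; exact: cf.
move=> [df Df]; split=> [x Ux|v].
  by apply: differentiableN; exact: df.
apply: (Ck_eq_on oU _ (IH _ (Df v))) => x Ux /=.
by rewrite -deriveN//; apply: diff_derivable; exact: df.
Qed.

Lemma CkM V (U : set V) k (f g : V -> R) : open U ->
  Ck k U f -> Ck k U g -> Ck k U (fun x => f x * g x).
Proof.
move=> oU; elim: k f g => [|k IH] f g.
  by move=> cf cg x Ux; apply: cvgM; [exact: cf|exact: cg].
move=> Cf Cg; have [df Df] := Cf; have [dg Dg] := Cg; split=> [x Ux|v].
  by apply: differentiableM; [exact: df|exact: dg].
apply: (Ck_eq_on oU _ (CkD oU (IH _ _ (CkW Cf) (Dg v)) (IH _ _ (CkW Cg) (Df v)))) => x Ux /=.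
by rewrite -[LHS]deriveM//; apply: diff_derivable; [exact: df|exact: dg].
Qed.

Lemma Ck_entry V m (U : set V) k (f : V -> 'rV[R]_m) j : open U ->
  Ck k U f -> Ck k U (fun x => f x 0 j).
Proof.
move=> oU; elim: k f => [|k IH] f.
  move=> cf x Ux; apply: (@continuous_comp _ _ _ f (fun A : 'rV[R]_m => A 0 j) x (cf x Ux)).
  exact: coord_continuous.
move=> [df Df]; split=> [x Ux|v].
  apply: (@differentiable_comp _ _ _ _ f (fun A : 'rV[R]_m => A 0 j) x (df x Ux)).
  exact: differentiable_coord.
apply: (Ck_eq_on oU _ (IH _ (Df v))) => x Ux /=.
by rewrite derive_mx ?mxE//; apply: diff_derivable; exact: df.
Qed.

Lemma row_differentiable V m (f : V -> 'rV[R]_m) x :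
  (forall j, differentiable (fun x => f x 0 j) x) -> differentiable f x.
Proof.
move=> df.
have -> : f = \sum_(j < m) (fun x => f x 0 j *: (delta_mx 0 j : 'rV[R]_m)).
  by apply/funext => y; rewrite fct_sumE -row_sum_delta.
by apply: differentiable_sum => j; exact: differentiableZl.
Qed.

Lemma Ck_row V m (U : set V) k (f : V -> 'rV[R]_m) : open U ->
  (forall j, Ck k U (fun x => f x 0 j)) -> Ck k U f.
Proof.
move=> oU; elim: k f => [|k IH] f Cf.
  move=> x Ux; apply/cvgrPdist_le => e e0.
  have /choice[d Hd] : forall j, exists d : R, 0 < d /\
      forall y, `|x - y| < d -> `|f x 0 j - f y 0 j| <= e.
    move=> j; have /cvgrPdist_le/(_ e e0)/nbhs_ballP[d /= d0 Hd] := Cf j x Ux.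
    by exists d; split => // y xy; apply: Hd; rewrite -ball_normE.
  apply/nbhs_ballP; exists (\big[Num.min/1]_j d j).
    by apply: (big_ind (fun x : R => 0 < x)) => // [p q p0 q0|j _];
      [rewrite lt_min p0|have [] := Hd j].
  move=> y; rewrite -ball_normE /ball_ /= => xy; apply: normr_mx_le => [|i j]; first exact: ltW.
  rewrite !mxE ord1; have [_ Hj] := Hd j; apply: Hj.
  by rewrite (lt_le_trans xy)//; exact: bigmin_le_cond.
have df x : U x -> differentiable f x.
  by move=> Ux; apply: row_differentiable => j; have [+ _] := Cf j; exact.
split=> // v; apply: IH => j; have [_ /(_ v)] := Cf j; apply: Ck_eq_on => // x Ux.
by rewrite derive_mx ?mxE//; apply: diff_derivable; exact: df.
Qed.

Lemma Ck_sum V W m (U : set V) k (f : 'I_m -> V -> W) : open U ->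
  (forall i, Ck k U (f i)) -> Ck k U (fun x => \sum_i f i x).
Proof.
move=> oU; elim: m f => [|m IH] f Cf.
  apply: (Ck_eq_on oU _ (Ck_cst U k 0)) => x _; by rewrite big_ord0.
apply: (Ck_eq_on oU _ (CkD oU (Cf ord0) (IH _ (fun i => Cf (lift ord0 i))))) => x _.
by rewrite big_ord_recl.
Qed.

(** ** Symmetry of second derivatives *)

Lemma dwithin_line V W (D : set R) (f : V -> W) (p v : V) (s : R) :
  differentiable f (p + s *: v) ->
  dwithin D (fun r => f (p + r *: v)) s ('D_v f (p + s *: v)).
Proof.
move=> df; rewrite deriveE//.
apply: (@dwithin_comp R V W D (fun r => p + r *: v)) => // e e0; exists 1 => // r _ _.
by rewrite opprD addrACA subrr add0r -scalerBl subrr normr0 mulr_ge0// ltW.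
Qed.

Lemma ball_line V (x : V) (d : R) (v w : V) (h s r : R) : 0 <= s <= h -> 0 <= r <= h ->
  h * (`|v| + `|w|) < d -> `|x + s *: v + r *: w - x| < d.
Proof.
move=> /andP[s0 sh] /andP[r0 rh]; apply: le_lt_trans.
rewrite addrAC [x + _]addrC addrK (le_trans (ler_normD _ _))// !normrZ !ger0_norm// mulrDr.
by rewrite lerD// ler_wpM2r.
Qed.

(** The second difference of [f] over a parallelogram approximates [h ^+ 2] times either mixed
    derivative: one applies the mean value inequality first along [v], then along [w]. It works
    for maps with values in any normed space, without reduction to coordinates. *)
Lemma second_difference V W (U : set V) (f : V -> W) x v w : open U -> U x -> Ck 2 U f ->
  forall e : R, 0 < e -> exists2 d : R, 0 < d & forall h, 0 < h -> h < d ->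
  `|(f (x + h *: v + h *: w) - f (x + h *: v)) - (f (x + h *: w) - f x)
     - (h ^+ 2) *: 'D_w ('D_v f) x| <= e * h ^+ 2.
Proof.
move=> oU Ux Cf e e0; have [df Df] := Cf; have [dDf cDf] := Df v.
have /nbhs_ballP[r /= r0 rU] : nbhs x U by exact: open_nbhs_nbhs.
have /cvgrPdist_le/(_ e e0)/nbhs_ballP[k /= k0 Hk] := cDf w x Ux.
have L0 : 0 < `|v| + `|w| + 1 by rewrite ltr_wpDl// addr_ge0.
exists (Num.min r k / (`|v| + `|w| + 1)); first by rewrite divr_gt0// lt_min r0.
move=> h h0; rewrite ltr_pdivlMr// => hd.
set A := 'D_w ('D_v f) x.
have ub s q : 0 <= s <= h -> 0 <= q <= h ->
    U (x + s *: v + q *: w) /\ `|'D_w ('D_v f) (x + s *: v + q *: w) - A| <= e.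
  move=> sh qh.
  have hb : h * (`|v| + `|w|) < Num.min r k.
    by rewrite (le_lt_trans _ hd)// ler_wpM2l ?(ltW h0)// lerDl.
  have := ball_line x sh qh hb; rewrite lt_min => /andP[b1 b2].
  split; first by apply: rU; rewrite -ball_normE /ball_ /= distrC.
  by rewrite distrC; apply: Hk; rewrite -ball_normE /ball_ /= distrC.
have h00 : 0 <= (0 : R) <= h by rewrite lexx ltW.
have hhh : 0 <= h <= h by rewrite lexx ltW.
pose phi s := f (x + s *: v + h *: w) - f (x + s *: v) - (s * h) *: A.
have -> : (f (x + h *: v + h *: w) - f (x + h *: v)) - (f (x + h *: w) - f x)
     - (h ^+ 2) *: A = phi h - phi 0.
  by rewrite /phi !scale0r mul0r scale0r subr0 addr0 expr2 addrAC.
have -> : e * h ^+ 2 = (e * h) * `|h - 0| by rewrite subr0 gtr0_norm// expr2 mulrA.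
pose phi' s := 'D_v f (x + s *: v + h *: w) - 'D_v f (x + s *: v) - h *: A.
apply: (@dwithin_mean_value _ W 0 h phi phi') => //; first by rewrite mulr_ge0// ltW.
- move=> s sh; apply: dwithinD; first apply: dwithinD.
  + have -> : (fun s => f (x + s *: v + h *: w)) = (fun s => f (x + h *: w + s *: v)).
      by apply/funext => q; rewrite addrAC.
    by rewrite addrAC; apply: dwithin_line; rewrite addrAC; apply: df; have [] := ub s h sh hhh.
  + apply: dwithinN; apply: dwithin_line; apply: df.
    by have [] := ub s 0 sh h00; rewrite scale0r addr0.
  + apply: dwithinN => e' e'0; exists 1 => // q _ _.
    by rewrite scalerA -scalerBl -scalerBl mulrBl subrr scale0r normr0 mulr_ge0// ltW.
move=> s sh.
pose psi r := 'D_v f (x + s *: v + r *: w) - r *: A.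
have -> : phi' s = psi h - psi 0.
  by rewrite /phi' /psi !scale0r addr0 subr0 addrAC.
have -> : e * h = e * `|h - 0| by rewrite subr0 gtr0_norm.
apply: (@dwithin_mean_value _ W 0 h psi
  (fun r => 'D_w ('D_v f) (x + s *: v + r *: w) - A)) => //; first exact: ltW.
- move=> q qh; apply: dwithinD.
    by apply: dwithin_line; apply: dDf; have [] := ub s q sh qh.
  apply: dwithinN => e' e'0; exists 1 => // y _ _.
  by rewrite -scalerBl subrr normr0 mulr_ge0// ltW.
- by move=> q qh; have [] := ub s q sh qh.
Qed.

(** Schwarz's theorem: the second difference is symmetric in [v] and [w]. *)
Lemma derive_comm V W (U : set V) (f : V -> W) x v w : open U -> U x -> Ck 2 U f ->
  'D_w ('D_v f) x = 'D_v ('D_w f) x.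
Proof.
move=> oU Ux Cf; apply/eqP; rewrite -subr_eq0 -normr_le0.
apply/ler_addgt0Pr => e e0; rewrite add0r.
have e2 : 0 < e / 2 by rewrite divr_gt0.
have [d d0 Hd] := second_difference v w oU Ux Cf e2.
have [k k0 Hk] := second_difference w v oU Ux Cf e2.
pose h := Num.min d k / 2.
have m0 : 0 < Num.min d k by rewrite lt_min d0.
have h0 : 0 < h by rewrite /h divr_gt0.
have hm : h < Num.min d k by rewrite /h; lra.
have [hd hk] : h < d /\ h < k by move: hm; rewrite lt_min => /andP[].
have {Hd} := Hd h h0 hd; have {Hk} := Hk h h0 hk.
have -> : f (x + h *: w + h *: v) - f (x + h *: w) - (f (x + h *: v) - f x) =
  f (x + h *: v + h *: w) - f (x + h *: v) - (f (x + h *: w) - f x).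
  rewrite [x + h *: w + _]addrAC !opprB addrACA [RHS]addrACA; congr (_ + _).
  exact: addrC.
set S := f _ - _ - _; move=> H1 H2.
have h2 : 0 < h ^+ 2 by rewrite exprn_gt0.
rewrite -(ler_pM2l h2) -[X in X * _ <= _](gtr0_norm h2) -normrZ scalerBr.
have -> : h ^+ 2 *: 'D_w ('D_v f) x - h ^+ 2 *: 'D_v ('D_w f) x =
   (S - h ^+ 2 *: 'D_v ('D_w f) x) - (S - h ^+ 2 *: 'D_w ('D_v f) x).
  by rewrite opprB [RHS]addrC addrA subrK.
rewrite (le_trans (ler_normB _ _))// (le_trans (lerD H1 H2))//.
by rewrite -mulrDl -splitr mulrC.
Qed.

End Smooth.

(** * Locally Lipschitz maps *)

Definition loclip {R : realType} {V W : normedModType R} (f : V -> W) (x : V) : Prop :=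
  exists (K d : R), [/\ 0 <= K, 0 < d & forall y z, `|y - x| < d -> `|z - x| < d ->
    `|f y - f z| <= K * `|y - z|].

Section Loclip.
Variable R : realType.
Implicit Types U V W : normedModType R.

Lemma lipschitz_loclip V W (f : V -> W) x K : 0 <= K ->
  (forall y z, `|f y - f z| <= K * `|y - z|) -> loclip f x.
Proof. by move=> K0 H; exists K, 1; split. Qed.

Lemma loclip_cst V W (a : W) (x : V) : loclip (cst a) x.
Proof. by apply: (@lipschitz_loclip _ _ _ _ 0) => // y z; rewrite subrr normr0 mul0r. Qed.

Lemma loclip_fst V W (x : V * W) : loclip (fst : V * W -> V) x.
Proof.
by apply: (@lipschitz_loclip _ _ _ _ 1) => // y z; rewrite mul1r [leRHS]prod_normE le_max lexx.
Qed.

Lemma loclip_snd V W (x : V * W) : loclip (snd : V * W -> W) x.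
Proof.
by apply: (@lipschitz_loclip _ _ _ _ 1) => // y z; rewrite mul1r [leRHS]prod_normE le_max lexx orbT.
Qed.

Lemma loclip_entry m j (x : 'rV[R]_m) : loclip ((fun A : 'rV[R]_m => A 0 j) : _ -> R) x.
Proof.
apply: (@lipschitz_loclip _ _ _ _ 1) => // y z; rewrite mul1r.
by have := normr_mx_entry (y - z) 0 j; rewrite !mxE.
Qed.

Lemma loclip_comp U V W (f : U -> V) (g : V -> W) x :
  loclip f x -> loclip g (f x) -> loclip (g \o f) x.
Proof.
move=> [K [d [K0 d0 Hd]]] [L [k [L0 k0 Hk]]].
have K1 : 0 < K + 1 by rewrite ltr_wpDl.
exists (L * K), (Num.min d (k / (K + 1))); split.
- exact: mulr_ge0.
- by rewrite lt_min d0 divr_gt0.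
have xd : `|x - x| < d by rewrite subrr normr0.
have near_fx y : `|y - x| < d -> `|y - x| < k / (K + 1) -> `|f y - f x| < k.
  move=> yd; rewrite ltr_pdivlMr// => yk; apply: le_lt_trans yk.
  by rewrite (le_trans (Hd _ _ yd xd))// mulrC ler_wpM2l// lerDl.
move=> y z; rewrite !lt_min => /andP[y1 y2] /andP[z1 z2] /=.
rewrite (le_trans (Hk _ _ (near_fx _ y1 y2) (near_fx _ z1 z2)))// -mulrA.
by rewrite ler_wpM2l// Hd.
Qed.

Lemma loclip_bounded V W (f : V -> W) x : loclip f x ->
  exists2 d : R, 0 < d & forall y, `|y - x| < d -> `|f y| <= `|f x| + 1.
Proof.
move=> [K [d [K0 d0 Hd]]].
have K1 : 0 < K + 1 by rewrite ltr_wpDl.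
exists (Num.min d (1 / (K + 1))); first by rewrite lt_min d0 divr_gt0.
move=> y; rewrite lt_min ltr_pdivlMr// => /andP[y1 y2].
have xd : `|x - x| < d by rewrite subrr normr0.
rewrite -[f y](subrK (f x)) (le_trans (ler_normD _ _))// addrC lerD2l.
by rewrite (le_trans (Hd _ _ y1 xd))// mulrC (le_trans _ (ltW y2))// ler_wpM2l// lerDl.
Qed.

Lemma loclip_pair U V W (f : U -> V) (g : U -> W) x :
  loclip f x -> loclip g x -> loclip (fun y => (f y, g y)) x.
Proof.
move=> [K [d [K0 d0 Hd]]] [L [k [L0 k0 Hk]]].
exists (Num.max K L), (Num.min d k); split.
- by rewrite le_max K0.
- by rewrite lt_min d0.
move=> y z; rewrite !lt_min => /andP[y1 y2] /andP[z1 z2].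
rewrite [leLHS]prod_normE ge_max /=; apply/andP; split.
  by rewrite (le_trans (Hd _ _ y1 z1))// ler_wpM2r// le_max lexx.
by rewrite (le_trans (Hk _ _ y2 z2))// ler_wpM2r// le_max lexx orbT.
Qed.

Lemma loclipD V W (f g : V -> W) x :
  loclip f x -> loclip g x -> loclip (fun y => f y + g y) x.
Proof.
move=> [K [d [K0 d0 Hd]]] [L [k [L0 k0 Hk]]].
exists (K + L), (Num.min d k); split; [exact: addr_ge0|by rewrite lt_min d0|].
move=> y z; rewrite !lt_min => /andP[y1 y2] /andP[z1 z2].
rewrite opprD addrACA (le_trans (ler_normD _ _))// mulrDl lerD//; [exact: Hd|exact: Hk].
Qed.

Lemma loclipN V W (f : V -> W) x : loclip f x -> loclip (fun y => - f y) x.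
Proof.
move=> [K [d [K0 d0 Hd]]]; exists K, d; split => // y z yd zd.
by rewrite -opprD normrN; exact: Hd.
Qed.

Lemma loclip_scale V W (a : V -> R) (f : V -> W) x :
  loclip a x -> loclip f x -> loclip (fun y => a y *: f y) x.
Proof.
move=> La Lf.
have [d1 d10 B1] := loclip_bounded La; have [d2 d20 B2] := loclip_bounded Lf.
case: La => K [d [K0 d0 Hd]]; case: Lf => L [k [L0 k0 Hk]].
exists ((`|a x| + 1) * L + K * (`|f x| + 1)), (Num.min (Num.min d k) (Num.min d1 d2)); split.
- by rewrite addr_ge0// mulr_ge0// addr_ge0.
- by rewrite !lt_min d0 k0 d10.
move=> y z; rewrite !lt_min => /andP[/andP[y1 y2] /andP[y3 y4]] /andP[/andP[z1 z2] /andP[z3 z4]].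
have -> : a y *: f y - a z *: f z = a y *: (f y - f z) + (a y - a z) *: f z.
  by rewrite scalerBr scalerBl addrA subrK.
rewrite (le_trans (ler_normD _ _))// !normrZ mulrDl lerD//.
  by rewrite -mulrA ler_pM// ?B1// Hk.
by rewrite mulrAC ler_pM// ?B2// Hd.
Qed.

Lemma loclipM V (a b : V -> R) x :
  loclip a x -> loclip b x -> loclip (fun y => a y * b y) x.
Proof. exact: loclip_scale. Qed.

Lemma loclip_sum V W m (f : 'I_m -> V -> W) x :
  (forall i, loclip (f i) x) -> loclip (fun y => \sum_i f i y) x.
Proof.
elim: m f => [|m IH] f H.
  by under eq_fun do rewrite big_ord0; exact: loclip_cst.
by under eq_fun do rewrite big_ord_recl; apply: loclipD; [exact: H|apply: IH => i; exact: H].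
Qed.

Lemma loclip_row V m (f : 'I_m -> V -> R) x :
  (forall j, loclip (f j) x) -> loclip (fun y => \row_j f j y) x.
Proof.
move=> H.
have -> : (fun y => \row_j f j y) = (fun y => \sum_j f j y *: delta_mx 0 j).
  by apply/funext => y; rewrite [LHS]row_sum_delta; apply: eq_bigr => j _; rewrite mxE.
by apply: loclip_sum => j; apply: loclip_scale; [exact: H|exact: loclip_cst].
Qed.

Lemma loclip_inv_sqrt (r : R) : 0 < r -> loclip (fun q : R => (Num.sqrt q)^-1) r.
Proof.
move=> r0; pose m := Num.sqrt (r / 2).
have m0 : 0 < m by rewrite sqrtr_gt0 divr_gt0.
exists ((2 * m ^+ 3)^-1), (r / 2); split.
- by rewrite invr_ge0 mulr_ge0// exprn_ge0// ltW.
- by rewrite divr_gt0.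
have lb q : `|q - r| < r / 2 -> 0 < q /\ m <= Num.sqrt q.
  by rewrite ltr_norml => /andP[h _]; split; [lra|apply: ler_wsqrtr; lra].
move=> y z /lb[y0 my] /lb[z0 mz].
have [sy sz] : 0 < Num.sqrt y /\ 0 < Num.sqrt z by rewrite !sqrtr_gt0.
have E : Num.sqrt z - Num.sqrt y = (z - y) / (Num.sqrt z + Num.sqrt y).
  rewrite -[in z - y](sqr_sqrtr (ltW y0)) -[in z - _](sqr_sqrtr (ltW z0)).
  by field; rewrite lt0r_neq0// addr_gt0.
have -> : (Num.sqrt y)^-1 - (Num.sqrt z)^-1 =
   (z - y) / ((Num.sqrt z + Num.sqrt y) * (Num.sqrt y * Num.sqrt z)).
  rewrite invfM mulrA -E; field; by rewrite !lt0r_neq0.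
rewrite normrM distrC mulrC ler_wpM2r// normfV.
rewrite ler_pV2 ?inE ?unitfE ?normr_gt0 ?lt0r_neq0 ?normr_gt0 ?lt0r_neq0//;
  rewrite ?mulr_gt0 ?addr_gt0 ?exprn_gt0//.
rewrite gtr0_norm ?mulr_gt0 ?addr_gt0//.
have -> : 2 * m ^+ 3 = (m + m) * (m * m) by ring.
by rewrite ler_pM ?lerD ?mulr_ge0 ?addr_ge0 ?ler_pM// ltW.
Qed.

(** The slope is bounded by the partial derivatives along the coordinate axes, which are finitely
    many and continuous. *)
Lemma Ck1_loclip m W (U : set 'rV[R]_m) (f : 'rV[R]_m -> W) x :
  open U -> U x -> Ck 1 U f -> loclip f x.
Proof.
move=> oU Ux [df Df].
have /nbhs_ballP[r /= r0 rU] : nbhs x U by exact: open_nbhs_nbhs.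
have /choice[d Hd] : forall j : 'I_m, exists d : R, 0 < d /\ forall y, `|y - x| < d ->
    `|'D_(delta_mx 0 j) f y| <= `|'D_(delta_mx 0 j) f x| + 1.
  move=> j; have /cvgrPdist_le/(_ 1 ltr01)/nbhs_ballP[d /= d0 Hd] := Df (delta_mx 0 j) x Ux.
  exists d; split => // y yx; rewrite -['D_(_) f y](subrK ('D_(delta_mx 0 j) f x)).
  rewrite (le_trans (ler_normD _ _))// addrC lerD2l distrC; apply: Hd.
  by rewrite -ball_normE /ball_ /= distrC.
pose dd := \big[Num.min/r]_j d j.
have dd0 : 0 < dd.
  by apply: (big_ind (fun x : R => 0 < x)) => // [p q p0 q0|j _];
    [rewrite lt_min p0|have [] := Hd j].
pose K := \sum_(j < m) (`|'D_(delta_mx 0 j) f x| + 1).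
have K0 : 0 <= K by apply: sumr_ge0 => j _; rewrite addr_ge0.
have inU y : `|y - x| < dd -> U y.
  move=> yx; apply: rU; rewrite -ball_normE /ball_ /= distrC (lt_le_trans yx)//.
  exact: bigmin_le_id.
have HK y v : `|y - x| < dd -> `|'D_v f y| <= K * `|v|.
  move=> yx; rewrite deriveE; last exact/df/inU.
  rewrite [v in 'd _ _ v]row_sum_delta linear_sum /= (le_trans (ler_norm_sum _ _ _))// mulr_suml.
  apply: ler_sum => j _; rewrite linearZ normrZ mulrC ler_pM//; last exact: normr_mx_entry.
  rewrite -deriveE; last exact/df/inU.
  have [_ Hj] := Hd j; apply: Hj; rewrite (lt_le_trans yx)//; exact: bigmin_le_cond.
exists K, dd; split => // y z yx zx.
have seg s : 0 <= s <= 1 -> `|z + s *: (y - z) - x| < dd.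
  move=> /andP[s0 s1].
  have -> : z + s *: (y - z) - x = (1 - s) *: (z - x) + s *: (y - x).
    have -> : y - z = (y - x) - (z - x) by rewrite opprB addrA subrK.
    by rewrite scalerBl scale1r (scalerBr s (y - x)) [LHS]addrAC [LHS]addrA [RHS]addrAC.
  have [->|sn] := eqVneq s 0; first by rewrite subr0 scale1r scale0r addr0.
  rewrite (le_lt_trans (ler_normD _ _))// !normrZ !ger0_norm// ?subr_ge0//.
  have h1 : (1 - s) * `|z - x| <= (1 - s) * dd by rewrite ler_wpM2l ?subr_ge0// ltW.
  have h2 : s * `|y - x| < s * dd by rewrite ltr_pM2l// lt_def sn.
  have -> : dd = (1 - s) * dd + s * dd by ring.
  by rewrite ler_ltD.
have := @dwithin_mean_value _ W 0 1 (fun s => f (z + s *: (y - z)))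
  (fun s => 'D_(y - z) f (z + s *: (y - z))) (K * `|y - z|) _ _ _ 0 1.
rewrite scale1r scale0r addr0 [z + _]addrC subrK subr0 normr1 mulr1; apply.
- exact: mulr_ge0.
- by move=> s /seg/inU Us; apply: dwithin_line; exact: df.
- by move=> s /seg/HK.
- by rewrite lexx ler01.
- by rewrite lexx ler01.
Qed.

End Loclip.

(** * The pairing of covectors and vectors *)

Definition dot {R : realType} {m : nat} (p v : 'rV[R]_m) : R := \sum_k p 0 k * v 0 k.

Section Dot.
Variables (R : realType) (m : nat).
Implicit Types p v w : 'rV[R]_m.

Lemma dotDl p q v : dot (p + q) v = dot p v + dot q v.
Proof. by rewrite /dot -big_split; apply: eq_bigr => k _; rewrite mxE mulrDl. Qed.
Lemma dotDr p v w : dot p (v + w) = dot p v + dot p w.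
Proof. by rewrite /dot -big_split; apply: eq_bigr => k _; rewrite mxE mulrDr. Qed.
Lemma dotZl a p v : dot (a *: p) v = a * dot p v.
Proof. by rewrite /dot mulr_sumr; apply: eq_bigr => k _; rewrite mxE mulrA. Qed.
Lemma dotZr a p v : dot p (a *: v) = a * dot p v.
Proof. by rewrite /dot mulr_sumr; apply: eq_bigr => k _; rewrite mxE mulrCA. Qed.
Lemma dotNl p v : dot (- p) v = - dot p v.
Proof. by rewrite -scaleN1r dotZl mulN1r. Qed.
Lemma dotNr p v : dot p (- v) = - dot p v.
Proof. by rewrite -scaleN1r dotZr mulN1r. Qed.
Lemma dot0l v : dot 0 v = 0.
Proof. by rewrite -(scale0r 0) dotZl mul0r. Qed.
Lemma dot0r v : dot v 0 = 0.
Proof. by rewrite -(scale0r 0) dotZr mul0r. Qed.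
Lemma dot_sumr k p (v : 'I_k -> 'rV[R]_m) : dot p (\sum_i v i) = \sum_i dot p (v i).
Proof. exact: (big_morph (dot p) (dotDr p) (dot0r p)). Qed.
Lemma dot_delta p j : dot p (delta_mx 0 j) = p 0 j.
Proof.
rewrite /dot (bigD1 j)//= mxE !eqxx mulr1 big1 ?addr0// => k kj.
by rewrite mxE eqxx (negbTE kj) mulr0.
Qed.
Lemma delta_dot v j : dot (delta_mx 0 j) v = v 0 j.
Proof.
rewrite /dot (bigD1 j)//= mxE !eqxx mul1r big1 ?addr0// => k kj.
by rewrite mxE eqxx (negbTE kj) mul0r.
Qed.
End Dot.

Lemma dot_mulmx (R : realType) m k (p : 'rV[R]_m) (v : 'rV[R]_k) (A : 'M[R]_(k, m)) :
  dot (p *m A^T) v = dot p (v *m A).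
Proof.
have dotE j (q w : 'rV[R]_j) : dot q w = (q *m w^T) 0 0.
  by rewrite mxE; apply: eq_bigr => i _; rewrite mxE.
by rewrite !dotE trmx_mul mulmxA.
Qed.

Lemma loclip_dot (R : realType) (V : normedModType R) m (p v : V -> 'rV[R]_m) x :
  loclip p x -> loclip v x -> loclip (fun y => dot (p y) (v y)) x.
Proof.
move=> Lp Lv; apply: loclip_sum => k; apply: loclipM.
  exact: (loclip_comp Lp (loclip_entry k (p x))).
exact: (loclip_comp Lv (loclip_entry k (v x))).
Qed.

Lemma dwithin_dot (R : realType) m (D : set R) (p v : R -> 'rV[R]_m) t p' v' :
  dwithin D p t p' -> dwithin D v t v' ->
  dwithin D (fun s => dot (p s) (v s)) t (dot p' (v t) + dot (p t) v').
Proof.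
move=> Hp Hv; rewrite /dot -big_split.
apply: dwithin_sum => k; apply: dwithinM; exact: dwithin_entry.
Qed.

(** * Directional derivatives *)

Section DirectionalDerivative.
Variable R : realType.
Implicit Types V W : normedModType R.

(** Directional derivatives can be computed along the line itself, by the rules for [dwithin]. *)
Lemma dwithin_derive V W (f : V -> W) (a v : V) (w : W) :
  dwithin `[-1, 1] (fun s => f (a + s *: v)) 0 w -> 'D_v f a = w.
Proof.
move=> H; apply: cvg_lim => //; apply/cvgrPdist_le => e e0.
have [d d0 Hd] := H e e0; rewrite near_withinE; apply/nbhs_ballP.
exists (Num.min d 1); first by rewrite /= lt_min d0 ltr01.
move=> h; rewrite -ball_normE /ball_ /= sub0r normrN lt_min => /andP[hd h1] h0.
have := Hd h; rewrite /= in_itv /= subr0 scale0r addr0.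
have -> : -1 <= h <= 1 by rewrite -ler_norml ltW.
move=> /(_ erefl hd) Hh.
have -> : w - h^-1 *: (f (h *: v + a) - f a) = - (h^-1 *: (f (h *: v + a) - f a - h *: w)).
  by rewrite [in RHS]scalerBr scalerA mulVf// scale1r opprB.
rewrite normrN normrZ normfV mulrC ler_pdivrMr ?normr_gt0//.
by rewrite [h *: v + a]addrC.
Qed.

Lemma derive_sum_delta m W (f : 'rV[R]_m -> W) x v : differentiable f x ->
  'D_v f x = \sum_k v 0 k *: 'D_(delta_mx 0 k) f x.
Proof.
move=> df; rewrite deriveE// [v in LHS]row_sum_delta linear_sum /=.
by apply: eq_bigr => k _; rewrite linearZ deriveE.
Qed.

Lemma derive_comp V W (U : normedModType R) (f : V -> W) (g : W -> U) x y v :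
  f x = y -> differentiable f x -> differentiable g y ->
  'D_v (g \o f) x = 'D_('D_v f x) g y.
Proof.
move=> <- df dg; rewrite deriveE; last exact: differentiable_comp.
by rewrite diff_comp// !deriveE.
Qed.

Lemma derive_linD V W (f : V -> W) x (a b : R) v w : differentiable f x ->
  'D_(a *: v + b *: w) f x = a *: 'D_v f x + b *: 'D_w f x.
Proof. by move=> df; rewrite !deriveE// linearD !linearZ. Qed.

Lemma derive_linB V W (f : V -> W) x v w : differentiable f x ->
  'D_(v - w) f x = 'D_v f x - 'D_w f x.
Proof. by move=> df; rewrite !deriveE// linearB. Qed.

Lemma subr_cancel (Z : zmodType) (a b c d : Z) : c = d -> (a + c) - (b + d) = a - b.
Proof. by move=> ->; rewrite opprD addrACA subrr addr0. Qed.

End DirectionalDerivative.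

#[local] Opaque derive.

Lemma dot_linN (R : realType) m (p v w : 'rV[R]_m) (a b : R) :
  - dot p (a *: v + b *: w) = a * - dot p v + b * - dot p w.
Proof. by rewrite dotDr !dotZr opprD !mulrN. Qed.

(** * Vector fields and covectors in charts *)

Section Charts.
Variables (R : realType) (n : nat) (M : smoothManifold R n).
Implicit Types (i j k : chart_index M) (p q : M) (X Y Z : vector_field M).

Notation img i := (chart i @` chart_dom i).
Notation overlap i j := (chart i @` (chart_dom i `&` chart_dom j)).
Notation psi i j := (chart j \o chart_inv i).

Lemma img_chart i p : chart_dom i p -> img i (chart i p).
Proof. by exists p. Qed.

Lemma overlap_chart i j p : chart_dom i p -> chart_dom j p -> overlap i j (chart i p).
Proof. by exists p. Qed.

Lemma overlap_open i j : open (overlap i j).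
Proof.
have -> : overlap i j = img i `&` (chart_inv i @^-1` chart_dom j).
  apply/seteqP; split => [x [p [ip jp] <-]|x [[p ip <-]]] /=.
    by split; [exists p|rewrite chartK].
  by rewrite chartK// => jp; exists p.
rewrite openE => x [ix jx]; rewrite /interior; apply: filterI.
  by apply: open_nbhs_nbhs; split => //; exact: chart_img_open.
apply: (chart_inv_continuous ix); apply: open_nbhs_nbhs; split => //.
exact: chart_dom_open.
Qed.

Lemma psi_chart i j p : chart_dom i p -> psi i j (chart i p) = chart j p.
Proof. by move=> ip; rewrite /= chartK. Qed.

Lemma psi_differentiable i j p : chart_dom i p -> chart_dom j p ->
  differentiable (psi i j) (chart i p).
Proof.
move=> ip jp; apply: (smooth_differentiable (transition_smooth i j)).
exact: overlap_chart.
Qed.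

Lemma mul_transition_jac i j p (v : 'rV[R]_n) : chart_dom i p -> chart_dom j p ->
  v *m transition_jac i j p = 'D_v (psi i j) (chart i p).
Proof. by move=> ip jp; rewrite deriveEjacobian//; exact: psi_differentiable. Qed.

#[local] Opaque transition_jac.

Lemma transition_jac_id i p : chart_dom i p -> transition_jac i i p = 1%:M.
Proof.
move=> ip; apply/row_matrixP => l; rewrite !rowE mulmx1 mul_transition_jac//.
rewrite (@derive_eq_on _ _ _ (img i) (psi i i) id) ?derive_id//.
- exact: chart_img_open.
- by move=> _ [q iq <-]; rewrite psi_chart.
Qed.

Lemma transition_jac_mul i j k p : chart_dom i p -> chart_dom j p -> chart_dom k p ->
  transition_jac i j p *m transition_jac j k p = transition_jac i k p.
Proof.
move=> ip jp kp.
apply/row_matrixP => l.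
rewrite !rowE.
rewrite mulmxA.
rewrite [LHS](mul_transition_jac _ jp kp).
rewrite [RHS](mul_transition_jac _ ip kp).
rewrite (mul_transition_jac _ ip jp).
rewrite (@derive_eq_on _ _ _ (overlap i j) (psi i k) (psi j k \o psi i j)).
- exact/esym/(derive_comp _ (psi_chart j ip) (psi_differentiable ip jp) (psi_differentiable jp kp)).
- exact: overlap_open.
- exact: overlap_chart.
- by move=> _ [q [iq jq] <-]; rewrite psi_chart//= chartK// chartK.
Qed.

Lemma vf_coordE X i p : chart_dom i p ->
  vf_coord X i (chart i p) = X p *m transition_jac (chart_at p) i p.
Proof. by move=> ip; rewrite /vf_coord chartK. Qed.

Lemma vf_coord_at X p : vf_coord X (chart_at p) (chart (chart_at p) p) = X p.
Proof.
by rewrite vf_coordE ?transition_jac_id ?mulmx1//; exact: chart_at_dom.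
Qed.

Lemma vf_coord_change X i j p : chart_dom i p -> chart_dom j p ->
  vf_coord X j (chart j p) = 'D_(vf_coord X i (chart i p)) (psi i j) (chart i p).
Proof.
move=> ip jp; have ap := chart_at_dom p.
rewrite -(mul_transition_jac _ ip jp) (vf_coordE _ jp) (vf_coordE _ ip) -mulmxA.
by rewrite (transition_jac_mul ap ip jp).
Qed.

Lemma smooth_vf_img X i : smooth_vf_on setT X -> smooth_on (img i) (vf_coord X i).
Proof. by move=> /(_ i); rewrite setIT. Qed.

Lemma vf_coord_differentiable X i p : smooth_vf_on setT X -> chart_dom i p ->
  differentiable (vf_coord X i) (chart i p).
Proof. by move=> sX ip; apply: (smooth_differentiable (smooth_vf_img i sX)); exact: img_chart. Qed.

Lemma line_near (V : normedModType R) (U : set V) x v : open U -> U x ->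
  exists2 d : R, 0 < d & forall s : R, `|s - 0| < d -> U (x + s *: v).
Proof.
move=> oU Ux; have /nbhs_ballP[r /= r0 Hr] : nbhs x U by exact: open_nbhs_nbhs.
have v0 : 0 < `|v| + 1 by rewrite ltr_wpDl.
exists (r / (`|v| + 1)); first exact: divr_gt0.
move=> s; rewrite subr0 ltr_pdivlMr// => sr; apply: Hr.
rewrite -ball_normE /ball_ /= opprD addrA subrr sub0r normrN normrZ (le_lt_trans _ sr)//.
by rewrite ler_wpM2l// lerDl.
Qed.

(** Differentiating $X_j\circ\psi = D\psi(X_i)$ produces the second derivative of the
    transition map; its symmetry is what makes brackets and Hamiltonian fields independent of
    the chart. *)
Lemma derive_vf_coord_change X i j p v : smooth_vf_on setT X ->
  chart_dom i p -> chart_dom j p ->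
  'D_('D_v (psi i j) (chart i p)) (vf_coord X j) (chart j p) =
  'D_('D_v (vf_coord X i) (chart i p)) (psi i j) (chart i p) +
  'D_(vf_coord X i (chart i p)) ('D_v (psi i j)) (chart i p).
Proof.
move=> sX ip jp; set x := chart i p.
have oO := overlap_open (i := i) (j := j).
have Ox : overlap i j x by exact: overlap_chart.
have sT := transition_smooth i j.
have dpsi y : overlap i j y -> differentiable (psi i j) y by exact: smooth_differentiable.
have dX : differentiable (vf_coord X i) x by exact: vf_coord_differentiable.
have Ep : psi i j x = chart j p := psi_chart j ip.
have dXj : differentiable (vf_coord X j) (chart j p) by exact: vf_coord_differentiable.
apply: (etrans (esym (derive_comp v Ep (dpsi x Ox) dXj))).
apply: dwithin_derive; apply: dwithin_row => m.
have [d d0 Hd] := line_near v oO Ox.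
apply: (@dwithin_near R R `[-1, 1] `[-1, 1]
  (fun s => \sum_l vf_coord X i (x + s *: v) 0 l *
    ('D_(delta_mx 0 l) (psi i j) (x + s *: v)) 0 m) _ 0 _ d d0).
- move=> s Ds /Hd Us; split => //; case: Us => q [iq jq] qE /=.
  rewrite -qE chartK// (vf_coord_change X iq jq) derive_sum_delta; last first.
    by apply: dpsi; exact: overlap_chart.
  by rewrite summxE; apply: eq_bigr => l _; rewrite [RHS]mxE.
- rewrite /= scale0r addr0 chartK// (vf_coord_change X ip jp) derive_sum_delta; last exact: dpsi.
  by rewrite summxE; apply: eq_bigr => l _; rewrite [RHS]mxE.
have E : ('D_('D_v (vf_coord X i) x) (psi i j) x + 'D_(vf_coord X i x) ('D_v (psi i j)) x) 0 m
  = \sum_l (('D_v (vf_coord X i) x) 0 l * ('D_(delta_mx 0 l) (psi i j) x) 0 m +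
      vf_coord X i x 0 l * ('D_v ('D_(delta_mx 0 l) (psi i j)) x) 0 m).
  rewrite big_split [LHS]mxE; congr (_ + _).
    rewrite (derive_sum_delta _ (dpsi x Ox)) summxE.
    by apply: eq_bigr => l _; rewrite [LHS]mxE.
  have dDv := smooth_differentiable (smooth_derive v sT) Ox.
  apply: (etrans (congr1 (fun A : 'rV[R]_n => A 0 m) (derive_sum_delta (vf_coord X i x) dDv))).
  rewrite summxE; apply: eq_bigr => l _; rewrite [LHS]mxE.
  exact: (congr1 (fun A : 'rV[R]_n => _ * A 0 m) (derive_comm v (delta_mx 0 l) oO Ox (sT 2))).
rewrite E; apply: dwithin_sum => l.
have line0 (V : normedModType R) (f : 'rV[R]_n -> V) : differentiable f x ->
    dwithin `[-1, 1] (fun s => f (x + s *: v)) 0 ('D_v f x).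
  move=> df; have := @dwithin_line R _ V `[-1, 1] f x v 0.
  by rewrite scale0r addr0; apply.
have := dwithinM (dwithin_entry 0 l (line0 _ _ dX))
  (dwithin_entry 0 m (line0 _ _ (smooth_differentiable (smooth_derive (delta_mx 0 l) sT) Ox))).
by rewrite scale0r addr0.
Qed.

(** ** Lie brackets *)

Definition bracket_coord i X Y (x : 'rV[R]_n) : 'rV[R]_n :=
  'D_(vf_coord X i x) (vf_coord Y i) x - 'D_(vf_coord Y i x) (vf_coord X i) x.

Lemma lie_bracketE X Y p :
  lie_bracket X Y p = bracket_coord (chart_at p) X Y (chart (chart_at p) p).
Proof. by rewrite /bracket_coord !vf_coord_at. Qed.

Lemma bracket_coord_change X Y i j p : smooth_vf_on setT X -> smooth_vf_on setT Y ->
  chart_dom i p -> chart_dom j p ->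
  bracket_coord j X Y (chart j p) = 'D_(bracket_coord i X Y (chart i p)) (psi i j) (chart i p).
Proof.
move=> sX sY ip jp; rewrite /bracket_coord.
rewrite (vf_coord_change X ip jp) (vf_coord_change Y ip jp).
have EY := derive_vf_coord_change (vf_coord X i (chart i p)) sY ip jp.
have EX := derive_vf_coord_change (vf_coord Y i (chart i p)) sX ip jp.
apply: (etrans (congr2 (fun a b => a - b) EY EX)).
have dpsi := psi_differentiable ip jp.
have Ec := derive_comm (vf_coord X i (chart i p)) (vf_coord Y i (chart i p))
  (overlap_open (i := i) (j := j)) (overlap_chart ip jp) (transition_smooth i j 2).
apply: (etrans (subr_cancel _ _ Ec)).
exact/esym/(derive_linB _ _ dpsi).
Qed.

(** The bracket is defined at each point in the chart chosen there; it has the same expression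
    in every chart, and in particular it is smooth. *)
Lemma vf_coord_bracket X Y i p : smooth_vf_on setT X -> smooth_vf_on setT Y ->
  chart_dom i p ->
  vf_coord (lie_bracket X Y) i (chart i p) = bracket_coord i X Y (chart i p).
Proof.
move=> sX sY ip; have ap := chart_at_dom p.
rewrite (vf_coordE _ ip) lie_bracketE (bracket_coord_change sX sY ip ap).
rewrite -(mul_transition_jac _ ip ap) -mulmxA.
by rewrite (transition_jac_mul ip ap ip) (transition_jac_id ip) mulmx1.
Qed.

Lemma lie_bracket_smooth X Y : smooth_vf_on setT X -> smooth_vf_on setT Y ->
  smooth_vf_on setT (lie_bracket X Y).
Proof.
move=> sX sY i; rewrite setIT => k; have oI : open (img i) by exact: chart_img_open.
have CX m := smooth_vf_img i sX m; have CY m := smooth_vf_img i sY m.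
pose B (Y Z : vector_field M) x : 'rV[R]_n :=
  \row_m \sum_l vf_coord Y i x 0 l * ('D_(delta_mx 0 l) (vf_coord Z i) x) 0 m.
have CB Y' Z' : smooth_on (img i) (vf_coord Y' i) -> smooth_on (img i) (vf_coord Z' i) ->
    Ck k (img i) (B Y' Z').
  move=> sY' sZ'; apply: Ck_row => // m; apply: (Ck_eq_on oI _ (Ck_sum oI _)).
    by move=> x _; rewrite mxE.
  by move=> l; apply: CkM => //; apply: Ck_entry => //; exact: (smooth_derive _ sZ' k).
apply: (Ck_eq_on oI _ (CkD oI (CB X Y CX CY) (CkN oI (CB Y X CY CX)))).
move=> _ [p ip <-]; rewrite vf_coord_bracket// /bracket_coord.
by congr (_ - _); rewrite derive_sum_delta; try exact: vf_coord_differentiable;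
  apply/rowP => m; rewrite /B mxE summxE; apply: eq_bigr => l _; rewrite !mxE.
Qed.

(** The control at a given time makes the velocity a combination of the frame with constant
    coefficients, so that one field at a time is enough to state the equations. *)
Definition vf_lin (a b : R) X Y : vector_field M := fun p => a *: X p + b *: Y p.

Lemma vf_coord_lin a b X Y i x :
  vf_coord (vf_lin a b X Y) i x = a *: vf_coord X i x + b *: vf_coord Y i x.
Proof. by rewrite /vf_coord /vf_lin mulmxDl !scalemxAl. Qed.

Lemma vf_lin_smooth a b X Y : smooth_vf_on setT X -> smooth_vf_on setT Y ->
  smooth_vf_on setT (vf_lin a b X Y).
Proof.
move=> sX sY i; rewrite setIT => k; have oI : open (img i) by exact: chart_img_open.
apply: Ck_row => // j.
have Cs (c : R) Z : smooth_vf_on setT Z -> Ck k (img i) (fun x => c * vf_coord Z i x 0 j).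
  by move=> sZ; apply: CkM => //; [exact: Ck_cst|apply: Ck_entry => //; exact: smooth_vf_img].
apply: (Ck_eq_on oI _ (CkD oI (Cs a X sX) (Cs b Y sY))) => x _.
by rewrite vf_coord_lin !mxE.
Qed.

Lemma derive_vf_lin a b X Y i p v : smooth_vf_on setT X -> smooth_vf_on setT Y ->
  chart_dom i p -> 'D_v (vf_coord (vf_lin a b X Y) i) (chart i p) =
    a *: 'D_v (vf_coord X i) (chart i p) + b *: 'D_v (vf_coord Y i) (chart i p).
Proof.
move=> sX sY ip.
have -> : vf_coord (vf_lin a b X Y) i =
    (fun x => (a *: vf_coord X i x)) \+ (fun x => b *: vf_coord Y i x).
  by apply/funext => x; exact: vf_coord_lin.
have dX : derivable (vf_coord X i) (chart i p) v.
  exact/diff_derivable/vf_coord_differentiable.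
have dY : derivable (vf_coord Y i) (chart i p) v.
  exact/diff_derivable/vf_coord_differentiable.
by rewrite deriveD; [rewrite !deriveZ|exact: derivableZ|exact: derivableZ].
Qed.

Lemma lie_bracket_linl a b X Y Z p : smooth_vf_on setT X -> smooth_vf_on setT Y ->
  smooth_vf_on setT Z -> lie_bracket (vf_lin a b X Y) Z p =
    a *: lie_bracket X Z p + b *: lie_bracket Y Z p.
Proof.
move=> sX sY sZ; have ap := chart_at_dom p.
rewrite /lie_bracket derive_vf_lin// /vf_lin derive_linD; last exact: vf_coord_differentiable.
by rewrite !scalerBr opprD addrACA.
Qed.

Lemma lie_bracketxx X p : lie_bracket X X p = 0.
Proof. by rewrite /lie_bracket subrr. Qed.

Lemma lie_bracketC X Y p : lie_bracket X Y p = - lie_bracket Y X p.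
Proof. by rewrite /lie_bracket opprB. Qed.

(** ** Cotangent coordinates *)

Lemma ct_coord_at (l : cotangent M) :
  ct_coord (chart_at l.1) l = (chart (chart_at l.1) l.1, l.2).
Proof.
by rewrite /ct_coord transition_jac_id ?trmx1 ?mulmx1//; exact: chart_at_dom.
Qed.

Lemma ct_coord_change i j (l : cotangent M) : chart_dom i l.1 -> chart_dom j l.1 ->
  (ct_coord j l).2 = (ct_coord i l).2 *m (transition_jac j i l.1)^T.
Proof.
move=> il jl; have al := chart_at_dom l.1.
by rewrite /= -mulmxA -trmx_mul (transition_jac_mul jl il al).
Qed.

Lemma ct_coord_of_coord i x (p : 'rV[R]_n) : img i x -> ct_coord i (ct_of_coord i x p) = (x, p).
Proof.
move=> [q iq <-]; have aq := chart_at_dom q; rewrite /ct_of_coord /ct_coord /= !chartK//.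
by rewrite -mulmxA -trmx_mul (transition_jac_mul iq aq iq) (transition_jac_id iq) trmx1 mulmx1.
Qed.

Lemma ct_coord_inj i (l l' : cotangent M) : chart_dom i l.1 -> chart_dom i l'.1 ->
  ct_coord i l = ct_coord i l' -> l = l'.
Proof.
move=> il il' E.
have E1 : chart i l.1 = chart i l'.1 := congr1 fst E.
have E2 : l.2 *m (transition_jac i (chart_at l.1) l.1)^T =
          l'.2 *m (transition_jac i (chart_at l'.1) l'.1)^T := congr1 snd E.
have Eq : l.1 = l'.1 by rewrite -(chartK il) E1 chartK.
rewrite -Eq in E2; have al := chart_at_dom l.1.
have := congr1 (fun w => w *m (transition_jac (chart_at l.1) i l.1)^T) E2.
rewrite -!mulmxA -trmx_mul (transition_jac_mul al il al) (transition_jac_id al) trmx1 !mulmx1.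
by move: Eq; case: (l) (l') => [q p] [q' p'] /= -> ->.
Qed.

Lemma hfun_coord X i (l : cotangent M) : chart_dom i l.1 ->
  hfun X l = dot (ct_coord i l).2 (vf_coord X i (chart i l.1)).
Proof.
move=> il; have al := chart_at_dom l.1.
rewrite (vf_coordE _ il) /= dot_mulmx -mulmxA (transition_jac_mul al il al).
by rewrite (transition_jac_id al) mulmx1.
Qed.

Lemma hfun_ct_of_coord X i x (p : 'rV[R]_n) : hfun X (ct_of_coord i x p) = dot p (vf_coord X i x).
Proof. by rewrite -dot_mulmx. Qed.

(** The Hamiltonian field of $h_X$ in the canonical coordinates of chart [i]. *)
Definition ham_coord i X (z : 'rV[R]_n * 'rV[R]_n) : 'rV[R]_n * 'rV[R]_n :=
  (vf_coord X i z.1, \row_k - dot z.2 ('D_(delta_mx 0 k) (vf_coord X i) z.1)).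

Lemma ham_vfE X l : smooth_vf_on setT X ->
  ham_vf (hfun X) l = ham_coord (chart_at l.1) X (ct_coord (chart_at l.1) l).
Proof.
move=> sX; have al := chart_at_dom l.1.
rewrite ct_coord_at /ham_vf /ham_coord /=; congr (_, _); apply/rowP => k; rewrite [LHS]mxE.
  apply: dwithin_derive; have -> : vf_coord X (chart_at l.1) (chart (chart_at l.1) l.1) 0 k =
    dot (delta_mx 0 k) (vf_coord X (chart_at l.1) (chart (chart_at l.1) l.1)) +
    dot (l.2 + 0 *: delta_mx 0 k) 0.
    by rewrite dot0r addr0 delta_dot.
  under [X in dwithin _ X]eq_fun => s do rewrite hfun_ct_of_coord.
  apply: (@dwithin_dot R n `[-1, 1] (fun s => l.2 + s *: delta_mx 0 k) (cst _)); last exact: dwithin_cst.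
  move=> e e0; exists 1 => // s _ _.
  by rewrite opprD addrACA subrr add0r -scalerBl subrr normr0 mulr_ge0// ltW.
rewrite [RHS]mxE; congr (- _); apply: dwithin_derive.
under [X in dwithin _ X]eq_fun => s do rewrite hfun_ct_of_coord.
set Y := vf_coord X _; set x := chart _ _.
have -> : dot l.2 ('D_(delta_mx 0 k) Y x) =
   dot 0 (Y (x + 0 *: delta_mx 0 k)) + dot l.2 ('D_(delta_mx 0 k) Y (x + 0 *: delta_mx 0 k)).
  by rewrite dot0l add0r scale0r addr0.
apply: (@dwithin_dot R n `[-1, 1] (cst l.2) (fun s => Y (x + s *: delta_mx 0 k))).
  exact: dwithin_cst.
apply: dwithin_line; rewrite scale0r addr0; exact: vf_coord_differentiable.
Qed.

Lemma ham_coord_lin a b X Y i z : smooth_vf_on setT X -> smooth_vf_on setT Y ->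
  img i z.1 -> ham_coord i (vf_lin a b X Y) z = a *: ham_coord i X z + b *: ham_coord i Y z.
Proof.
move=> sX sY [p ip zE]; rewrite /ham_coord -zE; apply/eqP.
rewrite xpair_eqE /= vf_coord_lin eqxx /=; apply/eqP/rowP => k.
rewrite [LHS]mxE.
apply: (etrans (congr1 (fun w => - dot z.2 w) (derive_vf_lin a b (delta_mx 0 k) sX sY ip))).
apply: (etrans (dot_linN _ _ _ _ _)).
by rewrite [RHS]mxE; congr (_ + _); rewrite [RHS]mxE; congr (_ * _); rewrite [RHS]mxE.
Qed.

Lemma ham_vf_lin a b X Y l : smooth_vf_on setT X -> smooth_vf_on setT Y ->
  ham_vf (hfun (vf_lin a b X Y)) l = a *: ham_vf (hfun X) l + b *: ham_vf (hfun Y) l.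
Proof.
move=> sX sY; rewrite !ham_vfE//; last exact: vf_lin_smooth.
by rewrite ham_coord_lin// ct_coord_at; exists l.1 => //; exact: chart_at_dom.
Qed.

End Charts.

#[local] Opaque derive transition_jac lie_bracket vf_coord.

Lemma dot_cancel (R : realType) m (p v w : 'rV[R]_m) :
  - dot p (v + w) + dot p w = - dot p v.
Proof. by rewrite dotDr opprD subrK. Qed.

(** * Hamiltonian equations along a curve of covectors *)

Lemma dot_lin (R : realType) m (p v w : 'rV[R]_m) (a b : R) :
  dot p (a *: v + b *: w) = a * dot p v + b * dot p w.
Proof. by rewrite dotDr !dotZr. Qed.

Lemma dot_linlN (R : realType) m (p q v : 'rV[R]_m) (a b : R) :
  - dot (a *: p + b *: q) v = a * - dot p v + b * - dot q v.
Proof. by rewrite dotDl !dotZl opprD !mulrN. Qed.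

Section Flow.
Variables (R : realType) (n : nat) (M : smoothManifold R n).
Implicit Types (i j : chart_index M) (X Y Z : vector_field M) (D : set R)
  (lam : R -> cotangent M).

Notation img i := (chart i @` chart_dom i).
Notation psi i j := (chart j \o chart_inv i).

(** Needed besides the derivative in a chart, which says nothing about the times at which the
    curve is outside of the chart. *)
Definition base_cont D lam (t : R) : Prop := forall U : set M, nbhs (lam t).1 U ->
  exists2 d : R, 0 < d & forall s, D s -> `|s - t| < d -> U (lam s).1.

Definition flow_in i D lam t Z : Prop :=
  dwithin D (ct_coord i \o lam) t (ham_coord i Z (ct_coord i (lam t))).

(** The equation at time [t] for the frozen field [Z]: only the value at [t] of a time-dependent
    field enters. *)
Definition flow_at D lam t Z : Prop :=
  base_cont D lam t /\ flow_in (chart_at (lam t).1) D lam t Z.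

Lemma nbhs_chart_dom i (p : M) : chart_dom i p -> nbhs p (chart_dom i).
Proof. by move=> ip; apply: open_nbhs_nbhs; split => //; exact: chart_dom_open. Qed.

Lemma dot_codrift (Y : 'rV[R]_n -> 'rV[R]_n) p w x : differentiable Y x ->
  dot (\row_k - dot p ('D_(delta_mx 0 k) Y x)) w = - dot p ('D_w Y x).
Proof.
move=> dY; apply/esym.
apply: (etrans (congr1 (fun u => - dot p u) (derive_sum_delta w dY))).
rewrite dot_sumr -sumrN; apply: eq_bigr => k _.
by rewrite dotZr mxE mulNr mulrC.
Qed.

Lemma ct_coord_change_entry i j (l : cotangent M) m : chart_dom i l.1 -> chart_dom j l.1 ->
  (ct_coord j l).2 0 m = dot (ct_coord i l).2 ('D_(delta_mx 0 m) (psi j i) (chart j l.1)).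
Proof.
move=> il jl; apply: (etrans (congr1 (fun A : 'rV[R]_n => A 0 m) (ct_coord_change il jl))).
apply: (etrans (esym (dot_delta _ m))); apply: (etrans (dot_mulmx _ _ _)).
exact: (congr1 (dot _) (mul_transition_jac (delta_mx 0 m) jl il)).
Qed.

Lemma flow_in_base i D lam t Z : flow_in i D lam t Z ->
  dwithin D (fun s => chart i (lam s).1) t (vf_coord Z i (chart i (lam t).1)).
Proof. exact: dwithin_fst. Qed.

(** The Hamiltonian equations have the same form in all charts: the covector coordinates change by
    the Jacobian, whose derivative along the curve is cancelled by the second derivative of the
    transition map in [derive_vf_coord_change]. *)
Lemma flow_in_change i j D lam t Z : smooth_vf_on setT Z ->
  chart_dom i (lam t).1 -> chart_dom j (lam t).1 -> base_cont D lam t ->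
  flow_in i D lam t Z -> flow_in j D lam t Z.
Proof.
move=> sZ it jt bc H.
have [d d0 Hd] := bc _ (filterI (nbhs_chart_dom it) (nbhs_chart_dom jt)).
have Hbase := flow_in_base H.
have Hj : dwithin D (fun s => chart j (lam s).1) t (vf_coord Z j (chart j (lam t).1)).
  have dpsi := psi_differentiable it jt.
  have := dwithin_comp dpsi Hbase.
  rewrite -(deriveE _ dpsi) => Hc.
  rewrite (vf_coord_change Z it jt).
  apply: (dwithin_near d0 _ _ Hc) => [s Ds sd|] /=; last by rewrite chartK.
  by have [si sj] := Hd s Ds sd; split => //; rewrite chartK.
apply: dwithin_pair => //; apply: dwithin_row => m /=.
pose W := 'D_(delta_mx 0 m) (psi j i).
have dW : differentiable W (chart j (lam t).1).
  apply: (smooth_differentiable (smooth_derive _ (transition_smooth j i))).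
  exact: overlap_chart.
have HW := dwithin_comp dW Hj; rewrite -(deriveE _ dW) in HW.
have Hdot := dwithin_dot (dwithin_snd H) HW.
have Eder : dot (ham_coord i Z (ct_coord i (lam t))).2 (W (chart j (lam t).1)) +
   dot (ct_coord i (lam t)).2 ('D_(vf_coord Z j (chart j (lam t).1)) W (chart j (lam t).1)) =
   (ham_coord j Z (ct_coord j (lam t))).2 0 m.
  rewrite [RHS]mxE dot_codrift; last exact: vf_coord_differentiable.
  apply: (etrans (congr1 (fun u => - dot _ u + _)
    (derive_vf_coord_change (delta_mx 0 m) sZ jt it))).
  apply: (etrans (dot_cancel _ _ _)); apply: (congr1 -%R); apply/esym.
  apply: (etrans (congr1 (fun q => dot q _) (ct_coord_change it jt))).
  apply: (etrans (dot_mulmx _ _ _)).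
  exact: (congr1 (dot _) (mul_transition_jac _ jt it)).
rewrite Eder in Hdot.
apply: (dwithin_near d0 _ _ Hdot) => [s Ds sd|].
  by have [si sj] := Hd s Ds sd; split => //; exact/esym/ct_coord_change_entry.
exact/esym/ct_coord_change_entry.
Qed.

Lemma flow_at_in i D lam t Z : smooth_vf_on setT Z -> chart_dom i (lam t).1 ->
  flow_at D lam t Z -> flow_in i D lam t Z.
Proof.
by move=> sZ it [bc H]; exact: (flow_in_change sZ (chart_at_dom _) it bc H).
Qed.

Lemma flow_in_at i D lam t Z : smooth_vf_on setT Z -> chart_dom i (lam t).1 ->
  base_cont D lam t -> flow_in i D lam t Z -> flow_at D lam t Z.
Proof.
by move=> sZ it bc H; split; [exact: bc|exact: (flow_in_change sZ it (chart_at_dom _) bc H)].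
Qed.

(** The motion of the covector contributes $-\langle\lambda, DZ(Y)\rangle$ and that of the base
    point $\langle\lambda, DY(Z)\rangle$. *)
Lemma flow_hfun D lam t Z Y : smooth_vf_on setT Z -> smooth_vf_on setT Y ->
  flow_at D lam t Z ->
  dwithin D (fun s => hfun Y (lam s)) t (hfun (lie_bracket Z Y) (lam t)).
Proof.
move=> sZ sY [bc H]; set i := chart_at (lam t).1 in H.
have it : chart_dom i (lam t).1 := chart_at_dom _.
have [d d0 Hd] := bc _ (nbhs_chart_dom it).
have dY : differentiable (vf_coord Y i) (chart i (lam t).1) by exact: vf_coord_differentiable.
have HY := dwithin_comp dY (flow_in_base H); rewrite -(deriveE _ dY) in HY.
have Hdot := dwithin_dot (dwithin_snd H) HY.
have E : dot (ham_coord i Z (ct_coord i (lam t))).2 (vf_coord Y i (chart i (lam t).1)) +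
   dot (ct_coord i (lam t)).2
     ('D_(vf_coord Z i (chart i (lam t).1)) (vf_coord Y i) (chart i (lam t).1)) =
   hfun (lie_bracket Z Y) (lam t).
  rewrite dot_codrift; last exact: vf_coord_differentiable.
  rewrite (hfun_coord _ it) (vf_coord_bracket sZ sY it) /bracket_coord.
  by rewrite dotDr dotNr addrC.
rewrite E in Hdot.
apply: (dwithin_near d0 _ _ Hdot) => [s Ds sd|]; last by rewrite (hfun_coord _ it).
by split => //; rewrite (hfun_coord _ (Hd s Ds sd)).
Qed.

Lemma flow_hfun_lin D lam t a b X1 X2 Y : smooth_vf_on setT X1 -> smooth_vf_on setT X2 ->
  smooth_vf_on setT Y -> flow_at D lam t (vf_lin a b X1 X2) ->
  dwithin D (fun s => hfun Y (lam s)) t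
    (a * hfun (lie_bracket X1 Y) (lam t) + b * hfun (lie_bracket X2 Y) (lam t)).
Proof.
move=> s1 s2 sY H.
have E := lie_bracket_linl a b (lam t).1 s1 s2 sY.
have E2 := etrans (congr1 (dot (lam t).2) E) (dot_lin _ _ _ _ _).
exact: (eq_ind _ (dwithin D _ t) (flow_hfun (vf_lin_smooth a b s1 s2) sY H) _ E2).
Qed.

(** ** Locality *)

Lemma flow_at_near D D' lam lam' t Z (d : R) : 0 < d ->
  (forall s, D' s -> `|s - t| < d -> D s /\ lam s = lam' s) -> lam t = lam' t ->
  flow_at D lam t Z -> flow_at D' lam' t Z.
Proof.
move=> d0 E Et [bc H]; split.
  move=> U; rewrite -Et => /bc[e e0 He]; exists (Num.min d e); first by rewrite lt_min d0.
  by move=> s Ds; rewrite lt_min => /andP[sd se]; have [Ds' <-] := E s Ds sd; exact: He.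
rewrite /flow_in -Et; apply: (dwithin_near d0 _ _ H) => [s Ds sd|] /=; last by rewrite Et.
by have [Ds' ->] := E s Ds sd.
Qed.

Lemma flow_at_subset D D' lam t Z : D' `<=` D -> flow_at D lam t Z -> flow_at D' lam t Z.
Proof. by move=> sub; apply: (flow_at_near ltr01) => // s /sub. Qed.

Lemma flow_at_setU D D' lam t Z :
  flow_at D lam t Z -> flow_at D' lam t Z -> flow_at (D `|` D') lam t Z.
Proof.
move=> [bc H] [bc' H']; split; last exact: dwithin_setU.
move=> U HU; have [d d0 Hd] := bc U HU; have [e e0 He] := bc' U HU.
exists (Num.min d e); first by rewrite lt_min d0.
by move=> s [] Ds; rewrite lt_min => /andP[sd se]; [exact: Hd|exact: He].
Qed.

(** ** Curves given in a chart *)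

Lemma flow_of_coord i D (z : R -> 'rV[R]_n * 'rV[R]_n) t Z : smooth_vf_on setT Z ->
  D t -> (forall s, D s -> img i (z s).1) ->
  dwithin D z t (ham_coord i Z (z t)) ->
  flow_at D (fun s => ct_of_coord i (z s).1 (z s).2) t Z.
Proof.
move=> sZ Dt zi H.
have zE s : D s -> ct_coord i (ct_of_coord i (z s).1 (z s).2) = z s.
  by move=> /zi zs; rewrite ct_coord_of_coord// -surjective_pairing.
have it : chart_dom i (chart_inv i (z t).1).
  by have [p ip <-] := zi t Dt; rewrite chartK.
set lam := fun s => ct_of_coord i (z s).1 (z s).2.
have bc : base_cont D lam t.
  move=> U /= HU; have /nbhs_ballP[r /= r0 Hr] := chart_inv_continuous (zi t Dt) HU.
  have [d d0 Hd] := dwithin_cwithin (dwithin_fst H) r0.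
  exists d => // s Ds sd; apply: Hr; rewrite -ball_normE /ball_ /= distrC.
  exact: Hd.
have fi : flow_in i D lam t Z.
  rewrite /flow_in (zE t Dt).
  apply: (dwithin_near ltr01 _ _ H) => [s Ds _|]; last exact: (esym (zE t Dt)).
  by split; [exact: Ds|exact: (esym (zE s Ds))].
have it' : chart_dom i (lam t).1 := it.
exact: (flow_in_at sZ it' bc fi).
Qed.

(** ** Lifts of a fixed curve *)

(** The equation is linear on the fibres over a fixed base curve. *)
Lemma flow_at_lin D (gamma : R -> M) (p q : R -> 'rV[R]_n) a b t Z :
  flow_at D (fun s => (gamma s, p s)) t Z -> flow_at D (fun s => (gamma s, q s)) t Z ->
  flow_at D (fun s => (gamma s, a *: p s + b *: q s)) t Z.
Proof.
move=> [bc Hp] [_ Hq]; split => //; rewrite /flow_in /= in Hp Hq *.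
set i := chart_at (gamma t) in Hp Hq *.
have Hb := dwithin_fst Hp; have {}Hp := dwithin_snd Hp; have {}Hq := dwithin_snd Hq.
apply: dwithin_pair; first exact: Hb.
have := dwithinD (dwithinZ a Hp) (dwithinZ b Hq).
set v := (X in dwithin _ _ _ X); set v' := (X in _ -> dwithin _ _ _ X).
have -> : v = v'.
  apply/rowP => k; rewrite /v /v' [LHS]mxE [X in X + _]mxE [X in _ + X]mxE [X in _ * X + _]mxE.
  rewrite [X in _ + _ * X]mxE [RHS]mxE /= mulmxDl -!scalemxAl.
  exact/esym/dot_linlN.
apply: (dwithin_near ltr01) => [s Ds _|] /=; last by rewrite mulmxDl -!scalemxAl.
by rewrite mulmxDl -!scalemxAl.
Qed.

End Flow.

(** * Continuity relative to a set *)

Section Cwithin.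
Variable R : realType.
Implicit Types (V W : normedModType R) (D : set R).

Lemma cwithin_near V D (D' : set R) (f f' : R -> V) t (d : R) : 0 < d ->
  (forall s, D' s -> `|s - t| < d -> D s /\ f s = f' s) -> f t = f' t ->
  cwithin D f t -> cwithin D' f' t.
Proof.
move=> d0 E Et H e e0; have [k k0 Hk] := H e e0.
exists (Num.min d k); first by rewrite lt_min d0.
move=> s Ds; rewrite lt_min => /andP[sd sk].
by have [Ds' <-] := E s Ds sd; rewrite -Et; exact: Hk.
Qed.

Lemma cwithin_subset V D (D' : set R) (f : R -> V) t :
  D' `<=` D -> cwithin D f t -> cwithin D' f t.
Proof. by move=> sub H e /H[d d0 Hd]; exists d => // s /sub; exact: Hd. Qed.

Lemma cwithin_cst V D (a : V) t : cwithin D (cst a) t.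
Proof. by move=> e e0; exists 1 => // s _ _; rewrite subrr normr0. Qed.

Lemma cwithin_loclip V W D (f : R -> V) (g : V -> W) t :
  cwithin D f t -> loclip g (f t) -> cwithin D (g \o f) t.
Proof.
move=> cf [K [d [K0 d0 Hd]]] e e0.
have K1 : 0 < K + 1 by rewrite ltr_wpDl.
have m0 : 0 < Num.min d (e / (K + 1)) by rewrite lt_min d0 divr_gt0.
have [k k0 Hk] := cf _ m0; exists k => // s Ds sk.
have := Hk s Ds sk; rewrite lt_min ltr_pdivlMr// => /andP[s1 s2].
have tt : `|f t - f t| < d by rewrite subrr normr0.
rewrite (le_lt_trans (Hd _ _ s1 tt))// (le_lt_trans _ s2)// mulrC ler_wpM2l// lerDl.
by [].
Qed.

Lemma cwithin_pair V W D (f : R -> V) (g : R -> W) t :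
  cwithin D f t -> cwithin D g t -> cwithin D (fun s => (f s, g s)) t.
Proof.
move=> cf cg e e0; have [d d0 Hd] := cf e e0; have [k k0 Hk] := cg e e0.
exists (Num.min d k); first by rewrite lt_min d0.
move=> s Ds; rewrite lt_min => /andP[sd sk].
by rewrite [ltLHS]prod_normE gt_max Hd// Hk.
Qed.

Lemma cwithinD V D (f g : R -> V) t :
  cwithin D f t -> cwithin D g t -> cwithin D (fun s => f s + g s) t.
Proof.
move=> cf cg; have cfg := cwithin_pair cf cg.
apply: (cwithin_loclip (g := fun z : V * V => z.1 + z.2) cfg).
by apply: loclipD; [exact: loclip_fst|exact: loclip_snd].
Qed.

Lemma cwithin_scale V D (a : R -> R) (f : R -> V) t :
  cwithin D a t -> cwithin D f t -> cwithin D (fun s => a s *: f s) t.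
Proof.
move=> ca cf; have caf := cwithin_pair ca cf.
apply: (cwithin_loclip (g := fun z : R * V => z.1 *: z.2) caf).
by apply: loclip_scale; [exact: loclip_fst|exact: loclip_snd].
Qed.

Lemma cwithinN V D (f : R -> V) t : cwithin D f t -> cwithin D (fun s => - f s) t.
Proof.
move=> cf e /cf[d d0 Hd]; exists d => // s Ds sd.
by rewrite -opprD normrN; exact: Hd.
Qed.

Lemma cwithinM D (a b : R -> R) t :
  cwithin D a t -> cwithin D b t -> cwithin D (fun s => a s * b s) t.
Proof. exact: cwithin_scale. Qed.

Lemma cwithin_bounded V D (f : R -> V) t : cwithin D f t ->
  exists2 d : R, 0 < d & forall s, D s -> `|s - t| < d -> `|f s| <= `|f t| + 1.
Proof.
move=> /(_ 1 ltr01)[d d0 Hd]; exists d => // s Ds sd.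
rewrite -[f s](subrK (f t)) (le_trans (ler_normD _ _))// addrC lerD2l.
by rewrite ltW// Hd.
Qed.

Lemma cwithin_within V (a b : R) (f : R -> V) :
  (forall t, a <= t <= b -> cwithin `[a, b] f t) <-> {within `[a, b], continuous f}.
Proof.
split=> [H|/subspace_continuousP H t tab e e0].
  apply/subspace_continuousP => t; rewrite /= in_itv /= => tab.
  apply/cvgrPdist_lt => e e0; have [d d0 Hd] := H t tab e e0.
  rewrite near_withinE; apply/nbhs_ballP; exists d => //= s.
  by rewrite -ball_normE /ball_ /= distrC => sd sab; rewrite distrC; exact: Hd.
have /cvgrPdist_lt/(_ e e0) := H t tab.
rewrite near_withinE => /nbhs_ballP[d /= d0 Hd]; exists d => // s sab sd.
by rewrite distrC; apply: Hd => //; rewrite -ball_normE /ball_ /= distrC.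
Qed.

Lemma cwithin_sum V m D (f : 'I_m -> R -> V) t :
  (forall i, cwithin D (f i) t) -> cwithin D (fun s => \sum_i f i s) t.
Proof.
elim: m f => [|m IH] f H.
  by under [X in cwithin _ X]eq_fun do rewrite big_ord0; exact: cwithin_cst.
under [X in cwithin _ X]eq_fun do rewrite big_ord_recl.
by apply: cwithinD; [exact: H|apply: IH => i; exact: H].
Qed.

Lemma cwithin_row m D (f : 'I_m -> R -> R) t :
  (forall k, cwithin D (f k) t) -> cwithin D (fun s => \row_k f k s) t.
Proof.
move=> H.
have -> : (fun s => \row_k f k s) = (fun s => \sum_k f k s *: delta_mx 0 k).
  by apply/funext => s; rewrite [LHS]row_sum_delta; apply: eq_bigr => k _; rewrite mxE.
by apply: cwithin_sum => k; apply: cwithin_scale; [exact: H|exact: cwithin_cst].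
Qed.

Lemma cwithin_entry m j D (f : R -> 'rV[R]_m) t :
  cwithin D f t -> cwithin D (fun s => f s 0 j) t.
Proof. by move=> cf; exact: cwithin_loclip cf (loclip_entry j (f t)). Qed.

Lemma cwithin_dot m D (p v : R -> 'rV[R]_m) t :
  cwithin D p t -> cwithin D v t -> cwithin D (fun s => dot (p s) (v s)) t.
Proof.
by move=> cp cv; apply: cwithin_sum => k; apply: cwithinM; exact: cwithin_entry.
Qed.

Lemma dot_norm m (p v : 'rV[R]_m) : `|dot p v| <= m%:R * (`|p| * `|v|).
Proof.
rewrite (le_trans (ler_norm_sum _ _ _))//.
apply: (@le_trans _ _ (\sum_(k < m) `|p| * `|v|)).
  by apply: ler_sum => k _; rewrite normrM ler_pM// normr_mx_entry.
by rewrite sumr_const card_ord mulr_natl.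
Qed.

End Cwithin.

(** * Gluing solutions *)

Section Transport.
Variables (R : realType) (n : nat) (M : smoothManifold R n) (X1 X2 : vector_field M).
Hypotheses (s1 : smooth_vf_on setT X1) (s2 : smooth_vf_on setT X2).
Implicit Types (i j : chart_index M) (D : set R) (lam : R -> cotangent M).

Notation img i := (chart i @` chart_dom i).

Lemma ham_coord_loclip i X z : smooth_vf_on setT X -> img i z.1 -> loclip (ham_coord i X) z.
Proof.
move=> sX iz; have sY := smooth_vf_img i sX.
have oI : open (img i) by exact: chart_img_open.
have lf := loclip_fst z.
apply: loclip_pair; first exact: loclip_comp lf (Ck1_loclip oI iz (sY 1%N)).
apply: (loclip_row (f := fun k (z : 'rV[R]_n * 'rV[R]_n) =>
   - dot z.2 ('D_(delta_mx 0 k) (vf_coord X i) z.1))) => k.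
apply: loclipN; apply: loclip_dot; first exact: loclip_snd.
exact: loclip_comp lf (Ck1_loclip oI iz (smooth_derive (delta_mx 0 k) sY 1%N)).
Qed.

(** At the junction the two one-sided derivatives agree, because the equation determines them from
    the common value. *)
Lemma flow_glue (x y z : R) lam1 lam2 (V : R -> vector_field M) : x <= y <= z ->
  lam1 y = lam2 y ->
  (forall t, x <= t <= y -> flow_at `[x, y] lam1 t (V t)) ->
  (forall t, y <= t <= z -> flow_at `[y, z] lam2 t (V t)) ->
  forall t, x <= t <= z -> flow_at `[x, z] (fun r => if r <= y then lam1 r else lam2 r) t (V t).
Proof.
move=> /andP[xy yz] E H1 H2 t /andP[xt tz].
pose lam r := if r <= y then lam1 r else lam2 r.
rewrite -/lam.
have L1 r : r <= y -> lam1 r = lam r by rewrite /lam => ->.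
have L2 r : y <= r -> lam2 r = lam r.
  by rewrite /lam le_eqVlt => /orP[/eqP <-|]; [rewrite lexx E|rewrite ltNge => /negbTE ->].
case: (ltgtP t y) => ty.
- have d0 : 0 < y - t by rewrite subr_gt0.
  have Ht : flow_at `[x, y] lam1 t (V t) by apply: H1; rewrite xt ltW.
  apply: (flow_at_near d0 _ _ Ht); last exact/L1/ltW.
  move=> s /=; rewrite !in_itv /= => /andP[xs sz]; rewrite ltr_norml => /andP[_ h].
  have sy : s <= y by lra.
  by split; [rewrite xs|exact: L1].
- have d0 : 0 < t - y by rewrite subr_gt0.
  have Ht : flow_at `[y, z] lam2 t (V t) by apply: H2; rewrite tz ltW.
  apply: (flow_at_near d0 _ _ Ht); last exact/L2/ltW.
  move=> s /=; rewrite !in_itv /= => /andP[xs sz]; rewrite ltr_norml => /andP[h _].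
  have sy : y <= s by lra.
  by split; [rewrite sy|exact: L2].
- have F1 : flow_at `[x, y] lam t (V t).
    apply: (flow_at_near ltr01 _ _ (H1 t _)); rewrite ?xt ?ty ?lexx//; last exact: L1.
    by move=> s /=; rewrite in_itv /= => /andP[xs sy] _; split; [rewrite xs|exact: L1].
  have F2 : flow_at `[y, z] lam t (V t).
    apply: (flow_at_near ltr01 _ _ (H2 t _)); rewrite ?tz ?ty ?lexx//; last exact: L2.
    by move=> s /=; rewrite in_itv /= => /andP[ys sz] _; split; [rewrite ys|exact: L2].
  apply: flow_at_subset (flow_at_setU F1 F2) => s /=; rewrite !in_itv /= => /andP[xs sz].
  by case: (leP s y) => sy; [left; rewrite xs|right; rewrite sz ltW].
Qed.

End Transport.

(** * Parallel transport of covectors *)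

Section ParallelTransport.
Variables (R : realType) (n : nat) (M : smoothManifold R n) (X1 X2 : vector_field M).
Hypotheses (s1 : smooth_vf_on setT X1) (s2 : smooth_vf_on setT X2).
Variables (T : R) (gamma : R -> M) (u1 u2 : R -> R) (p0 : R -> 'rV[R]_n).
Implicit Types (i j : chart_index M) (r s t : R).

Let Z t := vf_lin (u1 t) (u2 t) X1 X2.

Hypothesis Hu1 : forall t, 0 <= t <= T -> cwithin `[0, T] u1 t.
Hypothesis Hu2 : forall t, 0 <= t <= T -> cwithin `[0, T] u2 t.
Hypothesis H0 : forall t, 0 <= t <= T -> flow_at `[0, T] (fun s => (gamma s, p0 s)) t (Z t).

Let sZ t : smooth_vf_on setT (Z t).
Proof. exact: vf_lin_smooth. Qed.

(* in chart [i] the equation for the covector [q] is [q' = drift i s q], linear in [q] *)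
Let coef i (k : 'I_n) s := 'D_(delta_mx 0 k) (vf_coord (Z s) i) (chart i (gamma s)).

Let base_at i t : 0 <= t <= T -> chart_dom i (gamma t) ->
  exists2 d : R, 0 < d & forall s, 0 <= s <= T -> `|s - t| < d -> chart_dom i (gamma s).
Proof.
move=> tT it; have [bc _] := H0 tT.
have [d d0 Hd] := bc _ (nbhs_chart_dom it).
by exists d => // s sT; apply: Hd; rewrite /= in_itv.
Qed.

Let coef_cwithin i k t : 0 <= t <= T -> chart_dom i (gamma t) ->
  cwithin `[0, T] (coef i k) t.
Proof.
move=> tT it; have [d d0 Hd] := base_at tT it.
have E s : chart_dom i (gamma s) -> coef i k s =
    u1 s *: 'D_(delta_mx 0 k) (vf_coord X1 i) (chart i (gamma s)) +
    u2 s *: 'D_(delta_mx 0 k) (vf_coord X2 i) (chart i (gamma s)).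
  by move=> is_; exact: derive_vf_lin.
have cx : cwithin `[0, T] (fun s => chart i (gamma s)) t.
  by apply/dwithin_cwithin/(flow_in_base (flow_at_in (sZ t) _ (H0 tT))).
have lip X : smooth_vf_on setT X ->
    loclip ('D_(delta_mx 0 k) (vf_coord X i)) (chart i (gamma t)).
  move=> sX; apply: (Ck1_loclip (chart_img_open (i := i)) (img_chart it)).
  exact: (smooth_derive _ (smooth_vf_img i sX) 1%N).
have C := cwithinD (cwithin_scale (Hu1 tT) (cwithin_loclip cx (lip _ s1)))
  (cwithin_scale (Hu2 tT) (cwithin_loclip cx (lip _ s2))).
apply: (cwithin_near d0 _ _ C) => [s Ds sd|]; last exact: (esym (E t it)).
by split; [exact: Ds|apply/esym/E; apply: Hd sd; move: Ds; rewrite /= in_itv].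
Qed.

Let coef_bounded i t : 0 <= t <= T -> chart_dom i (gamma t) ->
  exists d B : R, [/\ 0 < d, 0 <= B & forall s, 0 <= s <= T -> `|s - t| < d ->
    chart_dom i (gamma s) /\ forall k, `|coef i k s| <= B].
Proof.
move=> tT it; have [d d0 Hd] := base_at tT it.
have /choice[e He] : forall k, exists e : R, 0 < e /\ forall s, 0 <= s <= T ->
    `|s - t| < e -> `|coef i k s| <= `|coef i k t| + 1.
  move=> k; have [e e0 He] := cwithin_bounded (coef_cwithin k tT it).
  by exists e; split => // s sT; apply: He; rewrite /= in_itv.
exists (\big[Num.min/d]_k e k), (\sum_k (`|coef i k t| + 1)); split.
- by apply: (big_ind (fun x : R => 0 < x)) => // [p q pp0 q0|j _];
    [rewrite lt_min pp0|have [] := He j].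
- by apply: sumr_ge0 => k _; rewrite addr_ge0.
move=> s sT st; split; first by apply: Hd => //; rewrite (lt_le_trans st)// bigmin_le_id.
move=> k; have [_ Hk] := He k.
have sk : `|s - t| < e k by rewrite (lt_le_trans st)//; exact: bigmin_le_cond.
rewrite (le_trans (Hk s sT sk))// (bigD1 k)//= lerDl; apply: sumr_ge0 => j _.
by rewrite addr_ge0.
Qed.

Let drift i s (q : 'rV[R]_n) : 'rV[R]_n := \row_k - dot q (coef i k s).

Let drift_bound i s q B : (forall k, `|coef i k s| <= B) -> 0 <= B ->
  `|drift i s q| <= n%:R * B * `|q|.
Proof.
move=> HB B0; apply: normr_mx_le => [|a k]; first by rewrite !mulr_ge0.
by rewrite mxE normrN (le_trans (dot_norm _ _))// -mulrA ler_wpM2l// mulrC ler_wpM2r.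
Qed.

Let covec i (p : R -> 'rV[R]_n) s : 'rV[R]_n := (ct_coord i (gamma s, p s)).2.

Let covec_flow i (p : R -> 'rV[R]_n) D t : chart_dom i (gamma t) ->
  flow_at D (fun s => (gamma s, p s)) t (Z t) ->
  dwithin D (covec i p) t (drift i t (covec i p t)).
Proof.
by move=> it H; exact: dwithin_snd (flow_at_in (lam := fun s => (gamma s, p s)) (sZ t) it H).
Qed.

Let covec_eq0 i p s : chart_dom i (gamma s) -> covec i p s = 0 <-> p s = 0.
Proof.
move=> it; rewrite /covec; split => [H|->]; last exact: mul0mx.
have E : (gamma s, p s) = (gamma s, 0) :> cotangent M.
  apply: (@ct_coord_inj _ _ _ i) => //; apply: (f_equal2 pair) => //.
  by rewrite [LHS]H; exact/esym/mul0mx.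
exact: (congr1 (fun l : cotangent M => l.2) E).
Qed.

(** Vanishing of a transported covector is decided near each time: in a chart the equation is
    linear, so that [dwithin_zero] spreads a zero to a neighbourhood of fixed size. *)
Lemma transport_zero (t : R) (p : R -> 'rV[R]_n) (s0 : R) : t <= T ->
  (forall s, 0 <= s <= t -> flow_at `[0, t] (fun r => (gamma r, p r)) s (Z s)) ->
  0 <= s0 <= t -> p s0 = 0 -> forall s, 0 <= s <= t -> p s = 0.
Proof.
move=> tT Hp s0t ps0; apply: (itv_connected s0t ps0) => s st.
have subT r : 0 <= r <= t -> 0 <= r <= T by move=> /andP[-> h]; exact: le_trans tT.
set i := chart_at (gamma s).
have is_ : chart_dom i (gamma s) := chart_at_dom _.
have [d [B [d0 B0 HB]]] := coef_bounded (subT s st) is_.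
pose C := n%:R * B.
have C0 : 0 <= C by exact: mulr_ge0.
have [d' d'0 Hd'] := cwithin_bounded (dwithin_cwithin (covec_flow is_ (Hp s st))).
pose e := Num.min (Num.min d d') (2 * (C + 1))^-1.
have e0 : 0 < e by rewrite !lt_min d0 d'0 invr_gt0 mulr_gt0// ltr_wpDl.
have Ce : C * e <= 1 / 2.
  have c2 : 0 < 2 * (C + 1) by rewrite mulr_gt0// ltr_wpDl.
  have : e * (2 * (C + 1)) <= 1 by rewrite -ler_pdivlMr// div1r ge_min lexx orbT.
  have := e0; lra.
pose a' := Num.max 0 (s - e / 2); pose b' := Num.min t (s + e / 2).
have inab r : 0 <= r <= t -> `|r - s| < e / 2 -> a' <= r <= b'.
  by rewrite ltr_norml /a' /b' ge_max le_min => /andP[-> ->] /andP[? ?]; apply/andP; lra.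
have abin r : a' <= r <= b' -> 0 <= r <= t /\ `|r - s| < e.
  rewrite /a' /b' ge_max le_min => /andP[/andP[-> ?] /andP[-> ?]]; split=> //.
  by rewrite ltr_norml; apply/andP; lra.
have e20 : 0 < e / 2 by rewrite divr_gt0.
exists (e / 2) => //.
have [[r0 [r0t r0s pr0]]|none] :=
    pselect (exists r0, [/\ 0 <= r0 <= t, `|r0 - s| < e / 2 & p r0 = 0]); last first.
  by right => r rt rs pr; apply: none; exists r.
left => r rt rs.
have dom q : a' <= q <= b' -> [/\ 0 <= q <= t, chart_dom i (gamma q),
    forall k, `|coef i k q| <= B & `|covec i p q| <= `|covec i p s| + 1].
  move=> /abin[qt qs].
  have [qd qd'] : `|q - s| < d /\ `|q - s| < d'.
    by move: qs; rewrite !lt_min => /andP[/andP[]].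
  have [h1 h2] := HB q (subT q qt) qd.
  by split => //; apply: Hd' => //; rewrite /= in_itv.
have [_ ir _ _] := dom r (inab r rt rs).
have [_ ir0 _ _] := dom r0 (inab r0 r0t r0s).
apply/(covec_eq0 _ ir).
apply: (@dwithin_zero R _ a' b' r0 (covec i p) (fun q => drift i q (covec i p q)) C
   (`|covec i p s| + 1)) => //.
- rewrite (le_trans _ Ce)// ler_wpM2l//.
  have [h1 h2] : s - e / 2 <= a' /\ b' <= s + e / 2.
    by rewrite /a' /b' le_max ge_min !lexx !orbT.
  lra.
- exact: inab.
- exact/covec_eq0.
- by move=> q /dom[].
- move=> q /dom[qt qi _ _]; apply: dwithin_subset (covec_flow qi (Hp q qt)).
  by move=> v /=; rewrite !in_itv /= => /abin[].
- by move=> q /dom[_ _ hB _]; exact: drift_bound.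
- exact: inab.
Qed.

Lemma transport_unique (t : R) (p q : R -> 'rV[R]_n) (s0 : R) : t <= T ->
  (forall s, 0 <= s <= t -> flow_at `[0, t] (fun r => (gamma r, p r)) s (Z s)) ->
  (forall s, 0 <= s <= t -> flow_at `[0, t] (fun r => (gamma r, q r)) s (Z s)) ->
  0 <= s0 <= t -> p s0 = q s0 -> forall s, 0 <= s <= t -> p s = q s.
Proof.
move=> tT Hp Hq s0t E s st; apply/eqP; rewrite -subr_eq0; apply/eqP.
have H r : 0 <= r <= t ->
    flow_at `[0, t] (fun r => (gamma r, 1 *: p r + (-1) *: q r)) r (Z r).
  by move=> rt; exact: flow_at_lin (Hp r rt) (Hq r rt).
have := transport_zero tT H s0t _ st; rewrite !scale1r !scaleN1r; apply.
by rewrite E subrr.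
Qed.

(* The length of the interval of existence depends on the coefficients only and not on [xi]: the
   radius [`|y0| + 1] of the ball grows with the covector, as the bound on the field does. *)
Let local_transport s : 0 <= s <= T -> exists2 d : R, 0 < d & forall x y,
  0 <= x -> x <= s -> s <= y -> y <= T -> s - x < d -> y - s < d ->
  forall xi, exists2 p : R -> 'rV[R]_n, p x = xi &
  forall r, x <= r <= y -> flow_at `[x, y] (fun q => (gamma q, p q)) r (Z r).
Proof.
move=> sT; set i := chart_at (gamma s).
have is_ : chart_dom i (gamma s) := chart_at_dom _.
have [d [B [d0 B0 HB]]] := coef_bounded sT is_.
pose C := n%:R * B.
have C0 : 0 <= C by exact: mulr_ge0.
pose e := (2 * (C + 1))^-1.
have e0 : 0 < e by rewrite invr_gt0 mulr_gt0// ltr_wpDl.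
have Ce : 2 * (C * e) <= 1.
  have c2 : 0 < 2 * (C + 1) by rewrite mulr_gt0// ltr_wpDl.
  have : e * (2 * (C + 1)) = 1 by rewrite /e mulVf ?lt0r_neq0.
  have := e0; lra.
exists (Num.min d (e / 2)); first by rewrite lt_min d0 divr_gt0.
move=> x y x0 xs sy yT; rewrite !lt_min => /andP[xd xe] /andP[yd ye] xi.
have xy := le_trans xs sy.
have dom r : x <= r <= y -> [/\ 0 <= r <= T, chart_dom i (gamma r) &
    forall k, `|coef i k r| <= B].
  move=> /andP[xr ry].
  have rT : 0 <= r <= T by rewrite (le_trans x0)// (le_trans ry).
  have rd : `|r - s| < d by rewrite ltr_norml; apply/andP; lra.
  by have [h1 h2] := HB r rT rd.
pose clamp (r : R) := Num.max x (Num.min r y).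
have clampxy r : x <= clamp r <= y by rewrite /clamp le_max lexx/= ge_max xy ge_min lexx orbT.
have clampE r : x <= r <= y -> clamp r = r.
  by rewrite /clamp => /andP[h1 h2]; rewrite min_l// max_r.
have clampL r r' : `|clamp r - clamp r'| <= `|r - r'|.
  exact: clamp_lipschitz.
pose F r q := drift i (clamp r) q.
pose y0 := covec i (cst xi) x.
have linF r q q' : F r q - F r q' = drift i (clamp r) (q - q').
  by apply/rowP => k; rewrite !mxE dotDl dotNl !opprD.
have FB r q : `|F r q| <= C * `|q|.
  by apply: drift_bound => //; have [] := dom _ (clampxy r).
have [|||||||||q [q0 Hq]] := @picard R 'rV[R]_n F x y0 (`|y0| + 1) (C * (2 * `|y0| + 1)) C e
   (@has_primitives_row R n) (@geom_complete_row R n).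
- by rewrite addr_ge0.
- by rewrite mulr_ge0// addr_ge0// mulr_ge0.
- exact: C0.
- exact: e0.
- have -> : C * (2 * `|y0| + 1) * e = 2 * (C * e) * (`|y0| + 1 / 2) by field.
  have := normr_ge0 y0; move: Ce; set c := 2 * _; set v := `|y0| => h1 h2.
  have : c * (v + 1 / 2) <= 1 * (v + 1 / 2) by rewrite ler_wpM2r//; lra.
  lra.
- lra.
- move=> r q qy; rewrite (le_trans (FB r q))// ler_wpM2l//.
  rewrite -[q](subrK y0) (le_trans (ler_normD _ _))//; lra.
- by move=> r q q' _ _; rewrite linF; apply: drift_bound => //; have [] := dom _ (clampxy r).
- move=> q _ r; apply/cvgrPdist_lt => ee ee0.
  have [cT ci _] := dom _ (clampxy r).
  have cF : cwithin `[0, T] (fun v => drift i v q) (clamp r).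
    apply: cwithin_row => k; apply: cwithinN; apply: cwithin_dot; first exact: cwithin_cst.
    exact: coef_cwithin.
  have [w w0 Hw] := cF _ ee0; apply/nbhs_ballP; exists w => //= r'.
  rewrite /ball /= distrC => rr'; rewrite distrC; apply: Hw.
    by have [h _ _] := dom _ (clampxy r'); rewrite /= in_itv.
  exact: le_lt_trans (clampL _ _) rr'.
pose p r := (ct_of_coord i (chart i (gamma r)) (q r)).2.
have pE r : x <= r <= y ->
    ct_of_coord i (chart i (gamma r)) (q r) = (gamma r, p r).
  by move=> /dom[_ ir _]; rewrite /p /ct_of_coord /= chartK.
have inab r : x <= r <= y -> x - e <= r <= x + e by move=> /andP[? ?]; apply/andP; lra.
exists p.
  have xxy : x <= x <= y by rewrite lexx.
  have [_ ix _] := dom x xxy.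
  have E : (gamma x, p x) = (gamma x, xi) :> cotangent M.
    apply: (etrans (esym (pE x xxy))); apply: (@ct_coord_inj _ _ _ i).
    - by rewrite /= chartK.
    - exact: ix.
    apply: (etrans (ct_coord_of_coord _ (img_chart ix))).
    exact: (f_equal2 pair (erefl _) q0).
  exact: (congr1 (fun l : cotangent M => l.2) E).
move=> r rxy.
have flow : flow_at `[x, y] (fun v => ct_of_coord i (chart i (gamma v)) (q v)) r (Z r).
  apply: (@flow_of_coord _ _ _ i `[x, y] (fun v => (chart i (gamma v), q v)) r (Z r) (sZ r)).
  - by rewrite /= in_itv.
  - by move=> v /=; rewrite in_itv /= => /dom[_ iv _]; exact: img_chart.
  apply: dwithin_pair => /=.
    have [rT ir _] := dom r rxy.
    apply: dwithin_subset (flow_in_base (flow_at_in (lam := fun s => (gamma s, p0 s)) (sZ r) ir (H0 rT))).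
    by move=> v /=; rewrite !in_itv /= => /dom[].
  have [_ Hr] := Hq r (inab r rxy).
  rewrite /F clampE// in Hr.
  by apply: dwithin_subset Hr => v /=; rewrite !in_itv /= => /inab.
apply: (flow_at_near ltr01 _ _ flow) => [v|]; last exact: pE.
by rewrite /= in_itv /= => vxy _; split; [exact: vxy|exact: pE].
Qed.

(** Local solutions exist around each time for all initial covectors, and [cousin] chains them. *)
Lemma transport_exists (xi : 'rV[R]_n) : 0 <= T -> exists2 p : R -> 'rV[R]_n, p 0 = xi &
  forall t, 0 <= t <= T -> flow_at `[0, T] (fun s => (gamma s, p s)) t (Z t).
Proof.
move=> T0; move: xi; apply: (cousin (Q := fun x y => forall xi, exists2 p : R -> 'rV[R]_n,
  p x = xi & forall t, x <= t <= y -> flow_at `[x, y] (fun s => (gamma s, p s)) t (Z t)) T0).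
  move=> x y z x0 xy yz zT H1 H2 xi.
  have [p px Hp] := H1 xi; have [q qy Hq] := H2 (p y).
  exists (fun r => if r <= y then p r else q r); first by rewrite xy.
  have xyz : x <= y <= z by rewrite xy.
  have E : (gamma y, p y) = (gamma y, q y) by rewrite qy.
  move=> t txz; apply: flow_at_near ltr01 _ _ (flow_glue xyz E Hp Hq txz).
    by move=> s Ds _; split; [exact: Ds|case: ifP].
  by case: ifP.
move=> s sT; have [d d0 Hd] := local_transport sT.
by exists d => // x y x0 xs sy yT xd yd xi; exact: Hd.
Qed.

End ParallelTransport.

(** * Abnormal lifts *)

Section AbsCont.
Variables (R : realType) (V : normedModType R).
Implicit Types (a b : R) (f g : R -> V).

Lemma abs_cont_subset a b a' b' f : a <= a' -> b' <= b -> abs_cont a b f -> abs_cont a' b' f.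
Proof.
move=> aa bb H e /H[d d0 Hd]; exists d => // m x y Hxy; apply: Hd => i.
have [h1 [h2 h3]] := Hxy i; split; first exact: le_trans h1.
by split => //; exact: le_trans bb.
Qed.

Lemma abs_contD a b f g : abs_cont a b f -> abs_cont a b g ->
  abs_cont a b (fun s => f s + g s).
Proof.
move=> Hf Hg e e0; have e2 : 0 < e / 2 by rewrite divr_gt0.
have [d d0 Hd] := Hf _ e2; have [k k0 Hk] := Hg _ e2.
exists (Num.min d k); first by rewrite lt_min d0.
move=> m x y H1 H2; rewrite lt_min => /andP[sd sk].
rewrite (splitr e) (le_lt_trans _ (ltrD (Hd m x y H1 H2 sd) (Hk m x y H1 H2 sk)))//.
by rewrite -big_split; apply: ler_sum => i _; rewrite opprD addrACA ler_normD.
Qed.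

Lemma abs_cont_cwithin a b f s : a <= s <= b -> abs_cont a b f -> cwithin `[a, b] f s.
Proof.
move=> /andP[as_ sb] H e /H[d d0 Hd]; exists d => // r.
rewrite /= in_itv /= => /andP[ar rb] rs.
have := Hd 1%N (fun=> Num.min r s) (fun=> Num.max r s); rewrite !big_ord1.
move=> /(_ _ _ _) h; have {h} : `|f (Num.max r s) - f (Num.min r s)| < e.
  apply: h.
  - by move=> _; rewrite le_min ge_max ar as_ rb sb; case: (leP r s) => // /ltW.
  - by move=> i j; rewrite !ord1.
  - by rewrite max_sub_min.
by rewrite dist_min_max.
Qed.

Lemma abs_cont_linear a b (v : V) : abs_cont a b (fun s => s *: v).
Proof.
apply: (@lipschitz_abs_cont R V a b _ `|v|) => x y _ _.
by rewrite -scalerBl normrZ mulrC.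
Qed.

End AbsCont.

Section Abnormal.
Variables (R : realType) (n : nat) (M : smoothManifold R n) (X1 X2 : vector_field M).
Hypotheses (s1 : smooth_vf_on setT X1) (s2 : smooth_vf_on setT X2).
Hypothesis indep : forall p a b a' b',
  a *: X1 p + b *: X2 p = a' *: X1 p + b' *: X2 p -> a = a' /\ b = b'.
Implicit Types (i j : chart_index M) (lam : R -> cotangent M) (r s t : R).

Notation img i := (chart i @` chart_dom i).

Lemma ct_velocity_flow t lam s a b :
  ct_velocity t lam s (a *: ham_vf (hfun X1) (lam s) + b *: ham_vf (hfun X2) (lam s)) <->
  flow_in (chart_at (lam s).1) `[0, t] lam s (vf_lin a b X1 X2).
Proof.
have E : a *: ham_vf (hfun X1) (lam s) + b *: ham_vf (hfun X2) (lam s) =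
    ham_coord (chart_at (lam s).1) (vf_lin a b X1 X2) (ct_coord (chart_at (lam s).1) (lam s)).
  apply: (etrans (esym (ham_vf_lin a b (lam s) s1 s2))).
  exact: (ham_vfE (lam s) (vf_lin_smooth a b s1 s2)).
by rewrite /ct_velocity E; exact: derivative_onE.
Qed.

Lemma flow_velocity t lam s Z : flow_at `[0, t] lam s Z ->
  dwithin `[0, t] (chart (chart_at (lam s).1) \o (fun r => (lam r).1)) s (Z (lam s).1).
Proof.
by move=> [_ /flow_in_base]; rewrite vf_coord_at.
Qed.

Lemma control_unique t lam lam' s a b a' b' : 0 < t -> 0 <= s <= t ->
  (forall r, 0 <= r <= t -> (lam r).1 = (lam' r).1) ->
  flow_at `[0, t] lam s (vf_lin a b X1 X2) -> flow_at `[0, t] lam' s (vf_lin a' b' X1 X2) ->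
  a = a' /\ b = b'.
Proof.
move=> t0 st E /flow_velocity H /flow_velocity H'.
apply: (indep (p := (lam s).1)); apply: (dwithin_unique t0 st H).
rewrite (E s st); apply: (dwithin_near ltr01 _ _ H') => [r rt _|]; last first.
  by rewrite /= (E s st).
have rt' : 0 <= r <= t by move: rt; rewrite /= in_itv.
by split; [exact: rt|rewrite /= (E r rt')].
Qed.

Variables (T : R) (gamma : R -> M) (u1 u2 : R -> R) (p0 : R -> 'rV[R]_n).

Let Z t := vf_lin (u1 t) (u2 t) X1 X2.

Hypothesis Hu1 : forall t, 0 <= t <= T -> cwithin `[0, T] u1 t.
Hypothesis Hu2 : forall t, 0 <= t <= T -> cwithin `[0, T] u2 t.
Hypothesis H0 : forall t, 0 <= t <= T -> flow_at `[0, T] (fun s => (gamma s, p0 s)) t (Z t).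

Let sZ t : smooth_vf_on setT (Z t).
Proof. exact: vf_lin_smooth. Qed.

Let ham_cwithin i lam t s : t <= T -> 0 <= s <= t -> base_cont `[0, t] lam s ->
  chart_dom i (lam s).1 -> cwithin `[0, t] (ct_coord i \o lam) s ->
  cwithin `[0, t] (fun r => ham_coord i (Z r) (ct_coord i (lam r))) s.
Proof.
move=> tT st bc is_ cc.
have [d d0 Hd] := bc _ (nbhs_chart_dom is_).
have sub := itv0_subset tT.
have sT : 0 <= s <= T := itv0_le tT st.
have lip X : smooth_vf_on setT X -> loclip (ham_coord i X) (ct_coord i (lam s)).
  by move=> sX; apply: ham_coord_loclip => //; exact: img_chart.
have C := cwithinD
  (cwithin_scale (cwithin_subset sub (Hu1 sT)) (cwithin_loclip cc (lip _ s1)))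
  (cwithin_scale (cwithin_subset sub (Hu2 sT)) (cwithin_loclip cc (lip _ s2))).
have E r : chart_dom i (lam r).1 -> ham_coord i (Z r) (ct_coord i (lam r)) =
   u1 r *: ham_coord i X1 (ct_coord i (lam r)) + u2 r *: ham_coord i X2 (ct_coord i (lam r)).
  by move=> ir; apply: (ham_coord_lin _ _ s1 s2); exact: (img_chart ir).
apply: (cwithin_near d0 _ _ C) => [r Dr rs|]; last exact: (esym (E s is_)).
by split; [exact: Dr|exact: (esym (E r (Hd r Dr rs)))].
Qed.

(** Abnormal lifts are a priori only absolutely continuous, with an $L^2$ control; since the
    frame is independent that control is [u] almost everywhere, and as [u] is continuous the
    lift solves its equation at every time. *)
Lemma abnormal_lift_flow t lam : 0 < t -> t <= T -> abnormal_lift X1 X2 t gamma lam ->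
  forall s, 0 <= s <= t -> flow_at `[0, t] lam s (Z s).
Proof.
move=> t0 tT [v1 [v2 [[_ _ _ Hvel] [Hac Hbase Hh Hct]]]] s st.
have sub := itv0_subset tT.
have inT r : 0 <= r <= t -> 0 <= r <= T := itv0_le tT.
have Href r : 0 <= r <= t -> flow_at `[0, t] (fun s => (gamma s, p0 s)) r (Z r).
  by move=> rt; exact: flow_at_subset sub (H0 (inT r rt)).
have bc r : 0 <= r <= t -> base_cont `[0, t] lam r.
  move=> rt U; rewrite (Hbase r rt) => HU; have [bcr _] := Href r rt.
  have [d d0 Hd] := bcr U HU; exists d => // q qt qr.
  by rewrite Hbase; [exact: Hd|move: qt; rewrite /= in_itv].
pose P1 := [set r : R | 0 <= r <= t ->
  velocity t gamma r (v1 r *: X1 (gamma r) + v2 r *: X2 (gamma r))].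
pose P2 := [set r : R | 0 <= r <= t -> ct_velocity t lam r
  (v1 r *: ham_vf (hfun X1) (lam r) + v2 r *: ham_vf (hfun X2) (lam r))].
pose N := ~` P1 `|` ~` P2.
have N0 : (@lebesgue_measure R).-negligible N by exact: negligibleU.
have flow_ae r : 0 <= r <= t -> ~ N r -> flow_at `[0, t] lam r (Z r).
  move=> rt Nr; have [r1 r2] : P1 r /\ P2 r.
    by split; apply: contrapT => h; apply: Nr; [left|right].
  have := r1 rt; rewrite /velocity => /derivative_onE vel.
  have [E1 E2] := indep (dwithin_unique t0 rt vel (flow_velocity (Href r rt))).
  split; first exact: bc.
  by apply/ct_velocity_flow; move: (r2 rt); rewrite E1 E2.
have [i [e [e0 ei eac]]] := Hac s st.
have is_ : chart_dom i (lam s).1 by apply: ei => //; rewrite subrr normr0 ltW.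
set a := Num.max 0 (s - e) in eac; set b := Num.min t (s + e) in eac.
have near_ab r : 0 <= r <= t -> `|r - s| < e -> a <= r <= b.
  rewrite /a /b ge_max le_min ltr_norml => /andP[-> ->] /andP[? ?].
  by apply/andP; split; lra.
have sab : a <= s <= b by apply: near_ab => //; rewrite subrr normr0.
set c := ct_coord i \o lam in eac.
have cc : cwithin `[0, t] c s.
  apply: (cwithin_near e0 _ _ (abs_cont_cwithin sab eac)) => // r.
  by rewrite /= !in_itv /= => rt rs; split => //; exact: near_ab.
have cw := ham_cwithin tT st (bc s st) is_ cc.
set w := (fun r => ham_coord i (Z r) (ct_coord i (lam r))) in cw.
have goal : flow_in i `[0, t] lam s (Z s).
  move=> ee ee0; have [d d0 Hd] := cw ee ee0.
  exists (Num.min d e); first by rewrite lt_min d0.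
  move=> r; rewrite /= in_itv /= lt_min => rt /andP[rd re].
  pose x := Num.min r s; pose y := Num.max r s.
  have xy : x <= y by rewrite /x /y; case: (leP r s) => // /ltW.
  have inxy q : x <= q <= y -> [/\ 0 <= q <= t, `|q - s| < d & `|q - s| < e].
    move=> qxy; have qr := between_dist qxy; split; first exact: between_itv qxy.
      exact: le_lt_trans qr rd.
    exact: le_lt_trans qr re.
  have xin : x <= x <= y by rewrite lexx.
  have yin : x <= y <= y by rewrite lexx xy.
  have ax : a <= x by have [h1 _ h2] := inxy x xin; have /andP[] := near_ab x h1 h2.
  have yb : y <= b by have [h1 _ h2] := inxy y yin; have /andP[] := near_ab y h1 h2.
  pose f q := c q + - (q *: w s).
  have acf : abs_cont x y f.
    apply: abs_contD; first exact: abs_cont_subset eac.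
    have -> : (fun q => - (q *: w s)) = (fun q => q *: (- w s)).
      by apply/funext => q; rewrite scalerN.
    exact: abs_cont_linear.
  have fslope q : x <= q <= y -> ~ N q -> slope_bound x y f ee q.
    move=> qxy Nq; have [qt qd qe] := inxy q qxy.
    have iq : chart_dom i (lam q).1 by apply: ei => //; exact: ltW.
    have Hq : dwithin `[x, y] c q (w q).
      apply: dwithin_subset (flow_at_in (sZ q) iq (flow_ae q qt Nq)) => z.
      by rewrite /= !in_itv /= => /inxy[].
    have wl : dwithin `[x, y] (fun q => q *: w s) q (w s).
      move=> k k0; exists 1 => // z _ _.
      by rewrite -scalerBl subrr normr0 mulr_ge0// ltW.
    apply: dwithin_slope_bound (dwithinD Hq (dwithinN wl)) _.
    by apply: ltW; apply: Hd => //; rewrite /= in_itv.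
  have := ac_mean_value xy (ltW ee0) acf N0 fslope.
  rewrite /x /y max_sub_min (dist_min_max f).
  have -> // : f r - f s = c r - c s - (r - s) *: w s.
  by rewrite /f opprD addrACA scalerBl [X in _ = _ + X]opprD.
exact: (flow_in_at (sZ s) is_ (bc s st) goal).
Qed.

(** Solutions with continuous control are locally Lipschitz, hence absolutely continuous. *)
Lemma flow_abnormal_lift t lam : 0 < t -> t <= T ->
  (forall s, 0 <= s <= t -> flow_at `[0, t] lam s (Z s)) ->
  (forall s, 0 <= s <= t -> (lam s).1 = gamma s) ->
  (forall s, 0 <= s <= t ->
    [/\ (lam s).2 != 0, hfun X1 (lam s) = 0 & hfun X2 (lam s) = 0]) ->
  abnormal_lift X1 X2 t gamma lam.
Proof.
move=> t0 tT Hf Hbase Hh.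
have sub := itv0_subset tT.
have inT r : 0 <= r <= t -> 0 <= r <= T := itv0_le tT.
have lipc s : 0 <= s <= t -> exists i (e K : R), [/\ 0 < e,
    forall r, 0 <= r <= t -> `|r - s| <= e -> chart_dom i (lam r).1 &
    forall x y, Num.max 0 (s - e) <= x <= Num.min t (s + e) ->
      Num.max 0 (s - e) <= y <= Num.min t (s + e) ->
      `|ct_coord i (lam y) - ct_coord i (lam x)| <= K * `|y - x|].
  move=> st; set i := chart_at (lam s).1.
  have is_ : chart_dom i (lam s).1 := chart_at_dom _.
  have [bc Hs] := Hf s st; have [d d0 Hd] := bc _ (nbhs_chart_dom is_).
  have [k k0 Hk] := cwithin_bounded (ham_cwithin tT st bc is_ (dwithin_cwithin Hs)).
  pose K := `|ham_coord i (Z s) (ct_coord i (lam s))| + 1; pose e := Num.min d k / 2.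
  have m0 : 0 < Num.min d k by rewrite lt_min d0.
  have e0 : 0 < e by rewrite divr_gt0.
  have ed r : `|r - s| <= e -> `|r - s| < d /\ `|r - s| < k.
    move=> re; apply/andP; rewrite -lt_min (le_lt_trans re)// /e.
    by move: m0; lra.
  exists i, e, K; split => //.
    by move=> r rt /ed[rd _]; apply: Hd => //; rewrite /= in_itv.
  have dom r : Num.max 0 (s - e) <= r <= Num.min t (s + e) -> 0 <= r <= t /\ `|r - s| <= e.
    rewrite ge_max le_min => /andP[/andP[-> ?] /andP[-> ?]]; split => //.
    by rewrite ler_norml; apply/andP; lra.
  apply: (@dwithin_mean_value R _ _ _ (ct_coord i \o lam)
    (fun r => ham_coord i (Z r) (ct_coord i (lam r))) K) => //.
  - exact: addr_ge0.
  - move=> r /dom[rt /ed[rd _]].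
    have ir : chart_dom i (lam r).1 by apply: Hd => //; rewrite /= in_itv.
    apply: dwithin_subset (flow_at_in (sZ r) ir (Hf r rt)) => q.
    by rewrite /= !in_itv /= => /dom[].
  - by move=> r /dom[rt /ed[_ rk]]; apply: Hk => //; rewrite /= in_itv.
exists u1, u2; split.
  have L2 (u : R -> R) : (forall r, 0 <= r <= T -> cwithin `[0, T] u r) -> L2_on t u.
    move=> Hu; have Hu' r : 0 <= r <= t -> cwithin `[0, t] u r.
      by move=> rt; exact: cwithin_subset sub (Hu r (inT r rt)).
    split; first by apply: subspace_continuous_measurable_fun => //; exact/cwithin_within.
    apply: continuous_compact_integrable; first exact: segment_compact.
    by apply/cwithin_within => r rt; apply: cwithinM; exact: Hu'.
  split; [|exact: L2|exact: L2|].
    move=> s st; have [i [e [K [e0 Hdom HK]]]] := lipc s st; exists i, e; split => //.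
      by move=> r rt rs; rewrite -(Hbase r rt); exact: Hdom.
    have e00 : 0 <= e := ltW e0.
    have inn x : Num.max 0 (s - e) <= x <= Num.min t (s + e) -> 0 <= x <= t.
      by rewrite ge_max le_min => /andP[/andP[-> _] /andP[-> _]].
    apply: (@lipschitz_abs_cont R _ _ _ _ K) => x y xab yab.
    rewrite /= -(Hbase x (inn x xab)) -(Hbase y (inn y yab)).
    by apply: le_trans (HK x y xab yab); rewrite [leRHS]prod_normE le_max lexx.
  apply: aeW => s st; rewrite /velocity.
  apply/derivative_onE; have := flow_velocity (Hf s st); rewrite (Hbase s st) => Hv.
  apply: (dwithin_near ltr01 _ _ Hv) => [r rt _|] /=; last by rewrite Hbase.
  by split; [exact: rt|rewrite Hbase //; move: rt; rewrite /= in_itv].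
split => //.
  move=> s st; have [i [e [K [e0 Hdom HK]]]] := lipc s st; exists i, e; split => //.
  exact: (lipschitz_abs_cont HK).
by apply: aeW => s st; apply/ct_velocity_flow; have [] := Hf s st.
Qed.

End Abnormal.

(** * Regular abnormal curves *)

Section SignedRotation.
Variables (R : realType) (a b : R).
Let r := Num.sqrt (b ^+ 2 + a ^+ 2).

Lemma sqrt_sum2_gt0 : 0 < r <-> ~ (a = 0 /\ b = 0).
Proof.
rewrite /r sqrtr_gt0 lt_def addr_ge0 ?sqr_ge0// andbT paddr_eq0 ?sqr_ge0// !sqrf_eq0.
split=> [/negP H [a0 b0]|H]; first by apply: H; rewrite a0 b0 eqxx.
by apply/negP => /andP[/eqP b0 /eqP a0]; exact: H.
Qed.

Let sqr_r : b ^+ 2 + a ^+ 2 = r ^+ 2.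
Proof. by rewrite sqr_sqrtr// addr_ge0 ?sqr_ge0. Qed.

Lemma rotation_unit sigma : sigma ^+ 2 = 1 -> 0 < r ->
  (sigma * (- b / r)) ^+ 2 + (sigma * (a / r)) ^+ 2 = 1.
Proof.
move=> ss r0; rewrite !exprMn ss !mul1r sqrrN -mulrDl sqr_r exprVn mulfV//.
by rewrite expf_neq0// lt0r_neq0.
Qed.

Lemma rotation_orthogonal sigma : sigma * (- b / r) * a + sigma * (a / r) * b = 0.
Proof. by ring. Qed.

Lemma rotation_det sigma : sigma ^+ 2 = 1 -> 0 < r ->
  sigma * (sigma * (a / r) * a - sigma * (- b / r) * b) = r.
Proof.
move=> ss r0.
have -> : sigma * (sigma * (a / r) * a - sigma * (- b / r) * b) =
  sigma ^+ 2 * (b ^+ 2 + a ^+ 2) / r by ring.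
by rewrite sqr_r ss mul1r expr2 mulfK// lt0r_neq0.
Qed.

(** In the plane the unit vectors orthogonal to $(a, b)$ are the two quarter turns of $(a, b)/r$,
    and the determinant tells them apart. *)
Lemma rotation_of_sign sigma u v : sigma ^+ 2 = 1 -> u ^+ 2 + v ^+ 2 = 1 ->
  u * a + v * b = 0 -> 0 < sigma * (v * a - u * b) ->
  [/\ u = sigma * (- b / r), v = sigma * (a / r) & 0 < r].
Proof.
move=> ss uv orth w0; set w := v * a - u * b in w0.
have aE : a = w * v.
  rewrite -[LHS]mulr1 -uv.
  have -> : a * (u ^+ 2 + v ^+ 2) = u * (u * a + v * b) + w * v by rewrite /w; ring.
  by rewrite orth mulr0 add0r.
have bE : b = - (w * u).
  rewrite -[LHS]mulr1 -uv.
  have -> : b * (u ^+ 2 + v ^+ 2) = v * (u * a + v * b) - w * u by rewrite /w; ring.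
  by rewrite orth mulr0 add0r.
have rE : r = sigma * w.
  have E : b ^+ 2 + a ^+ 2 = (sigma * w) ^+ 2.
    by rewrite exprMn ss [in LHS]bE [in LHS]aE mul1r sqrrN !exprMn -mulrDr uv mulr1.
  by rewrite /r E sqrtr_sqr gtr0_norm.
have sw : sigma * w != 0 by rewrite lt0r_neq0.
have s0 : sigma != 0 by apply: contraNneq sw => ->; rewrite mul0r.
have w00 : w != 0 by apply: contraNneq sw => ->; rewrite mulr0.
split; last by rewrite rE.
- rewrite rE [in RHS]bE; move: (w) w00 => ww ww0; field; exact/andP.
- rewrite rE [in RHS]aE; move: (w) w00 => ww ww0; field; exact/andP.
Qed.

End SignedRotation.

Section RegularCurves.
Variables (R : realType) (n : nat) (M : smoothManifold R n) (X1 X2 : vector_field M).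
Hypotheses (s1 : smooth_vf_on setT X1) (s2 : smooth_vf_on setT X2).
Implicit Types (i j : chart_index M) (lam mu : R -> cotangent M) (r s t : R) (l : cotangent M).

Notation img i := (chart i @` chart_dom i).
Notation X12 := (lie_bracket X1 X2).
Notation X112 := (lie_bracket X1 X12).
Notation X212 := (lie_bracket X2 X12).

Let s12 : smooth_vf_on setT X12. Proof. exact: lie_bracket_smooth. Qed.
Let s112 : smooth_vf_on setT X112. Proof. exact: lie_bracket_smooth. Qed.
Let s212 : smooth_vf_on setT X212. Proof. exact: lie_bracket_smooth. Qed.

Lemma hfun_bracketxx (X : vector_field M) l : hfun (lie_bracket X X) l = 0.
Proof.
exact: (etrans (congr1 (dot l.2) (lie_bracketxx X l.1)) (dot0r _)).
Qed.

Lemma hfun_bracketC (X Y : vector_field M) l :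
  hfun (lie_bracket X Y) l = - hfun (lie_bracket Y X) l.
Proof.
exact: (etrans (congr1 (dot l.2) (lie_bracketC X Y l.1)) (dotNr _ _)).
Qed.

Section Evolution.
Variables (a b : R) (lam : R -> cotangent M) (u1 u2 : R -> R).
Hypothesis flow : forall t, a <= t <= b -> flow_at `[a, b] lam t (vf_lin (u1 t) (u2 t) X1 X2).

Let d1 t : a <= t <= b ->
  dwithin `[a, b] (fun s => hfun X1 (lam s)) t (- (u2 t * hfun X12 (lam t))).
Proof.
move=> tab; have H := flow_hfun_lin s1 s2 s1 (flow tab).
have E (x y z w v : R) : x = 0 -> y = - z -> w * x + v * y = - (v * z).
  by move=> -> ->; ring.
have EE := E _ _ _ (u1 t) (u2 t) (hfun_bracketxx X1 (lam t)) (hfun_bracketC X2 X1 (lam t)).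
exact: (eq_ind _ (dwithin _ _ t) H _ EE).
Qed.

Let d2 t : a <= t <= b ->
  dwithin `[a, b] (fun s => hfun X2 (lam s)) t (u1 t * hfun X12 (lam t)).
Proof.
move=> tab; have H := flow_hfun_lin s1 s2 s2 (flow tab).
have E (x y w v : R) : x = 0 -> w * y + v * x = w * y by move=> ->; ring.
have EE := E _ (hfun X12 (lam t)) (u1 t) (u2 t) (hfun_bracketxx X2 (lam t)).
exact: (eq_ind _ (dwithin _ _ t) H _ EE).
Qed.

Let d12 t : a <= t <= b -> dwithin `[a, b] (fun s => hfun X12 (lam s)) t
  (u1 t * h112 X1 X2 (lam t) + u2 t * h212 X1 X2 (lam t)).
Proof. by move=> tab; exact: flow_hfun_lin s1 s2 s12 (flow tab). Qed.

Let zero_derivative (f : R -> R) v t : a < b -> a <= t <= b ->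
  (forall s, a <= s <= b -> f s = 0) -> dwithin `[a, b] f t v -> v = 0.
Proof.
move=> ab tab f0 H; apply: (dwithin_unique ab tab H).
apply: (dwithin_near ltr01 _ _ (dwithin_cst `[a, b] (0 : R) t)) => [s|]; last by rewrite f0.
by rewrite /= in_itv /= => sab _; split => //; rewrite f0.
Qed.

(** Along a unit-speed abnormal lift, differentiating $h_1 = h_2 = 0$ gives $h_{12} = 0$, and
    differentiating again gives the equation which determines the control up to sign. *)
Lemma abnormal_brackets : a < b -> (forall t, a <= t <= b -> u1 t ^+ 2 + u2 t ^+ 2 = 1) ->
  (forall t, a <= t <= b -> hfun X1 (lam t) = 0 /\ hfun X2 (lam t) = 0) ->
  forall t, a <= t <= b -> hfun X12 (lam t) = 0 /\
    u1 t * h112 X1 X2 (lam t) + u2 t * h212 X1 X2 (lam t) = 0.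
Proof.
move=> ab unit h0.
have H12 t : a <= t <= b -> hfun X12 (lam t) = 0.
  move=> tab; have E1 := zero_derivative ab tab (fun s sab => (h0 s sab).1) (d1 tab).
  have E2 := zero_derivative ab tab (fun s sab => (h0 s sab).2) (d2 tab).
  have := unit t tab; move: E1 E2; set x := u1 t; set y := u2 t; set h := hfun X12 (lam t).
  move=> E1 E2 u; have -> : h = x * (x * h) - y * (- (y * h)) by rewrite -[LHS]mul1r -u; ring.
  by rewrite E1 E2; ring.
by move=> t tab; split; [exact: H12|exact: zero_derivative ab tab H12 (d12 tab)].
Qed.

Let constant (f f' : R -> R) : (forall t, a <= t <= b -> dwithin `[a, b] f t (f' t)) ->
  (forall t, a <= t <= b -> f' t = 0) -> forall t, a <= t <= b -> f t = f a.
Proof.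
move=> df f0 t tab; have ab : a <= a <= b by case/andP: tab => h1 h2; rewrite lexx (le_trans h1).
have := dwithin_mean_value (lexx 0) df _ ab tab; rewrite mul0r normr_le0 subr_eq0.
by move=> H; apply/eqP/H => s /f0 ->; rewrite normr0.
Qed.

(** The orthogonality hypothesis makes $h_{12}$ constant, hence zero, and then $h_1$ and $h_2$ are
    constant too. *)
Lemma Delta2_invariant :
  (forall t, a <= t <= b -> u1 t * h112 X1 X2 (lam t) + u2 t * h212 X1 X2 (lam t) = 0) ->
  Delta2_perp X1 X2 (lam a) -> forall t, a <= t <= b -> Delta2_perp X1 X2 (lam t).
Proof.
move=> H [ha1 ha2 ha12].
have H12 t : a <= t <= b -> hfun X12 (lam t) = 0.
  by move=> tab; exact: (etrans (constant d12 H tab) ha12).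
have H1 t : a <= t <= b -> hfun X1 (lam t) = 0.
  move=> tab; apply: (etrans (constant d1 _ tab) ha1) => s sab.
  by rewrite (H12 s sab) mulr0 oppr0.
have H2 t : a <= t <= b -> hfun X2 (lam t) = 0.
  move=> tab; apply: (etrans (constant d2 _ tab) ha2) => s sab.
  by rewrite (H12 s sab) mulr0.
by move=> t tab; split; [exact: H1|exact: H2|exact: H12].
Qed.

Lemma hfun_cwithin Y t : smooth_vf_on setT Y -> a <= t <= b ->
  cwithin `[a, b] (fun s => hfun Y (lam s)) t.
Proof. by move=> sY tab; exact: dwithin_cwithin (flow_hfun_lin s1 s2 sY (flow tab)). Qed.

End Evolution.

(** ** The field $\vec G$ *)

Definition G_rad l : R := Num.sqrt (h212 X1 X2 l ^+ 2 + h112 X1 X2 l ^+ 2).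
Definition G_u1 l : R := - h212 X1 X2 l / G_rad l.
Definition G_u2 l : R := h112 X1 X2 l / G_rad l.

(** [sigma] is [1] or [-1] in the applications, which treats $\vec G$ and $-\vec G$ together. *)
Definition G_flow (sigma : R) (D : set R) lam t : Prop :=
  flow_at D lam t (vf_lin (sigma * G_u1 (lam t)) (sigma * G_u2 (lam t)) X1 X2).

Lemma regular_rad l : regular_set X1 X2 l <-> Delta2_perp X1 X2 l /\ 0 < G_rad l.
Proof.
have radP := sqrt_sum2_gt0 (h112 X1 X2 l) (h212 X1 X2 l).
split=> [[H2 H3]|[H2 r0]].
  by split; [exact: H2|apply/radP => h; apply: H3; split; [exact: H2|exact: h]].
by split; [exact: H2|move=> [_ h]; exact: (iffLR radP r0 h)].
Qed.

Definition G_coord (sigma : R) i (z : 'rV[R]_n * 'rV[R]_n) : 'rV[R]_n * 'rV[R]_n :=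
  let a := dot z.2 (vf_coord X112 i z.1) in let b := dot z.2 (vf_coord X212 i z.1) in
  let q := (Num.sqrt (b ^+ 2 + a ^+ 2))^-1 in
  (sigma * (- b * q)) *: ham_coord i X1 z + (sigma * (a * q)) *: ham_coord i X2 z.

Lemma G_coordE sigma i l : chart_dom i l.1 ->
  ham_coord i (vf_lin (sigma * G_u1 l) (sigma * G_u2 l) X1 X2) (ct_coord i l) =
  G_coord sigma i (ct_coord i l).
Proof.
move=> il; have iz : img i (ct_coord i l).1 := img_chart il.
apply: (etrans (ham_coord_lin _ _ s1 s2 iz)).
have Ea : h112 X1 X2 l = dot (ct_coord i l).2 (vf_coord X112 i (ct_coord i l).1) :=
  hfun_coord X112 il.
have Eb : h212 X1 X2 l = dot (ct_coord i l).2 (vf_coord X212 i (ct_coord i l).1) :=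
  hfun_coord X212 il.
exact: (f_equal2 (fun a b : R =>
  (sigma * (- b * (Num.sqrt (b ^+ 2 + a ^+ 2))^-1)) *: ham_coord i X1 (ct_coord i l) +
  (sigma * (a * (Num.sqrt (b ^+ 2 + a ^+ 2))^-1)) *: ham_coord i X2 (ct_coord i l)) Ea Eb).
Qed.

Lemma dot_vf_loclip i Y z : smooth_vf_on setT Y -> img i z.1 ->
  loclip (fun z : 'rV[R]_n * 'rV[R]_n => dot z.2 (vf_coord Y i z.1)) z.
Proof.
move=> sY iz; apply: loclip_dot; first exact: loclip_snd.
have oI : open (img i) by exact: chart_img_open.
exact: loclip_comp (loclip_fst z) (Ck1_loclip oI iz (smooth_vf_img i sY 1%N)).
Qed.

Lemma G_coord_loclip sigma i l : chart_dom i l.1 -> 0 < G_rad l ->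
  loclip (G_coord sigma i) (ct_coord i l).
Proof.
move=> il r0.
have iz : img i (ct_coord i l).1 := img_chart il.
have La := dot_vf_loclip s112 iz; have Lb := dot_vf_loclip s212 iz.
have Lq : loclip (fun z : 'rV[R]_n * 'rV[R]_n => (Num.sqrt
   (dot z.2 (vf_coord X212 i z.1) ^+ 2 + dot z.2 (vf_coord X112 i z.1) ^+ 2))^-1) (ct_coord i l).
  apply: (loclip_comp (f := fun z : 'rV[R]_n * 'rV[R]_n =>
    dot z.2 (vf_coord X212 i z.1) ^+ 2 + dot z.2 (vf_coord X112 i z.1) ^+ 2)
    (g := fun q : R => (Num.sqrt q)^-1)).
    by apply: loclipD; [exact: (loclipM Lb Lb)|exact: (loclipM La La)].
  apply: loclip_inv_sqrt.
  have h : 0 < h212 X1 X2 l ^+ 2 + h112 X1 X2 l ^+ 2 by rewrite -sqrtr_gt0.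
  exact: (eq_ind _ (fun x => 0 < x) h _ (f_equal2 (fun a b : R => b ^+ 2 + a ^+ 2)
    (hfun_coord X112 il) (hfun_coord X212 il))).
apply: loclipD; apply: loclip_scale; try exact: ham_coord_loclip.
  by apply: loclipM; [exact: loclip_cst|exact: (loclipM (loclipN Lb) Lq)].
by apply: loclipM; [exact: loclip_cst|exact: (loclipM La Lq)].
Qed.

Lemma ct_of_coordK i l : chart_dom i l.1 ->
  ct_of_coord i (ct_coord i l).1 (ct_coord i l).2 = l.
Proof.
move=> il; apply: (@ct_coord_inj _ _ _ i _ _ _ il).
  by rewrite /= chartK.
apply: (etrans (ct_coord_of_coord _ (img_chart il))).
exact/esym/surjective_pairing.
Qed.

(** Picard's theorem in a chart, on a ball where the coordinate field is Lipschitz and the point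
    remains regular; membership in $\Delta_2^\perp$ then propagates from the initial point. *)
Lemma G_flow_exists sigma l0 tau : sigma ^+ 2 = 1 -> regular_set X1 X2 l0 ->
  exists (e : R) lam, [/\ 0 < e, lam tau = l0 &
    forall t, tau <= t <= tau + e ->
      G_flow sigma `[tau, tau + e] lam t /\ regular_set X1 X2 (lam t)].
Proof.
move=> ss reg0; have [D20 r0] := iffLR (regular_rad l0) reg0.
set i := chart_at l0.1; have i0 : chart_dom i l0.1 := chart_at_dom _.
set z0 := ct_coord i l0; have iz0 : img i z0.1 := img_chart i0.
pose rad2 (z : 'rV[R]_n * 'rV[R]_n) : R :=
  dot z.2 (vf_coord X212 i z.1) ^+ 2 + dot z.2 (vf_coord X112 i z.1) ^+ 2.
have rad2E l : chart_dom i l.1 -> G_rad l = Num.sqrt (rad2 (ct_coord i l)).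
  move=> il; exact: (congr1 Num.sqrt (f_equal2 (fun a b : R => b ^+ 2 + a ^+ 2)
    (hfun_coord X112 il) (hfun_coord X212 il))).
have rad20 : 0 < rad2 z0 by move: r0; rewrite (rad2E l0 i0) sqrtr_gt0.
have [k k0 Hk] : exists2 k : R, 0 < k & forall z, `|z - z0| < k -> 0 < rad2 z.
  have La := dot_vf_loclip s112 iz0; have Lb := dot_vf_loclip s212 iz0.
  have [K [d [K0 d0 Hd]]] : loclip rad2 z0.
    by apply: loclipD; [exact: (loclipM Lb Lb)|exact: (loclipM La La)].
  have K1 : 0 < K + 1 by rewrite ltr_wpDl.
  exists (Num.min d (rad2 z0 / (K + 1))); first by rewrite lt_min d0 divr_gt0.
  move=> z; rewrite lt_min => /andP[zd zk].
  have zz : `|z0 - z0| < d by rewrite subrr normr0.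
  have arith (x y w : R) : `|x - y| <= K * w -> w < y / (K + 1) -> 0 <= w -> 0 < x.
    by rewrite ltr_pdivlMr// ler_norml => /andP[h _] h1 h2; lra.
  exact: (arith _ _ _ (Hd z z0 zd zz) zk (normr_ge0 _)).
have [m m0 Hm] : exists2 m : R, 0 < m & forall z, `|z - z0| < m -> img i z.1.
  have /nbhs_ballP[m /= m0 Hm] : nbhs z0.1 (img i).
    by apply: open_nbhs_nbhs; split; [exact: chart_img_open|exact: iz0].
  exists m => // z zm; apply: Hm; rewrite -ball_normE /ball_ /= distrC.
  by apply: le_lt_trans zm; rewrite [leRHS]prod_normE le_max lexx.
have [K [d [K0 d0 Hd]]] := G_coord_loclip sigma i0 r0.
rewrite -/z0 in Hd.
pose rho := Num.min d (Num.min k m) / 2.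
have mm0 : 0 < Num.min d (Num.min k m) by rewrite !lt_min d0 k0.
have rho0 : 0 < rho by rewrite divr_gt0.
have inball z : `|z - z0| <= rho -> [/\ `|z - z0| < d, 0 < rad2 z & img i z.1].
  move=> zr; have : `|z - z0| < Num.min d (Num.min k m).
    by apply: le_lt_trans zr _; rewrite /rho; move: mm0; lra.
  rewrite !lt_min => /and3P[h1 h2 h3].
  by split; [exact: h1|exact: Hk|exact: Hm].
have zz : `|z0 - z0| <= rho by rewrite subrr normr0 ltW.
pose B := `|G_coord sigma i z0| + K * rho.
have B0 : 0 <= B by rewrite addr_ge0// mulr_ge0// ltW.
pose e := Num.min (rho / (B + 1)) (1 / (2 * (K + 1))).
have B1 : 0 < B + 1 by rewrite ltr_wpDl.
have K1 : 0 < 2 * (K + 1) by rewrite mulr_gt0// ltr_wpDl.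
have e0 : 0 < e by rewrite lt_min !divr_gt0.
have eB : e * (B + 1) <= rho by rewrite -ler_pdivlMr// ge_min lexx.
have eK : e * (2 * (K + 1)) <= 1 by rewrite -ler_pdivlMr// ge_min lexx orbT.
have [z [zt0 Hz]] : exists z : R -> 'rV[R]_n * 'rV[R]_n, z tau = z0 /\
    forall t, tau - e <= t <= tau + e -> `|z t - z0| <= rho /\
      dwithin `[tau - e, tau + e] z t (G_coord sigma i (z t)).
  apply: (@picard R _ (fun=> G_coord sigma i) tau z0 rho B K e).
  - apply: has_primitives_pair; exact: has_primitives_row.
  - apply: geom_complete_pair; exact: geom_complete_row.
  - exact: ltW.
  - exact: B0.
  - exact: K0.
  - exact: e0.
  - by move: eB e0; lra.
  - by move: eK e0; lra.
  - move=> _ z zr; have [zd _ _] := inball z zr; have [zd0 _ _] := inball z0 zz.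
    rewrite -[G_coord sigma i z](subrK (G_coord sigma i z0)) (le_trans (ler_normD _ _))//.
    by rewrite addrC lerD2l (le_trans (Hd z z0 zd zd0))// ler_wpM2l.
  - by move=> _ z z' /inball[zd _ _] /inball[zd' _ _]; exact: Hd.
  - by move=> z _ t; exact: cvg_cst.
have sub t : tau <= t <= tau + e -> tau - e <= t <= tau + e.
  by move=> /andP[h ->]; rewrite andbT (le_trans _ h)// gerBl ltW.
pose lam t := ct_of_coord i (z t).1 (z t).2.
have lamE t : tau <= t <= tau + e -> ct_coord i (lam t) = z t.
  move=> /sub/Hz[/inball[_ _ iz] _].
  exact: (etrans (ct_coord_of_coord _ iz) (esym (surjective_pairing _))).
have lami t : tau <= t <= tau + e -> chart_dom i (lam t).1.
  by move=> /sub/Hz[/inball[_ _ [p ip pE]] _]; rewrite /lam /= -pE chartK.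
have lamr t : tau <= t <= tau + e -> 0 < G_rad (lam t).
  move=> tt; rewrite (rad2E _ (lami t tt)) (lamE t tt) sqrtr_gt0.
  by have [/inball[_ h _] _] := Hz t (sub t tt).
have flow t : tau <= t <= tau + e -> G_flow sigma `[tau, tau + e] lam t.
  move=> tt; apply: flow_of_coord.
  - exact: vf_lin_smooth.
  - by rewrite /= in_itv.
  - by move=> q /=; rewrite in_itv /= => /sub/Hz[/inball[]].
  have E := G_coordE sigma (lami t tt); rewrite (lamE t tt) in E.
  rewrite E; have [_ H] := Hz t (sub t tt).
  by apply: dwithin_subset H => q /=; rewrite !in_itv /= => /sub.
have lam_tau : lam tau = l0.
  exact: (etrans (congr1 (fun w => ct_of_coord i w.1 w.2) zt0) (ct_of_coordK i0)).
have D2 : forall t, tau <= t <= tau + e -> Delta2_perp X1 X2 (lam t).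
  apply: (Delta2_invariant flow); last by rewrite lam_tau; exact: D20.
  by move=> t tt; exact: rotation_orthogonal.
exists e, lam; split; [exact: e0|exact: lam_tau|move=> t tt].
by split; [exact: flow|apply/regular_rad; split; [exact: D2|exact: lamr]].
Qed.

(** In a chart the difference of two solutions satisfies a linear differential inequality. *)
Lemma G_flow_unique sigma tau b lam mu : tau < b -> 0 < G_rad (lam tau) ->
  (forall t, tau <= t <= b -> G_flow sigma `[tau, b] lam t) ->
  (forall t, tau <= t <= b -> G_flow sigma `[tau, b] mu t) ->
  lam tau = mu tau ->
  exists2 e : R, 0 < e & forall t, tau <= t <= b -> t <= tau + e -> lam t = mu t.
Proof.
move=> tb r0 Hl Hm E0.
set i := chart_at (lam tau).1; have i0 : chart_dom i (lam tau).1 := chart_at_dom _.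
have [K [d [K0 d0 Hd]]] := G_coord_loclip sigma i0 r0.
have tt : tau <= tau <= b by rewrite lexx ltW.
have near_chart nu : nu tau = lam tau ->
    (forall t, tau <= t <= b -> G_flow sigma `[tau, b] nu t) ->
    exists2 e : R, 0 < e & forall t, tau <= t <= b -> `|t - tau| < e ->
      chart_dom i (nu t).1 /\ `|ct_coord i (nu t) - ct_coord i (lam tau)| < d.
  move=> nE Hn; have [bc _] := Hn tau tt.
  have in_ : chart_dom i (nu tau).1 by rewrite nE.
  have [e1 e10 He1] := bc _ (nbhs_chart_dom in_).
  have sV : smooth_vf_on setT (vf_lin (sigma * G_u1 (nu tau)) (sigma * G_u2 (nu tau)) X1 X2).
    exact: vf_lin_smooth.
  have [e2 e20 He2] := dwithin_cwithin (flow_at_in sV in_ (Hn tau tt)) d0.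
  exists (Num.min e1 e2); first by rewrite lt_min e10.
  move=> t tab; rewrite lt_min => /andP[h1 h2].
  have tD : `[tau, b]%classic t by rewrite /= in_itv.
  by split; [exact: He1|have := He2 t tD h2; rewrite /= nE].
have [e1 e10 He1] := near_chart lam erefl Hl.
have [e2 e20 He2] := near_chart mu (esym E0) Hm.
have K1 : 0 < 2 * (K + 1) by rewrite mulr_gt0// ltr_wpDl.
pose e := Num.min (Num.min e1 e2 / 2) (1 / (2 * (K + 1))).
have m0 : 0 < Num.min e1 e2 by rewrite lt_min e10.
have e0 : 0 < e by rewrite lt_min !divr_gt0.
have eK : e * (2 * (K + 1)) <= 1 by rewrite -ler_pdivlMr// ge_min lexx orbT.
exists e => //.
pose b' := Num.min b (tau + e).
have dom t : tau <= t <= b' -> [/\ tau <= t <= b,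
    chart_dom i (lam t).1 /\ `|ct_coord i (lam t) - ct_coord i (lam tau)| < d &
    chart_dom i (mu t).1 /\ `|ct_coord i (mu t) - ct_coord i (lam tau)| < d].
  rewrite /b' le_min => /and3P[h1 h2 h3].
  have tab : tau <= t <= b by rewrite h1.
  have tn : `|t - tau| < Num.min e1 e2.
    rewrite ger0_norm ?subr_ge0//.
    have : e <= Num.min e1 e2 / 2 by rewrite ge_min lexx.
    by move: m0 h3; lra.
  by move: tn; rewrite lt_min => /andP[k1 k2]; split; [exact: tab|exact: He1|exact: He2].
have tb' : tau <= b' by rewrite /b' le_min (ltW tb) lerDl ltW.
have sub : `[tau, b']%classic `<=` `[tau, b]%classic.
  by move=> t /=; rewrite !in_itv /= => /dom[].
have dG nu t : tau <= t <= b' -> chart_dom i (nu t).1 -> G_flow sigma `[tau, b] nu t ->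
    dwithin `[tau, b'] (ct_coord i \o nu) t (G_coord sigma i (ct_coord i (nu t))).
  move=> tab' it H; rewrite -(G_coordE sigma it).
  apply: (dwithin_subset sub).
  by apply: (flow_at_in _ it H); exact: vf_lin_smooth.
have H : forall t, tau <= t <= b' -> ct_coord i (lam t) + - ct_coord i (mu t) = 0.
  apply: (@dwithin_zero R _ tau b' tau (fun t => ct_coord i (lam t) + - ct_coord i (mu t))
    (fun t => G_coord sigma i (ct_coord i (lam t)) + - G_coord sigma i (ct_coord i (mu t)))
    K (d + d)) => //.
  - have h : b' - tau <= e by rewrite lerBlDl /b' ge_min lexx orbT.
    apply: (le_trans (ler_wpM2l K0 h)).
    by move: eK e0; lra.
  - by rewrite lexx.
  - by rewrite E0 subrr.
  - move=> t /dom[_ [_ h1] [_ h2]]; rewrite ltW//.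
    have -> : ct_coord i (lam t) - ct_coord i (mu t) =
      (ct_coord i (lam t) - ct_coord i (lam tau)) - (ct_coord i (mu t) - ct_coord i (lam tau)).
      by rewrite opprB addrA subrK.
    exact: (le_lt_trans (ler_normB _ _) (ltrD h1 h2)).
  - move=> t tb''; have [tab [l1 _] [l2 _]] := dom t tb''.
    apply: dwithinD; first exact: dG tb'' l1 (Hl t tab).
    by apply: dwithinN; exact: dG tb'' l2 (Hm t tab).
  - by move=> t /dom[_ [_ h1] [_ h2]]; exact: (Hd _ _ h1 h2).
move=> t tab te.
have tb'' : tau <= t <= b' by case/andP: tab => h1 h2; rewrite h1 /b' le_min h2.
have [_ [l1 _] [l2 _]] := dom t tb''.
apply: (ct_coord_inj l1 l2); apply/eqP; rewrite -subr_eq0; apply/eqP; exact: H.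
Qed.

End RegularCurves.

(** * Dimension of a set of covectors *)

Section DimSet.
Variables (R : realType) (n : nat).
Implicit Types A B : set 'rV[R]_n.

Let has_free A k := exists b : k.-tuple 'rV[R]_n, free b /\ (forall v, v \in b -> A v).

Let dim_set_ge A (k : 'I_n.+1) : has_free A k -> (k <= dim_set A)%N.
Proof.
move=> hk; apply: (@leq_bigmax_cond _ (fun k : 'I_n.+1 => `[< has_free A k >])
  (fun k : 'I_n.+1 => k : nat) k); exact/asboolP.
Qed.

Let dim_set_attained A : exists2 k : nat, has_free A k & dim_set A = k.
Proof.
rewrite /dim_set; apply: (big_ind (fun m => exists2 k : nat, has_free A k & m = k)).
- by exists 0%N => //; exists [tuple]; split => //; rewrite /= nil_free.
- move=> x y [k hk ->] [k' hk' ->]; case: (leqP k k') => h.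
    by exists k'.
  by exists k.
- by move=> k /asboolP hk; exists k.
Qed.

Lemma dim_set_le A B : A `<=` B -> (dim_set A <= dim_set B)%N.
Proof.
move=> AB; apply/bigmax_leqP => k /asboolP[b [fb bA]].
by apply: dim_set_ge; exists b; split => // v /bA/AB.
Qed.

(** A maximal free family of the subspace [A] spans inside [A], so it remains free with [v]. *)
Lemma dim_set_lt A B v : (forall a b u w, A u -> A w -> A (a *: u + b *: w)) -> A 0 ->
  A `<=` B -> B v -> ~ A v -> (dim_set A < dim_set B)%N.
Proof.
move=> linA A0 AB Bv nAv.
have [k hk kE] := dim_set_attained A.
rewrite kE; have [b [fb bA]] := hk.
have spanA w : w \in <<b>>%VS -> A w.
  move=> wb; rewrite (coord_span wb).
  apply: (big_ind A) => // [u u' Au Au'|j _].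
    by have := linA 1 1 _ _ Au Au'; rewrite !scale1r.
  have bj : b`_j \in b by rewrite mem_nth// size_tuple.
  by have := linA (coord b j w) 0 _ _ (bA _ bj) A0; rewrite scaler0 addr0.
have fvb : free (v :: b).
  by rewrite free_cons fb andbT; apply/negP => /spanA.
have kn : (k.+1 < n.+1)%N.
  have := dimvS (subvf <<v :: b>>%VS).
  move: fvb; rewrite /free => /eqP ->; rewrite /= size_tuple dimvf /dim /=.
  by rewrite mul1n.
apply: (@dim_set_ge B (Ordinal kn)); exists [tuple of v :: b]; split=> // w.
by rewrite inE => /orP[/eqP ->|/bA/AB].
Qed.

End DimSet.

(** * Regular abnormal geodesics as integral curves *)

Section Geodesics.
Variables (R : realType) (n : nat) (M : smoothManifold R n) (X1 X2 : vector_field M).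
Hypotheses (s1 : smooth_vf_on setT X1) (s2 : smooth_vf_on setT X2).
Implicit Types (lam mu : R -> cotangent M) (r s t T : R) (l : cotangent M).

Lemma base_cont_within T lam : {within `[0, T], continuous (fun t => (lam t).1 : M)} <->
  forall t, 0 <= t <= T -> base_cont `[0, T] lam t.
Proof.
split=> [/subspace_continuousP H t tT U HU|H].
  have /= := H t _ U HU; rewrite in_itv /= => /(_ tT)/nbhs_ballP[d /= d0 Hd].
  by exists d => // s Ds st; apply: Hd => //; rewrite /ball /= distrC.
apply/subspace_continuousP => t /=; rewrite in_itv /= => tT U HU.
have [d d0 Hd] := H t tT U HU; apply/nbhs_ballP; exists d => //= s.
by rewrite /ball /= distrC => st Ds; exact: Hd.
Qed.

Lemma Gvec_velocity sigma T lam t :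
  ct_velocity T lam t (sigma *: Gvec X1 X2 (lam t)) <->
  flow_in (chart_at (lam t).1) `[0, T] lam t
    (vf_lin (sigma * G_u1 X1 X2 (lam t)) (sigma * G_u2 X1 X2 (lam t)) X1 X2).
Proof.
have -> : sigma *: Gvec X1 X2 (lam t) =
    (sigma * G_u1 X1 X2 (lam t)) *: ham_vf (hfun X1) (lam t) +
    (sigma * G_u2 X1 X2 (lam t)) *: ham_vf (hfun X2) (lam t).
  by rewrite /Gvec scalerDr !scalerA.
exact: ct_velocity_flow.
Qed.

Lemma geodesic_G_flow T (gamma : R -> M) : regular_abnormal_geodesic X1 X2 T gamma ->
  exists (sigma : R) (p : R -> 'rV[R]_n), sigma ^+ 2 = 1 /\ forall t, 0 <= t <= T ->
    G_flow X1 X2 sigma `[0, T] (fun s => (gamma s, p s)) t /\ regular_set X1 X2 (gamma t, p t).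
Proof.
move=> [lam [Hint Hreg Hbase]].
have [sigma ss [/base_cont_within bc Hvel]] : exists2 sigma : R, sigma ^+ 2 = 1 &
    integral_curve (fun l => sigma *: Gvec X1 X2 l) T lam.
  case: Hint => [[bc H]|[bc H]].
    by exists 1; rewrite ?expr1n//; split => // t /H; rewrite scale1r.
  by exists (-1); rewrite ?sqrrN ?expr1n//; split => // t /H; rewrite scaleN1r.
exists sigma, (fun s => (lam s).2); split => // t tT.
have E s : 0 <= s <= T -> lam s = (gamma s, (lam s).2).
  by move=> sT; rewrite -(Hbase s sT) -surjective_pairing.
have reg := Hreg t tT.
have fl : G_flow X1 X2 sigma `[0, T] lam t.
  by split; [exact: bc|apply/Gvec_velocity; exact: Hvel].
rewrite /G_flow -(E t tT); split; last exact: reg.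
apply: (flow_at_near ltr01 _ (E t tT) fl) => s sD _; split; first exact: sD.
by apply: E; move: sD; rewrite /= in_itv.
Qed.

Lemma G_flow_geodesic sigma T lam : sigma ^+ 2 = 1 ->
  (forall t, 0 <= t <= T -> G_flow X1 X2 sigma `[0, T] lam t /\ regular_set X1 X2 (lam t)) ->
  regular_abnormal_geodesic X1 X2 T (fun t => (lam t).1).
Proof.
move=> ss H; exists lam.
have bc : {within `[0, T], continuous (fun t => (lam t).1 : M)}.
  by apply/base_cont_within => t tT; have [[]] := H t tT.
have vel t : 0 <= t <= T -> ct_velocity T lam t (sigma *: Gvec X1 X2 (lam t)).
  by move=> tT; apply/Gvec_velocity; have [[]] := H t tT.
split; [|by move=> t tT; have [] := H t tT|by []].
have : (sigma == 1) || (sigma == -1) by rewrite -sqrf_eq1 ss.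
by case/orP => /eqP E; [left|right]; split => // t tT; have := vel t tT;
  rewrite E ?scale1r ?scaleN1r.
Qed.

End Geodesics.

(** * Branching and the drop of dimension *)

Lemma frame_independent (R : realType) (n : nat) (M : smoothManifold R n)
  (S : subRiemannian2 M) (X1 X2 : vector_field M) : orthonormal_frame S X1 X2 ->
  forall p a b a' b', a *: X1 p + b *: X2 p = a' *: X1 p + b' *: X2 p -> a = a' /\ b = b'.
Proof.
move=> [[_ D1] [_ D2] on] p a b a' b' E.
have [/(_ p) gsym /(_ p) glin _ _] := sr_metric_smooth S.
have [e11 e22 e12] := on p.
have {}D1 := D1 p I; have {}D2 := D2 p I.
set g := sr_metric S p in gsym glin e11 e22 e12.
have g0 w : w \in sr_dist S p -> g 0 w = 0.
  move=> Dw; have := glin 1 0 0 w (mem0v _) (mem0v _) Dw.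
  by rewrite scale1r addr0 mul1r => h; apply: (addrI (g 0 w)); rewrite -h addr0.
have gE c d w : w \in sr_dist S p -> g (c *: X1 p + d *: X2 p) w = c * g (X1 p) w + d * g (X2 p) w.
  move=> Dw; rewrite glin//; last exact: memvZ.
  by rewrite -[d *: X2 p]addr0 glin ?mem0v// g0// addr0.
have e21 : g (X2 p) (X1 p) = 0 by rewrite gsym.
split.
  by have := congr1 (g ^~ (X1 p)) E; rewrite /= !gE// e11 e21 !mulr1 !mulr0 !addr0.
by have := congr1 (g ^~ (X2 p)) E; rewrite /= !gE// e22 e12 !mulr1 !mulr0 !add0r.
Qed.

Lemma sign_near (R : realType) (k x y : R) : k ^+ 2 = 1 -> `|y - x| < k * x -> 0 < k * y.
Proof.
move=> kk h; have k1 : `|k| = 1.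
  by apply/eqP; rewrite -(@pexpr_eq1 _ _ 2)// -normrX kk normr1.
have : - `|k * (y - x)| <= k * (y - x) by rewrite lerNl -normrN ler_norm.
by rewrite normrM k1 mul1r; lra.
Qed.

Section Branching.
Variables (R : realType) (n : nat) (M : smoothManifold R n) (X1 X2 : vector_field M).
Hypotheses (s1 : smooth_vf_on setT X1) (s2 : smooth_vf_on setT X2).
Hypothesis indep : forall p a b a' b',
  a *: X1 p + b *: X2 p = a' *: X1 p + b' *: X2 p -> a = a' /\ b = b'.
Variables (T : R) (T0 : 0 < T) (gamma : R -> M) (sigma : R) (p0 : R -> 'rV[R]_n).
Hypothesis ss : sigma ^+ 2 = 1.

Notation X12 := (lie_bracket X1 X2).
Notation X112 := (lie_bracket X1 X12).
Notation X212 := (lie_bracket X2 X12).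
Notation G_u1 := (@G_u1 R n M X1 X2).
Notation G_u2 := (@G_u2 R n M X1 X2).
Notation G_rad := (@G_rad R n M X1 X2).
Notation A t := (abnormal_space X1 X2 gamma t).

Hypothesis geo : forall t, 0 <= t <= T ->
  G_flow X1 X2 sigma `[0, T] (fun s => (gamma s, p0 s)) t /\ regular_set X1 X2 (gamma t, p0 t).

Let s12 : smooth_vf_on setT X12. Proof. exact: lie_bracket_smooth. Qed.
Let s112 : smooth_vf_on setT X112. Proof. exact: lie_bracket_smooth. Qed.
Let s212 : smooth_vf_on setT X212. Proof. exact: lie_bracket_smooth. Qed.

Let u1 s := sigma * G_u1 (gamma s, p0 s).
Let u2 s := sigma * G_u2 (gamma s, p0 s).
Let Z t := vf_lin (u1 t) (u2 t) X1 X2.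

Let flow0 t : 0 <= t <= T -> flow_at `[0, T] (fun s => (gamma s, p0 s)) t (Z t).
Proof. by move=> /geo[]. Qed.

Let rad0 t : 0 <= t <= T -> 0 < G_rad (gamma t, p0 t).
Proof. by move=> /geo[_ /regular_rad[]]. Qed.

Let u_unit t : 0 <= t <= T -> u1 t ^+ 2 + u2 t ^+ 2 = 1.
Proof. by move=> tT; exact: rotation_unit ss (rad0 tT). Qed.

Let inv_rad_cwithin t : 0 <= t <= T ->
  cwithin `[0, T] (fun s => (G_rad (gamma s, p0 s))^-1) t.
Proof.
move=> tT.
have ca := hfun_cwithin s1 s2 flow0 s112 tT; have cb := hfun_cwithin s1 s2 flow0 s212 tT.
apply: (cwithin_loclip (g := fun q : R => (Num.sqrt q)^-1)
  (cwithinD (cwithinM cb cb) (cwithinM ca ca))).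
by apply: loclip_inv_sqrt; rewrite -sqrtr_gt0; exact: rad0.
Qed.

Let Hu1 t : 0 <= t <= T -> cwithin `[0, T] u1 t.
Proof.
move=> tT; apply: cwithinM; first exact: cwithin_cst.
apply: cwithinM; last exact: inv_rad_cwithin.
by apply: cwithinN; exact: (hfun_cwithin s1 s2 flow0 s212 tT).
Qed.

Let Hu2 t : 0 <= t <= T -> cwithin `[0, T] u2 t.
Proof.
move=> tT; apply: cwithinM; first exact: cwithin_cst.
apply: cwithinM; last exact: inv_rad_cwithin.
exact: (hfun_cwithin s1 s2 flow0 s112 tT).
Qed.

Let lift t (p : R -> 'rV[R]_n) : Prop :=
  forall s, 0 <= s <= t -> flow_at `[0, t] (fun r => (gamma r, p r)) s (Z s).

Let lift_subset t t' p : t' <= t -> lift t p -> lift t' p.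
Proof.
move=> tt H s /andP[h1 h2]; apply: flow_at_subset (H s _); last by rewrite h1 (le_trans h2).
by move=> r /=; rewrite !in_itv /= => /andP[-> h]; exact: le_trans tt.
Qed.

Let lift_unique t p q : 0 <= t -> t <= T -> lift t p -> lift t q -> p 0 = q 0 ->
  forall s, 0 <= s <= t -> p s = q s.
Proof.
move=> t0 tT Hp Hq E; apply: (transport_unique s1 s2 Hu1 Hu2 flow0 tT Hp Hq _ E).
by rewrite lexx.
Qed.

(* A choice of the parallel transport of each covector along [gamma]. *)
Let P_ex : exists P : 'rV[R]_n -> R -> 'rV[R]_n, forall xi, P xi 0 = xi /\ lift T (P xi).
Proof.
suff /choice[P HP] : forall xi, exists p, p 0 = xi /\ lift T p by exists P.
move=> xi; have [p h1 h2] := transport_exists s1 s2 Hu1 Hu2 flow0 xi (ltW T0).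
by exists p.
Qed.

Let annihilates (p : R -> 'rV[R]_n) s : Prop :=
  hfun X1 (gamma s, p s) = 0 /\ hfun X2 (gamma s, p s) = 0.

Let hfun_lin Y s (p q : R -> 'rV[R]_n) (a b : R) :
  hfun Y (gamma s, a *: p s + b *: q s) = a * hfun Y (gamma s, p s) + b * hfun Y (gamma s, q s).
Proof. by apply: (etrans (dotDl _ _ _)); rewrite !dotZl. Qed.

Let P := sval (cid P_ex).
Let P_init xi : P xi 0 = xi. Proof. exact: (svalP (cid P_ex) xi).1. Qed.
Let P_lift xi : lift T (P xi). Proof. exact: (svalP (cid P_ex) xi).2. Qed.

Let P_lin a b xi eta s : 0 <= s <= T -> P (a *: xi + b *: eta) s = a *: P xi s + b *: P eta s.
Proof.
move=> sT; apply: (@lift_unique T _ (fun s => a *: P xi s + b *: P eta s)) sT => //.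
- exact: ltW.
- by move=> r rT; apply: flow_at_lin; [exact: P_lift|exact: P_lift].
- by rewrite !P_init.
Qed.

(* Transport turns [A t] into the linear conditions on [xi] that $h_1$ and $h_2$ vanish along the
   transported covector on [[0, t]]. *)
Let A_E t xi : 0 < t -> t <= T -> A t xi <-> forall s, 0 <= s <= t -> annihilates (P xi) s.
Proof.
move=> t0 tT; have liftP := lift_subset tT (P_lift xi).
have inT s : 0 <= s <= t -> 0 <= s <= T := itv0_le tT.
split=> [[xi0|[lam Hlam lam0]] s st|H].
- have -> : xi = 0 *: xi + 0 *: xi by rewrite xi0 !scale0r addr0.
  by rewrite /annihilates P_lin ?inT// !hfun_lin !mul0r addr0.
- have Hf := abnormal_lift_flow s1 s2 indep Hu1 Hu2 flow0 t0 tT Hlam.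
  have [v1 [v2 [_ [_ base Hh _]]]] := Hlam.
  have E r : 0 <= r <= t -> lam r = (gamma r, (lam r).2).
    by move=> rt; rewrite -(base r rt) -surjective_pairing.
  have liftL : lift t (fun r => (lam r).2).
    move=> r rt; apply: (flow_at_near ltr01 _ (E r rt) (Hf r rt)) => q qD _.
    by split; [exact: qD|apply: E; move: qD; rewrite /= in_itv].
  have lam02 : (lam 0).2 = P xi 0 by rewrite lam0 P_init.
  have := lift_unique (ltW t0) tT liftL liftP lam02 st => Es.
  by have [_ h1 h2] := Hh s st; split; rewrite -Es -(E s st).
have [xi0|xi0] := eqVneq xi 0; [by left|right].
exists (fun s => (gamma s, P xi s)); last by rewrite P_init.
apply: (flow_abnormal_lift (lam := fun s => (gamma s, P xi s)) s1 s2 Hu1 Hu2 t0 tT liftP).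
  by [].
move=> s st.
have [h1 h2] := H s st; split; [|exact: h1|exact: h2].
apply: contra_neq xi0 => /= Ps0; rewrite -(P_init xi).
by apply: (transport_zero s1 s2 Hu1 Hu2 flow0 tT liftP st Ps0); rewrite lexx ltW.
Qed.

Let A_lin t : 0 < t -> t <= T -> forall a b v w, A t v -> A t w -> A t (a *: v + b *: w).
Proof.
move=> t0 tT a b v w /(A_E _ t0 tT) Hv /(A_E _ t0 tT) Hw; apply/(A_E _ t0 tT) => s st.
have sT : 0 <= s <= T := itv0_le tT st.
have [v1 v2] := Hv s st; have [w1 w2] := Hw s st.
by rewrite /annihilates P_lin// !hfun_lin v1 v2 w1 w2 !mulr0 addr0.
Qed.

Let A_mono t t' : 0 < t -> t <= t' -> t' <= T -> A t' `<=` A t.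
Proof.
move=> t0 tt tT xi /(A_E _ (lt_le_trans t0 tt) tT) H; apply/(A_E _ t0 (le_trans tt tT)) => s.
by move=> /andP[h1 h2]; apply: H; rewrite h1 (le_trans h2).
Qed.

Let A_eq t t' : 0 < t -> t <= t' -> t' <= T -> dim_set (A t) = dim_set (A t') -> A t = A t'.
Proof.
move=> t0 tt tT E; apply/seteqP; split; last exact: A_mono.
move=> xi Axi; apply: contrapT => nA.
have t'0 := lt_le_trans t0 tt.
have := dim_set_lt (A_lin t'0 tT) (or_introl erefl) (A_mono t0 tt tT) Axi nA.
by rewrite E ltnn.
Qed.

Let hfun_lift_cwithin Y t p s : smooth_vf_on setT Y -> lift t p -> 0 <= s <= t ->
  cwithin `[0, t] (fun r => hfun Y (gamma r, p r)) s.
Proof. by move=> sY Hp st; exact: (hfun_cwithin s1 s2 Hp sY st). Qed.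

(* The spaces [A t] decrease and have finite dimension, so that they are constant just before
    [tau]; the conditions defining them being closed, that constant value is [A tau]. *)
Let A_left tau : 0 < tau -> tau <= T ->
  exists t0, [/\ 0 < t0, t0 < tau & forall t, t0 <= t <= tau -> A t = A tau].
Proof.
move=> tau0 tauT.
pose Q m := `[< exists t, [/\ 0 < t, t < tau & dim_set (A t) = m] >].
have exQ : exists m, Q m.
  exists (dim_set (A (tau / 2))); apply/asboolP; exists (tau / 2); split => //; lra.
case: (ex_minnP exQ) => m /asboolP[t0 [t00 t0tau dm]] minm.
have Aconst t : t0 <= t -> t < tau -> A t = A t0.
  move=> tt ttau; have tT := le_trans (ltW ttau) tauT.
  apply/esym/A_eq => //; apply/eqP; rewrite eqn_leq (dim_set_le (A_mono t00 tt tT)) andbT.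
  rewrite dm; apply: minm; apply/asboolP; exists t; split => //; exact: lt_le_trans tt.
have Atau : A tau = A t0.
  apply/seteqP; split; first by apply: A_mono => //; exact: ltW.
  move=> xi Axi; apply/(A_E _ tau0 tauT).
  have before s : 0 <= s -> s < tau -> annihilates (P xi) s.
    move=> s0 stau; pose t := Num.max s t0.
    have tt : t0 <= t by rewrite le_max lexx orbT.
    have st : s <= t by rewrite le_max lexx.
    have ttau : t < tau by rewrite gt_max stau.
    have : A t xi by rewrite (Aconst t tt ttau).
    move=> /(A_E _ (lt_le_trans t00 tt) (le_trans (ltW ttau) tauT)); apply.
    by rewrite s0.
  have liftP := lift_subset tauT (P_lift xi).
  have tautau : 0 <= tau <= tau by rewrite lexx ltW.
  have limit Y : smooth_vf_on setT Y ->
      (forall s, 0 <= s -> s < tau -> hfun Y (gamma s, P xi s) = 0) ->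
      hfun Y (gamma tau, P xi tau) = 0.
    move=> sY HY; apply/eqP; rewrite -normr_le0; apply/ler_addgt0Pr => e e0; rewrite add0r.
    have [d d0 Hd] := hfun_lift_cwithin sY liftP tautau e0.
    pose s := Num.max 0 (tau - d / 2).
    have s0 : 0 <= s by rewrite le_max lexx.
    have stau : s < tau by rewrite gt_max tau0 /= ltrBlDr ltrDl divr_gt0.
    have sd : `|s - tau| < d.
      have : tau - d / 2 <= s by rewrite le_max lexx orbT.
      by rewrite ltr_norml => h; apply/andP; split; lra.
    have sD : `[0, tau]%classic s by rewrite /= in_itv /= s0 ltW.
    have := Hd s sD sd; rewrite (HY s s0 stau) sub0r normrN; exact: ltW.
  move=> s /andP[s0]; rewrite le_eqVlt => /orP[/eqP ->|stau]; last exact: before.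
  by split; [apply: (limit X1 s1)|apply: (limit X2 s2)] => r r0 rt; have [] := before r r0 rt.
exists t0; split => // t /andP[tt]; rewrite le_eqVlt => /orP[/eqP -> //|ttau].
by rewrite Aconst.
Qed.

(* After [tau] the dimension takes its largest value on a whole interval starting at [tau]. *)
Let A_right tau : 0 < tau -> tau < T ->
  exists t1, [/\ tau < t1, t1 <= T & forall t, tau < t <= t1 -> A t = A t1].
Proof.
move=> tau0 tauT.
pose Q m := `[< exists t, [/\ tau < t, t <= T & dim_set (A t) = m] >].
have exQ : exists m, Q m.
  by exists (dim_set (A T)); apply/asboolP; exists T.
have bQ m : Q m -> (m <= dim_set (A tau))%N.
  by move=> /asboolP[t [h1 h2 <-]]; apply/dim_set_le/A_mono => //; exact: ltW.
case: (ex_maxnP exQ bQ) => m /asboolP[t1 [h1 h2 dm]] maxm.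
exists t1; split => // t /andP[taut tt1].
have t0 := lt_trans tau0 taut.
apply: A_eq => //; apply/eqP; rewrite eqn_leq (dim_set_le (A_mono t0 tt1 h2)) andbT dm.
by apply: maxm; apply/asboolP; exists t; split => //; exact: le_trans h2.
Qed.

Let D t := dim_set (A t).

(** The dimension is monotone and continuous from the left, so that only a drop immediately after
    [tau] can make it discontinuous. *)
Lemma dim_continuousP tau : 0 < tau < T ->
  (D t @[t --> within `]0, T] (nbhs tau)] --> D tau) <->
  exists2 t, tau < t <= T & A t = A tau.
Proof.
move=> /andP[tau0 tauT]; split.
  move=> /discrete_cvg; rewrite /nbhs /=.
  case/nbhs_ballP => d /= d0 Hd.
  pose t := Num.min T (tau + d / 2).
  have taut : tau < t by rewrite lt_min tauT ltrDl divr_gt0.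
  have tT : t <= T by rewrite ge_min lexx.
  exists t; first by rewrite taut.
  apply/esym/A_eq => //; first exact: ltW.
  apply/esym; apply: Hd; last by rewrite /= in_itv /= tT (lt_trans tau0).
  have : t <= tau + d / 2 by rewrite ge_min lexx orbT.
  by move=> h; rewrite /ball /= ltr_norml; apply/andP; split; lra.
move=> [t1 /andP[taut1 t1T] E1].
have [t0 [t00 t0tau H0]] := A_left tau0 (ltW tauT).
apply/discrete_cvg; apply/nbhs_ballP.
exists (Num.min (tau - t0) (t1 - tau)); first by rewrite /= lt_min !subr_gt0 t0tau.
move=> t; rewrite /ball /= lt_min => /andP[ht0 ht1]; rewrite in_itv /= => /andP[tpos tT].
suff -> : D t = D tau by [].
rewrite /D; congr (dim_set _).
move: ht0 ht1; rewrite !ltr_norml => /andP[a1 a2] /andP[b1 b2].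
case: (leP t tau) => ht.
  by apply: H0; apply/andP; split; lra.
apply/seteqP; split; first by apply: A_mono => //; exact: ltW.
by rewrite -E1; apply: A_mono => //; lra.
Qed.

(* Along an abnormal lift $(h_{112}, h_{212})$ is [det p s] times the control
   turned by a right angle; its sign tells $\vec G$ from $-\vec G$. *)
Let det p s := u2 s * h112 X1 X2 (gamma s, p s) - u1 s * h212 X1 X2 (gamma s, p s).

Let det_cwithin t p s : t <= T -> lift t p -> 0 <= s <= t -> cwithin `[0, t] (det p) s.
Proof.
move=> tT Hp st.
have sT : 0 <= s <= T := itv0_le tT st.
have sub := itv0_subset tT.
apply: cwithinD; last apply: cwithinN; apply: cwithinM.
- exact: cwithin_subset sub (Hu2 sT).
- exact: hfun_lift_cwithin s112 Hp st.
- exact: cwithin_subset sub (Hu1 sT).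
- exact: hfun_lift_cwithin s212 Hp st.
Qed.

Let det_lin p q a b s : det (fun s => a *: p s + b *: q s) s = a * det p s + b * det q s.
Proof.
have arith (x y x' y' v w : R) :
  v * (a * x + b * x') - w * (a * y + b * y') = a * (v * x - w * y) + b * (v * x' - w * y').
  by ring.
apply: (etrans _ (arith _ _ _ _ _ _)).
exact: (f_equal2 (fun x y => u2 s * x - u1 s * y) (hfun_lin X112 s p q a b)
  (hfun_lin X212 s p q a b)).
Qed.

Let lift_control t p (v1 v2 : R -> R) : 0 < t -> t <= T ->
  (forall s, 0 <= s <= t ->
    flow_at `[0, t] (fun r => (gamma r, p r)) s (vf_lin (v1 s) (v2 s) X1 X2)) ->
  forall s, 0 <= s <= t -> v1 s = u1 s /\ v2 s = u2 s.
Proof.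
move=> t0 tT H s st.
have st0 : lift t p0 by exact: lift_subset tT flow0.
exact: (control_unique (lam := fun r => (gamma r, p r)) (lam' := fun r => (gamma r, p0 r))
  indep t0 st (fun _ _ => erefl) (H s st) (st0 s st)).
Qed.

Let annihilator_sign t p s k : 0 < t -> t <= T -> lift t p ->
  (forall r, 0 <= r <= t -> annihilates p r) -> 0 <= s <= t -> k ^+ 2 = 1 -> 0 < k * det p s ->
  [/\ u1 s = k * G_u1 (gamma s, p s), u2 s = k * G_u2 (gamma s, p s) &
     regular_set X1 X2 (gamma s, p s)].
Proof.
move=> t0 tT Hp Hann st kk kdet.
have inT r : 0 <= r <= t -> 0 <= r <= T := itv0_le tT.
have [e12 orth] := abnormal_brackets s1 s2 Hp t0 (fun r rt => u_unit (inT r rt)) Hann st.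
have [h1 h2 r0] := rotation_of_sign kk (u_unit (inT s st)) orth kdet.
have [a1 a2] := Hann s st.
by split; [exact: h1|exact: h2|apply/regular_rad; split].
Qed.

Let geo_annihilates s : 0 <= s <= T -> annihilates p0 s.
Proof. by move=> /geo[_ [[h1 h2 _] _]]. Qed.

(** If [A] drops at [tau], a covector [xi] lost there is added, with a small coefficient, to the
    lift of [gamma]: the sum is again regular and lifts [gamma] up to [tau], but its
    continuation by the field cannot follow [gamma] any longer. *)
Lemma branching_of_drop tau : 0 < tau < T ->
  (forall t, tau < t <= T -> A t <> A tau) -> regular_abnormal_branching X1 X2 T gamma tau.
Proof.
move=> /andP[tau0 tauT] drop.
have [xi [Axi nAxi]] : exists xi, A tau xi /\ forall t, tau < t <= T -> ~ A t xi.
  have [t1 [h1 h2 H1]] := A_right tau0 tauT.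
  have t1T : tau < t1 <= T by rewrite h1.
  have [xi [Axi nA]] : exists xi, A tau xi /\ ~ A t1 xi.
    apply: contrapT => no; apply: (drop t1 t1T); apply/seteqP; split.
      by apply: A_mono => //; exact: ltW.
    by move=> xi Axi; apply: contrapT => nA; apply: no; exists xi.
  exists xi; split => // t /andP[taut tT].
  case: (leP t t1) => tt; first by rewrite H1// taut.
  by move=> /(A_mono (lt_trans tau0 h1) (ltW tt) tT).
have tauT' := ltW tauT.
have xi_ann := iffLR (A_E xi tau0 tauT') Axi.
have lift0 := lift_subset tauT' flow0.
have lift_xi := lift_subset tauT' (P_lift xi).
have inT s : 0 <= s <= tau -> 0 <= s <= T := itv0_le tauT'.
have det0 s : 0 <= s <= T -> sigma * det p0 s = G_rad (gamma s, p0 s).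
  by move=> sT; exact: rotation_det ss (rad0 sT).
(* by compactness, a small multiple of [P xi] does not change the sign of the determinant *)
have [m m0 Hm] : exists2 m : R, 0 < m & forall s, 0 <= s <= tau -> m <= sigma * det p0 s.
  have [|c cD Hc] := @EVT_min R (fun s => sigma * det p0 s) 0 tau (ltW tau0).
    apply/cwithin_within => s st; apply: cwithinM; first exact: cwithin_cst.
    exact: det_cwithin lift0 st.
  rewrite in_itv /= in cD; exists (sigma * det p0 c).
    by rewrite det0 ?inT//; exact: rad0 (inT c cD).
  by move=> s st; apply: Hc; rewrite in_itv.
have [B HB] : exists B : R, forall s, 0 <= s <= tau -> - (sigma * det (P xi) s) <= B.
  have [|c cD Hc] := @EVT_max R (fun s => - (sigma * det (P xi) s)) 0 tau (ltW tau0).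
    apply/cwithin_within => s st; apply: cwithinN; apply: cwithinM; first exact: cwithin_cst.
    exact: det_cwithin lift_xi st.
  by exists (- (sigma * det (P xi) c)) => s st; apply: Hc; rewrite in_itv.
have B1 : 0 < `|B| + 1 by rewrite ltr_wpDl.
pose e := m / (2 * (`|B| + 1)).
have e0 : 0 < e by rewrite divr_gt0// mulr_gt0.
pose q s := 1 *: p0 s + e *: P xi s.
have lift_q : lift T q.
  by move=> s sT; apply: flow_at_lin; [exact: flow0|exact: P_lift].
have q_ann s : 0 <= s <= tau -> annihilates q s.
  move=> st; have [h1 h2] := geo_annihilates (inT s st); have [k1 k2] := xi_ann s st.
  by rewrite /annihilates /q !hfun_lin h1 h2 k1 k2 !mulr0 addr0.
have det_q s : 0 <= s <= tau -> 0 < sigma * det q s.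
  move=> st; rewrite /q det_lin mul1r mulrDr mulrCA.
  have hB := HB s st; have hm := Hm s st; have hB' := ler_norm B.
  have eB : e * (2 * (`|B| + 1)) = m by rewrite /e divfK// lt0r_neq0// mulr_gt0.
  have : e * - (sigma * det (P xi) s) <= e * `|B|.
    by rewrite ler_wpM2l ?(ltW e0)// (le_trans hB).
  by move: eB hm m0 e0; move: (sigma * det p0 s) (sigma * det (P xi) s) `|B| => x y w; lra.
have q_reg s (st : 0 <= s <= tau) :=
  annihilator_sign tau0 tauT' (lift_subset tauT' lift_q) q_ann st ss (det_q s st).
have tautau : 0 <= tau <= tau by rewrite lexx ltW.
have [_ _ reg_tau] := q_reg tau tautau.
have [e1 [lam2 [e10 lam2_tau Hlam2]]] := G_flow_exists s1 s2 tau ss reg_tau.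
pose eps0 := Num.min e1 (T - tau).
have eps00 : 0 < eps0 by rewrite lt_min e10 subr_gt0.
have eps0e : eps0 <= e1 by rewrite ge_min lexx.
have eps0T : tau + eps0 <= T.
  by rewrite -lerBrDl ge_min lexx orbT.
pose lam1 s : cotangent M := (gamma s, q s).
pose lam s := if s <= tau then lam1 s else lam2 s.
have lamL s : s <= tau -> lam s = lam1 s by rewrite /lam => ->.
have lamR s : tau <= s -> lam s = lam2 s.
  rewrite le_eqVlt => /orP[/eqP <-|]; first by rewrite lamL.
  by rewrite /lam ltNge => /negbTE ->.
pose V t := vf_lin (sigma * G_u1 (lam t)) (sigma * G_u2 (lam t)) X1 X2.
have flowL t : 0 <= t <= tau -> flow_at `[0, tau] lam1 t (V t).
  move=> tt; have [h1 h2 _] := q_reg t tt; rewrite /V lamL; last by case/andP: tt.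
  have -> : vf_lin (sigma * G_u1 (lam1 t)) (sigma * G_u2 (lam1 t)) X1 X2 = Z t.
    exact: (f_equal2 (fun a b => vf_lin a b X1 X2) (esym h1) (esym h2)).
  exact: (lift_subset tauT' lift_q tt).
have flowR t : tau <= t <= tau + eps0 -> flow_at `[tau, tau + eps0] lam2 t (V t).
  move=> /andP[tt te]; rewrite /V lamR//.
  have te1 : tau <= t <= tau + e1 by rewrite tt (le_trans te)// lerD2l.
  have [H _] := Hlam2 t te1; apply: flow_at_subset H => r /=.
  by rewrite !in_itv /= => /andP[-> h]; rewrite (le_trans h)// lerD2l.
have mid : 0 <= tau <= tau + eps0 by rewrite (ltW tau0) lerDl ltW.
have flow3 := flow_glue mid (esym lam2_tau) flowL flowR.
have geo3 t : 0 <= t <= tau + eps0 ->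
    G_flow X1 X2 sigma `[0, tau + eps0] lam t /\ regular_set X1 X2 (lam t).
  move=> tt; split; first exact: flow3.
  case/andP: tt => t00 te; case: (leP t tau) => h.
    have tt : 0 <= t <= tau by rewrite t00.
    by have [_ _ H] := q_reg t tt; rewrite (lamL t h); exact: H.
  have te1 : tau <= t <= tau + e1 by rewrite (ltW h) (le_trans te)// lerD2l.
  by have [_ H] := Hlam2 t te1; rewrite (lamR t (ltW h)); exact: H.
exists eps0, (fun t => (lam t).1); split.
- by split.
- exact: (G_flow_geodesic s1 s2 ss geo3).
- by move=> t /andP[_ tt]; rewrite lamL.
move=> eps /andP[eps_gt0 epse] Heq.
pose t' := tau + eps.
have t'e : t' <= tau + eps0 by rewrite lerD2l.
have t'T : t' <= T := le_trans t'e eps0T.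
have t'0 : 0 < t' by rewrite addr_gt0.
have tt' : tau < t' by rewrite ltrDl.
have lamE s : 0 <= s <= t' -> lam s = (gamma s, (lam s).2).
  by move=> st; rewrite -(Heq s st) -surjective_pairing.
have flow' s : 0 <= s <= t' -> flow_at `[0, t'] (fun r => (gamma r, (lam r).2)) s (V s).
  move=> st; have st' : 0 <= s <= tau + eps0 := itv0_le t'e st.
  have sub := itv0_subset t'e.
  apply: (flow_at_near ltr01 _ (lamE s st) (flow_at_subset sub (flow3 s st'))) => r rD _.
  by split; [exact: rD|apply: lamE; move: rD; rewrite /= in_itv].
have lift3 : lift t' (fun r => (lam r).2).
  move=> s st; have [h1 h2] := lift_control t'0 t'T flow' st.
  have <- : V s = Z s by exact: (f_equal2 (fun a b => vf_lin a b X1 X2) h1 h2).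
  exact: flow'.
have lam_q : (lam 0).2 = q 0 by rewrite lamL// ltW.
apply: (nAxi t'); first by rewrite tt'.
apply/(A_E _ t'0 t'T) => s st.
have sT : 0 <= s <= T := itv0_le t'T st.
have qs := lift_unique (ltW t'0) t'T lift3 (lift_subset t'T lift_q) lam_q st.
have st' : 0 <= s <= tau + eps0 := itv0_le t'e st.
have [_ [[h1 h2 _] _]] := geo3 s st'.
rewrite (lamE s st) qs in h1 h2; have [k1 k2] := geo_annihilates sT.
have cancel (x y : R) : x = 0 -> 1 * x + e * y = 0 -> y = 0.
  by move=> ->; rewrite mulr0 add0r => /eqP; rewrite mulf_eq0 (gt_eqF e0) => /eqP.
split; [apply: (cancel _ _ k1)|apply: (cancel _ _ k2)]; by rewrite -hfun_lin.
Qed.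

(** Conversely the lift of a branch starts in [A tau], and cannot start in a later [A t]: the
    transport along [gamma] of its initial covector would be an integral curve of the same
    field, so that the branch would follow [gamma] after [tau]. *)
Lemma drop_of_branching tau : 0 < tau < T -> regular_abnormal_branching X1 X2 T gamma tau ->
  forall t, tau < t <= T -> A t <> A tau.
Proof.
move=> /andP[tau0 tauT] [eps0 [gamma' [[eps00 eps0T] geo' Heq Hneq]]] t /andP[taut tT] EA.
have tauT' := ltW tauT.
have [k [p' [kk Hp']]] := geodesic_G_flow s1 s2 geo'.
have taue : tau <= tau + eps0 by rewrite lerDl ltW.
have in_e s : 0 <= s <= tau -> 0 <= s <= tau + eps0.
  by move=> /andP[-> h]; exact: le_trans taue.
pose v1 s := k * G_u1 (gamma' s, p' s); pose v2 s := k * G_u2 (gamma' s, p' s).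
have E s : 0 <= s <= tau -> (gamma' s, p' s) = (gamma s, p' s) by move=> /Heq ->.
have flow' s : 0 <= s <= tau ->
    flow_at `[0, tau] (fun r => (gamma r, p' r)) s (vf_lin (v1 s) (v2 s) X1 X2).
  move=> st; have [H _] := Hp' s (in_e s st).
  have sub : `[0, tau]%classic `<=` `[0, tau + eps0]%classic.
    by move=> r /=; rewrite !in_itv /= => /in_e.
  apply: (flow_at_near ltr01 _ (E s st) (flow_at_subset sub H)) => r rD _.
  by split; [exact: rD|apply: E; move: rD; rewrite /= in_itv].
have ctrl := lift_control tau0 tauT' flow'.
have lift' : lift tau p'.
  move=> s st; have [h1 h2] := ctrl s st.
  have E2 : vf_lin (v1 s) (v2 s) X1 X2 = Z s.
    exact: (f_equal2 (fun a b => vf_lin a b X1 X2) h1 h2).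
  by rewrite -E2; exact: flow'.
pose xi := p' 0.
have Pp' s : 0 <= s <= tau -> P xi s = p' s.
  apply: (lift_unique (ltW tau0) tauT' (lift_subset tauT' (P_lift xi)) lift').
  by rewrite P_init.
have Axi : A tau xi.
  apply/(A_E _ tau0 tauT') => s st; rewrite /annihilates (Pp' s st) -(E s st).
  by have [_ [[h1 h2 _] _]] := Hp' s (in_e s st).
pose t' := Num.min t (tau + eps0).
have tt' : tau < t' by rewrite lt_min taut ltrDl.
have t't : t' <= t by rewrite ge_min lexx.
have t'e : t' <= tau + eps0 by rewrite ge_min lexx orbT.
have t'T := le_trans t't tT.
have t'0 := lt_trans tau0 tt'.
have ann : forall s, 0 <= s <= t' -> annihilates (P xi) s.
  by apply/(A_E _ t'0 t'T)/(A_mono t'0 t't tT); rewrite EA.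
have lift_xi := lift_subset t'T (P_lift xi).
have tautau : 0 <= tau <= tau by rewrite lexx ltW.
have tau_t' : 0 <= tau <= t' by rewrite (ltW tau0) ltW.
have Etau : (gamma tau, P xi tau) = (gamma' tau, p' tau) by rewrite (Pp' tau tautau) -(E tau tautau).
have [_ /regular_rad[_ rad_tau]] := Hp' tau (in_e tau tautau).
have det_tau : 0 < k * det (P xi) tau.
  have [h1 h2] := ctrl tau tautau.
  by rewrite /det -h1 -h2 Etau /v1 /v2 [X in 0 < X](rotation_det kk rad_tau).
have [d d0 Hd] := det_cwithin t'T lift_xi tau_t' det_tau.
pose b := Num.min t' (tau + d / 2).
have taub : tau < b by rewrite lt_min tt' ltrDl divr_gt0.
have bt' : b <= t' by rewrite ge_min lexx.
have bd : b <= tau + d / 2 by rewrite ge_min lexx orbT.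
have in_t' s : tau <= s <= b -> 0 <= s <= t'.
  by move=> /andP[h1 h2]; rewrite (le_trans (ltW tau0) h1) (le_trans h2).
have sgn s : tau <= s <= b -> 0 < k * det (P xi) s.
  move=> sb; have st' := in_t' s sb; case/andP: sb => h1 h2.
  have sD : `[0, t']%classic s by rewrite /= in_itv.
  have sd : `|s - tau| < d by rewrite ger0_norm ?subr_ge0//; lra.
  exact: sign_near kk (Hd s sD sd).
have Gmu s : tau <= s <= b -> G_flow X1 X2 k `[tau, b] (fun r => (gamma r, P xi r)) s.
  move=> sb; have st' := in_t' s sb.
  have [h1 h2 _] := annihilator_sign t'0 t'T lift_xi ann st' kk (sgn s sb).
  have sub : `[tau, b]%classic `<=` `[0, t']%classic.
    by move=> r /=; rewrite !in_itv /= => /in_t'.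
  have := flow_at_subset sub (lift_xi s st').
  have -> // : Z s = vf_lin (k * G_u1 (gamma s, P xi s)) (k * G_u2 (gamma s, P xi s)) X1 X2.
  exact: (f_equal2 (fun a b => vf_lin a b X1 X2) h1 h2).
have Glam s : tau <= s <= b -> G_flow X1 X2 k `[tau, b] (fun r => (gamma' r, p' r)) s.
  have in_te r : tau <= r <= b -> 0 <= r <= tau + eps0.
    by move=> /in_t'/andP[-> h]; exact: le_trans t'e.
  move=> sb; have [H _] := Hp' s (in_te s sb).
  by apply: flow_at_subset H => r /=; rewrite !in_itv /= => /in_te.
have [e e0 He] := G_flow_unique s1 s2 taub rad_tau Glam Gmu (esym Etau).
pose eps := Num.min (b - tau) e.
have eps_gt0 : 0 < eps by rewrite lt_min subr_gt0 taub.
have epsb : tau + eps <= b by rewrite -lerBrDl ge_min lexx.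
have epse : eps <= eps0.
  by rewrite -(lerD2l tau) (le_trans epsb)// (le_trans bt').
apply: (Hneq eps); first by rewrite eps_gt0.
move=> s /andP[s0 se]; case: (leP s tau) => h; first by apply: Heq; rewrite s0.
have sb : tau <= s <= b by rewrite (ltW h) (le_trans se).
have se' : s <= tau + e by rewrite (le_trans se)// lerD2l ge_min lexx orbT.
exact: (congr1 fst (He s sb se')).
Qed.

End Branching.

Theorem theorem3p13 (R : realType) (n : nat) (M : smoothManifold R n)
  (S : subRiemannian2 M) (X1 X2 : vector_field M)
  (frame : orthonormal_frame S X1 X2)
  (T : R) (T_gt0 : 0 < T) (gamma : R -> M)
  (gamma_geo : regular_abnormal_geodesic X1 X2 T gamma)
  (tau : R) (tau_in : 0 < tau < T) :
  regular_abnormal_branching X1 X2 T gamma tau <->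
  ~ (dim_set (abnormal_space X1 X2 gamma t)
       @[t --> within `]0, T] (nbhs tau)]
       --> dim_set (abnormal_space X1 X2 gamma tau)).

Proof.
have [[s1 D1] [s2 D2] _] := frame.
have indep := frame_independent frame.
have [sigma [p0 [ss geo]]] := geodesic_G_flow s1 s2 gamma_geo.
have dimP := dim_continuousP s1 s2 indep T_gt0 geo tau_in.
split=> [br /dimP[t tT E]|ncvg].
  exact: (drop_of_branching s1 s2 indep T_gt0 ss geo tau_in br tT E).
apply: (branching_of_drop s1 s2 indep T_gt0 ss geo tau_in) => t tT E.
by apply: ncvg; apply/dimP; exists t.
Qed.
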